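(* Let $\rho$ be the unique real root of $x^3 = x+1$ and let $\lambda^* := \rho^{1/2} + \rho^{-1/2}$ ($\approx 2.01980$). Fix $-1 \le \beta < 0 \le \alpha < 1$. Set $\lambda = (1-\alpha)/(\alpha-\beta)$ and $p = \lfloor -\alpha/\beta \rfloor + 1$. If $\lambda < \lambda^*$, then $$N_{\alpha,\beta}(d) = \begin{cases} \dfrac{k_p(\lambda)\, d}{k_p(\lambda)-1} + O_{\alpha,\beta}(1) & \text{if } k_p(\lambda) < \infty, \\ d + O_{\alpha,\beta}(1) & \text{otherwise}, \end{cases}$$ where $O_{\alpha,\beta}(1)$ denotes a quantity, depending on $d \in \{1,2,\dots\}$, whose absolute value is bounded by a constant depending only on $\alpha$ and $\beta$.
   Context: $N_{\alpha,\beta}(d)$ denotes the maximum number of unit vectors in $\mathbb{R}^d$ all of whose pairwise inner products lie in $\{\alpha,\beta\}$. A signed graph is a finite simple undirected graph (with at least one vertex) each of whose edges is labeled $+$ or $-$. The eigenvalues of a signed graph $G^\pm$ are those of its signed adjacency matrix, whose $(i,j)$-th entry is $1$ if $ij$ is a positive edge, $-1$ if $ij$ is a negative edge, and $0$ otherwise. $\lambda^1(G^\pm)$ is the largest eigenvalue of $G^\pm$, $|G^\pm|$ is the number of vertices, and $\operatorname{mult}(\lambda, G^\pm)$ is the multiplicity of $\lambda$ as an eigenvalue of $G^\pm$. A valid $p$-coloring of a signed graph $G^\pm$ is a coloring of the vertices using $p$ colors such that the endpoints of every negative edge receive different colors and the endpoints of every positive edge receive identical colors. The chromatic number $\chi(G^\pm)$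 is the smallest $p$ for which $G^\pm$ has a valid $p$-coloring, and $\chi(G^\pm) = \infty$ if there is no such $p$. For $\lambda > 0$ and $p \in \{1,2,\dots\}$, define $$k_p(\lambda) = \inf\left\{\frac{|G^\pm|}{\operatorname{mult}(\lambda, G^\pm)} : \chi(G^\pm) \le p \text{ and } \lambda^1(G^\pm) = \lambda\right\},$$ with $\inf \varnothing = \infty$. *)

(* Defs.v *)
From HB Require Import structures.
From mathcomp Require Import all_boot all_order all_algebra.
From mathcomp Require Import all_classical all_reals all_analysis.
Set Implicit Arguments.
Unset Strict Implicit.
Unset Printing Implicit Defensive.
Import Order.TTheory GRing.Theory Num.Theory.
Local Open Scope classical_set_scope.
Local Open Scope ring_scope.

(* Every finite signed graph is, up to isomorphism, on the vertex set 'I_n. *)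
Record signed_graph (n : nat) := SignedGraph {
  pos_edge : rel 'I_n;
  neg_edge : rel 'I_n;
  pos_edge_sym : symmetric pos_edge;
  neg_edge_sym : symmetric neg_edge;
  pos_edge_irr : irreflexive pos_edge;
  neg_edge_irr : irreflexive neg_edge;
  edge_one_sign : forall i j, ~~ (pos_edge i j && neg_edge i j) }.

Definition signed_adj (R : realType) (n : nat) (G : signed_graph n) : 'M[R]_n :=
  \matrix_(i, j) (if pos_edge G i j then 1
                  else if neg_edge G i j then -1 else 0).

(* The signed adjacency matrix is real symmetric, so its eigenvalues are all
   real, and algebraic and geometric multiplicities agree. *)
Definition is_largest_eigenvalue (R : realType) (n : nat) (G : signed_graph n)
    (lambda : R) : Prop :=
  eigenvalue (signed_adj R G) lambda /\
  forall mu : R, eigenvalue (signed_adj R G) mu -> mu <= lambda.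

Definition mult (R : realType) (n : nat) (lambda : R) (G : signed_graph n) : nat :=
  \rank (eigenspace (signed_adj R G) lambda).

Definition valid_coloring (n p : nat) (G : signed_graph n)
    (c : {ffun 'I_n -> 'I_p}) : bool :=
  [forall i, forall j, (neg_edge G i j ==> (c i != c j)) &&
                       (pos_edge G i j ==> (c i == c j))].

(* Not every colour has to be used. *)
Definition colorable (n : nat) (G : signed_graph n) (p : nat) : bool :=
  [exists c : {ffun 'I_n -> 'I_p}, valid_coloring G c].

Definition chromatic_number (R : realType) (n : nat) (G : signed_graph n) : \bar R :=
  if pselect (exists p, colorable G p) is left ex
  then (ex_minn ex)%:R%:E else +oo%E.

Definition k_ (R : realType) (p : nat) (lambda : R) : \bar R :=
  ereal_inf [set x | exists (n : nat) (G : signed_graph n),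
    [/\ (0 < n)%N, (chromatic_number R G <= p%:R%:E)%E,
        is_largest_eigenvalue G lambda
      & x = (n%:R / (mult lambda G)%:R)%:E]].

(* Explicit Euclidean inner product: the library norm on 'rV[R]_d is the sup
   norm. *)
Definition dot (R : realType) (d : nat) (u v : 'rV[R]_d) : R :=
  \sum_(i < d) u 0 i * v 0 i.

(* For alpha, beta != 1 the vectors v i are automatically distinct. *)
Definition two_distance_code (R : realType) (alpha beta : R) (d n : nat)
    (v : 'I_n -> 'rV[R]_d) : Prop :=
  (forall i, dot (v i) (v i) = 1) /\
  (forall i j, i != j -> dot (v i) (v j) = alpha \/ dot (v i) (v j) = beta).

(* N is the maximum number of vectors in such a code, i.e. N_{alpha,beta}(d). *)
Definition is_max_code_size (R : realType) (alpha beta : R) (d N : nat) : Prop :=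
  (exists v : 'I_N -> 'rV[R]_d, two_distance_code alpha beta v) /\
  (forall (n : nat) (v : 'I_n -> 'rV[R]_d),
     two_distance_code alpha beta v -> (n <= N)%N).

(* Main.v *)
(** Dividing the Gram matrix of a code by alpha - beta gives lambda I - B + gamma J,
  with B the adjacency matrix of the pairs of inner product beta. Positivity and
  Ramsey's theorem bound everything about the graph B up to O(1) vertices: it is
  close to complete p-partite, so B - (the complete p-partite graph) is the matrix
  A of a p-coloured signed graph of bounded degree, and lambda I - A is positive on
  vectors with zero sum on every colour class.

  The threshold enters through an integrality phenomenon. Let a connected signed
  graph of bounded degree have largest eigenvalue < lambda_star and more than a
  constant number of vertices. It contains a long induced path, whose vertices are
  roots e_j - e_(j+1). Adding the vertices one at a time, each new vertex is again
  a root +-e_a +-e_b: the vector f of least energy solving approximately the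
  required inner products is compared with an integral vector, and all other
  integral vectors cost too much. After sorting, the cost is that of a network of
  springs on a half line, whose critical value is exactly rho^(1/2) + rho^(-1/2).
  Hence such a graph is represented by roots, has all eigenvalues at most 2, and
  any obstruction to lambda I - A >= 0 has bounded size; the obstructions are
  removed by deleting O(1) vertices. The rank of the Gram matrix then bounds the
  code size through the ratio |G| / mult(lambda, G) of a graph G with
  lambda^1(G) = lambda.

  Conversely, disjoint copies of a graph attaining k_p(lambda) give a code of the
  right size. The infimum is attained since connected graphs suffice, the degrees
  are bounded, and large connected graphs occur only for lambda = 2; these are
  represented by roots and do no better than the all-negative p x p rook graph
  (p >= 3) or than the triangle (p <= 2). *)
Require Import Defs.
From HB Require Import structures.
From mathcomp Require Import all_boot all_order all_algebra.
From mathcomp Require Import ring lra zify.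
From mathcomp.classical Require Import boolp.
From mathcomp Require Import reals.
Import Order.TTheory GRing.Theory Num.Theory.
Set Implicit Arguments.
Unset Strict Implicit.
Unset Printing Implicit Defensive.
Local Open Scope ring_scope.

(** * Springs on a half line *)

(** The critical value is where two energies meet one budget. Bounding the form of the enlarged
    graph by [2 + e] bounds by [2 + e] the energy [|f|^2 + e^-1 |residual|^2] of a regularised
    solution [f]: coordinates are nodes tied to the ground by unit springs, roots are links of
    stiffness [1 / e]. An infinite tail of such a network has the conductance [C] with
    [C (C + 1) = 1 / e], and [C = 1 / (t - 1)] turns [2 + 1 / (C (C + 1))] into [t + 1 / t]. Two
    failures compete: an integral potential that is nonzero at three coordinates, and a root whose
    inner product disagrees with the potential. Each exceeds the budget under the same polynomial
    inequality, [t^6 <= t^2 + 1], that is [t^2 <= rho]. The strict inequality between lambda and the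
    threshold leaves room for [e < 1 / (C (C + 1))], so that tails of a finite length [m0] already
    have conductance [C]. The estimate sees a spanning tree and a single further root at a time;
    this is why a representation carries a tree. *)

(* For [t = (C + 1) / C] this says [t ^+ 6 <= t ^+ 2 + 1], i.e. [t ^+ 2 <= rho]. *)
Definition subcrit (R : realFieldType) (C : R) : Prop :=
  0 < C /\ 4 * C ^+ 5 + 14 * C ^+ 4 + 20 * C ^+ 3 + 15 * C ^+ 2 + 6 * C + 1 <= C ^+ 6.

Section Numeric.
Variable R : realFieldType.
Implicit Types (a k x y z C w : R).

(** Minimise over [x]: springs of stiffness [a] and [k] in series act as one of stiffness
    [a * k / (a + k)]. *)
Lemma series_springs a k x y : 0 < a -> 0 < k ->
  a * k / (a + k) * y ^+ 2 <= a * x ^+ 2 + k * (x - y) ^+ 2.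
Proof.
move=> a0 k0; rewrite -subr_ge0.
suff -> : a * x ^+ 2 + k * (x - y) ^+ 2 - a * k / (a + k) * y ^+ 2
   = ((a + k) * x - k * y) ^+ 2 / (a + k).
  by rewrite mulr_ge0 ?sqr_ge0 // invr_ge0 ltW // addr_gt0.
by field; apply: lt0r_neq0; rewrite addr_gt0.
Qed.

(** The critical [C] is about 6.62; this crude bound serves wherever an estimate has room. *)
Lemma subcrit_ge6 C : subcrit C -> 6 <= C.
Proof.
case=> C0 h; rewrite leNgt; apply/negP => C6.
have h3 : 0 < C ^+ 3 by rewrite exprn_gt0.
have h4 : 0 < C ^+ 4 by rewrite exprn_gt0.
have h2 : 0 < C ^+ 2 by rewrite exprn_gt0.
have h5 : C ^+ 5 <= 6 * C ^+ 4 by rewrite (exprS C 4) ler_pM2r // ltW.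
have h6 : C ^+ 6 <= 6 * C ^+ 5 by rewrite (exprS C 5) ler_pM2r ?exprn_gt0 // ltW.
lra.
Qed.

(** Three sorted coordinates with nonzero potential, then a tail of conductance [C]. Eliminating
    [w0], [w1], [w2] in turn gives the exact minimum, so the bound is sharp at the critical [C]. *)
Lemma three_high C w0 w1 w2 (k := C * (C + 1)) : subcrit C ->
  2 + k^-1 <= (1 - w0) ^+ 2 + (1 - w1) ^+ 2 + (1 - w2) ^+ 2
    + k * ((w0 - w1) ^+ 2 + (w1 - w2) ^+ 2) + C * w2 ^+ 2.
Proof.
move=> hC; have C6 := subcrit_ge6 hC; case: hC => C0 hC.
have k0 : 0 < k by rewrite /k mulr_gt0 //; lra.
have h0 := @series_springs 1 k (1 - w0) (1 - w1) ltr01 k0.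
set a1 := 1 + 1 * k / (1 + k).
have d1 : 0 < 1 + k by lra.
have a10 : 0 < a1 by rewrite /a1 mul1r addr_gt0 // divr_gt0.
have h1 := @series_springs a1 k (1 - w1) (1 - w2) a10 k0.
set a2 := 1 + a1 * k / (a1 + k).
have d2 : 0 < a1 + k by lra.
have a20 : 0 < a2 by rewrite /a2 addr_gt0 // divr_gt0 // mulr_gt0.
have h2 := @series_springs C a2 w2 1 C0 a20.
have d3 : 0 < a2 + C by lra.
have : 2 + k^-1 <= C * a2 / (C + a2).
  have e2 : a2 = (3 * k + 1) * (k + 1) / (k ^+ 2 + 3 * k + 1).
    rewrite /a2 /a1; field.
    by do ? (apply/andP; split); apply: lt0r_neq0 => //; nra.
  have q0 : 0 < k ^+ 2 + 3 * k + 1 by nra.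
  rewrite ler_pdivlMr ?(addrC C) //.
  rewrite -subr_ge0.
  (* The excess over the budget has the polynomial of [subcrit] as a factor. *)
  suff -> : C * a2 - (2 + k^-1) * (a2 + C) = (C + 1) *
     (C ^+ 6 - (4 * C ^+ 5 + 14 * C ^+ 4 + 20 * C ^+ 3 + 15 * C ^+ 2 + 6 * C + 1))
       / (k * (k ^+ 2 + 3 * k + 1)).
    by rewrite divr_ge0 ?mulr_ge0 ?subr_ge0 // ?ltW //; lra.
  rewrite e2 /k; field.
  by do ? (apply/andP; split); apply: lt0r_neq0 => //; rewrite -/k; lra.
move: h0 h1 h2; rewrite /a2 /a1.
move: (a1 * k / (a1 + k)) (1 * k / (1 + k)) => A B.
rewrite !expr1n !mulr1 => h0 h1 h2 h3.
lra.
Qed.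

(** The tangent of the square at [m]. It replaces [z] by its lower bound [a] whatever the sign of
    [a]. *)
Lemma sq_minorant k m z a : 0 <= k -> 0 <= m -> a <= z ->
  k * (2 * m * a - m ^+ 2) <= k * z ^+ 2.
Proof.
move=> k0 m0 az; apply: ler_wpM2l => //.
have := sqr_ge0 (z - m); have : 0 <= m * (z - a) by rewrite mulr_ge0 ?subr_ge0.
lra.
Qed.

(** The right-hand side is the least energy when one constraint fails and at most one coordinate is
    nonzero. Its excess over the budget again has the polynomial of [subcrit] as numerator. *)
Lemma defect_value C (k := C * (C + 1)) : subcrit C ->
  2 + k^-1 <= k / (2 * (1 + 2 * k)) + k / (2 * (1 + 2 * C)).
Proof.
move=> hC; have C6 := subcrit_ge6 hC; case: hC => C0 hC.
have k0 : 0 < k by rewrite /k mulr_gt0 //; lra.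
rewrite -subr_ge0.
suff -> : k / (2 * (1 + 2 * k)) + k / (2 * (1 + 2 * C)) - (2 + k^-1) =
   (C ^+ 6 - (4 * C ^+ 5 + 14 * C ^+ 4 + 20 * C ^+ 3 + 15 * C ^+ 2 + 6 * C + 1))
     / (k * (1 + 2 * k) * (1 + 2 * C)).
  rewrite divr_ge0 ?subr_ge0 // ltW // mulr_gt0 ?mulr_gt0 //; lra.
rewrite /k; field.
by do ? (apply/andP; split); apply: lt0r_neq0 => //; rewrite -/k; lra.
Qed.

(** The potential vanishes and one further constraint fails by [z]. The pair [u0], [u1] minimises
    the energy with [z] at its lower bound, so what remains is a sum of squares around it. The next
    two lemmas do the same for one and two nonzero values. *)
Lemma defect_none C w0 w1 z (k := C * (C + 1)) : subcrit C -> 1 - w0 - w1 <= z ->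
  2 + k^-1 <= w0 ^+ 2 + w1 ^+ 2 + k * ((w0 - w1) ^+ 2 + z ^+ 2) + C * w1 ^+ 2.
Proof.
move=> hC hz; have C6 := subcrit_ge6 hC; have := defect_value hC; case: hC => C0 hC.
have k0 : 0 < k by rewrite /k mulr_gt0 //; lra.
rewrite -/k => hv.
set u0 := k / (1 + 2 * k); set u1 := C / (1 + 2 * C).
(* These two bounds make the tangent point [1 - u0 - u1] nonnegative. *)
have U0 : u0 <= 1/2 by rewrite /u0 ler_pdivrMr; lra.
have U1 : u1 <= 1/2 by rewrite /u1 ler_pdivrMr; lra.
have hm := @sq_minorant k (1 - u0 - u1) z (1 - w0 - w1) (ltW k0) ltac:(lra) hz.
have p0 := sqr_ge0 (w0 - u0); have p1 := sqr_ge0 (w1 - u1).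
have p2 := sqr_ge0 ((w0 - u0) - (w1 - u1)).
have q1 : 0 <= (1 + C) * (w1 - u1) ^+ 2 by rewrite mulr_ge0 //; lra.
have q2 : 0 <= k * ((w0 - u0) - (w1 - u1)) ^+ 2 by rewrite mulr_ge0 // ltW.
suff E : w0 ^+ 2 + w1 ^+ 2 + k * (w0 - w1) ^+ 2 + C * w1 ^+ 2
   + k * (2 * (1 - u0 - u1) * (1 - w0 - w1) - (1 - u0 - u1) ^+ 2)
   = k / (2 * (1 + 2 * k)) + k / (2 * (1 + 2 * C)) + (w0 - u0) ^+ 2
     + (1 + C) * (w1 - u1) ^+ 2 + k * ((w0 - u0) - (w1 - u1)) ^+ 2 by lra.
rewrite /u0 /u1 /k; field.
by do ? (apply/andP; split); apply: lt0r_neq0 => //; rewrite -/k; lra.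
Qed.

Lemma defect_one C w0 w1 z (k := C * (C + 1)) : subcrit C -> 1 - w0 - w1 <= z ->
  2 + k^-1 <= (1 - w0) ^+ 2 + w1 ^+ 2 + k * ((w0 - w1) ^+ 2 + z ^+ 2) + C * w1 ^+ 2.
Proof.
move=> hC hz; have C6 := subcrit_ge6 hC; have := defect_value hC; case: hC => C0 hC.
have k1 : 42 <= k by rewrite /k; nra.
have k0 : 0 < k by lra.
rewrite -/k => hv.
set u0 := (1 + k) / (1 + 2 * k); set u1 := C / (1 + 2 * C).
have U0 : u0 <= 1/2 + (2 * (1 + 2 * k))^-1.
  rewrite /u0 le_eqVlt; apply/orP; left; apply/eqP; field.
  by apply: lt0r_neq0; lra.
have U1 : u1 = 1/2 - (2 * (1 + 2 * C))^-1.
  by rewrite /u1; field; apply: lt0r_neq0; lra.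
have Ck : (2 * (1 + 2 * k))^-1 <= (2 * (1 + 2 * C))^-1.
  by rewrite lef_pV2 ?posrE; [rewrite /k; nra|lra|lra].
have hm := @sq_minorant k (1 - u0 - u1) z (1 - w0 - w1) (ltW k0) ltac:(lra) hz.
have p0 := sqr_ge0 (w0 - u0).
have q1 : 0 <= (1 + C) * (w1 - u1) ^+ 2 by rewrite mulr_ge0 ?sqr_ge0 //; lra.
have q2 : 0 <= k * ((w0 - u0) - (w1 - u1)) ^+ 2 by rewrite mulr_ge0 ?sqr_ge0 // ltW.
suff E : (1 - w0) ^+ 2 + w1 ^+ 2 + k * (w0 - w1) ^+ 2 + C * w1 ^+ 2
   + k * (2 * (1 - u0 - u1) * (1 - w0 - w1) - (1 - u0 - u1) ^+ 2)
   = k / (2 * (1 + 2 * k)) + k / (2 * (1 + 2 * C)) + (w0 - u0) ^+ 2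
     + (1 + C) * (w1 - u1) ^+ 2 + k * ((w0 - u0) - (w1 - u1)) ^+ 2 by lra.
rewrite /u0 /u1 /k; field.
by do ? (apply/andP; split); apply: lt0r_neq0 => //; rewrite -/k; lra.
Qed.

Lemma defect_two C w0 w1 z (k := C * (C + 1)) : subcrit C -> 1 - w0 - w1 <= z ->
  2 + k^-1 <= (1 - w0) ^+ 2 + (1 - w1) ^+ 2 + k * ((w0 - w1) ^+ 2 + z ^+ 2) + C * w1 ^+ 2.
Proof.
move=> hC hz; have C6 := subcrit_ge6 hC; have := defect_value hC; case: hC => C0 hC.
have k1 : 42 <= k by rewrite /k; nra.
have k0 : 0 < k by lra.
rewrite -/k => hv.
set d := 1 + C + 2 * k.
have d0 : 0 < d by rewrite /d; lra.
set u0 := (1 + k) / (1 + 2 * k); set u1 := (k + 1) / d.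
have U0 : u0 = 1/2 + (2 * (1 + 2 * k))^-1.
  by rewrite /u0; field; apply: lt0r_neq0; lra.
have U1 : u1 = 1/2 - (C - 1) / (2 * d).
  by rewrite /u1 /d; field; apply: lt0r_neq0; rewrite -/d.
have Ck : (2 * (1 + 2 * k))^-1 <= (C - 1) / (2 * d).
  rewrite ler_pdivlMr ?ler_pdivrMl //; try lra.
  rewrite /d; nra.
have hm := @sq_minorant k (1 - u0 - u1) z (1 - w0 - w1) (ltW k0) ltac:(lra) hz.
have p0 := sqr_ge0 (w0 - u0).
have q1 : 0 <= (1 + C) * (w1 - u1) ^+ 2 by rewrite mulr_ge0 ?sqr_ge0 //; lra.
have q2 : 0 <= k * ((w0 - u0) - (w1 - u1)) ^+ 2 by rewrite mulr_ge0 ?sqr_ge0 // ltW.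
(* Two nonzero values cost [C / d] more than none or one. *)
have q3 : 0 <= C / d by rewrite divr_ge0 // ltW.
suff E : (1 - w0) ^+ 2 + (1 - w1) ^+ 2 + k * (w0 - w1) ^+ 2 + C * w1 ^+ 2
   + k * (2 * (1 - u0 - u1) * (1 - w0 - w1) - (1 - u0 - u1) ^+ 2)
   = k / (2 * (1 + 2 * k)) + k / (2 * (1 + 2 * C)) + C / d + (w0 - u0) ^+ 2
     + (1 + C) * (w1 - u1) ^+ 2 + k * ((w0 - u0) - (w1 - u1)) ^+ 2 by lra.
rewrite /u0 /u1 /d /k; field.
by do ? (apply/andP; split); apply: lt0r_neq0 => //; rewrite -/k; lra.
Qed.

(** A value 2 next to a value 1. The energy is far above the budget, so [6 <= C] and [42 <= k]
    suffice. *)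
Lemma high_two C w0 w1 (k := C * (C + 1)) : subcrit C ->
  2 + k^-1 <= (2 - w0) ^+ 2 + (1 - w1) ^+ 2 + k * (w0 - w1) ^+ 2 + C * w1 ^+ 2.
Proof.
move=> hC; have C6 := subcrit_ge6 hC; case: hC => C0 hC.
have k1 : 42 <= k by rewrite /k; nra.
have k0 : 0 < k by lra.
have ki : k^-1 <= 1/42 by rewrite invf_ple ?posrE; lra.
have p0 := sqr_ge0 (w0 - w1); have p1 := sqr_ge0 w1.
have q1 : 6 * w1 ^+ 2 <= C * w1 ^+ 2 by rewrite ler_wpM2r.
have q2 : 42 * (w0 - w1) ^+ 2 <= k * (w0 - w1) ^+ 2 by rewrite ler_wpM2r.
(* The square vanishes at the best [w0] for stiffness 42, and 3/8 is close to the best [w1]. *)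
have := sqr_ge0 (43 * (w0 - w1) - (2 - w1)).
have := sqr_ge0 (w1 - 3/8).
nra.
Qed.

End Numeric.

(** * Conductance of a finite tail *)

Section Tail.
Variable R : archiRealFieldType.
Implicit Types (e C : R) (W : nat -> R).

(* [tail_conductance e m] is the least value of
   [\sum_(0 < i <= m) W i ^+ 2 + e^-1 * \sum_(i < m) (W i - W i.+1) ^+ 2]
   subject to [W 0 = 1]. *)
Fixpoint tail_conductance e (m : nat) : R :=
  if m is m'.+1 then (1 + tail_conductance e m') / (1 + e * (1 + tail_conductance e m'))
  else 0.

Lemma tail_conductance_ge0 e m : 0 < e -> 0 <= tail_conductance e m.
Proof.
move=> e0; elim: m => //= m IH; rewrite divr_ge0 ?addr_ge0 // mulr_ge0 ?addr_ge0 //.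
exact: ltW.
Qed.

Lemma tail_energy e W j m : 0 < e ->
  tail_conductance e m * W j ^+ 2 <=
  \sum_(j <= i < j + m) (W i.+1 ^+ 2 + e^-1 * (W i - W i.+1) ^+ 2).
Proof.
move=> e0; elim: m j => [|m IH] j /=; first by rewrite mul0r addn0 big_geq.
rewrite addnS big_ltn ?ltnS ?leq_addr // -addSn.
have := IH j.+1; set c := tail_conductance e m.
have c0 : 0 <= c by exact: tail_conductance_ge0.
have ei : 0 < e^-1 by rewrite invr_gt0.
have := @series_springs _ (1 + c) e^-1 (W j.+1) (W j) ltac:(lra) ei.
have -> : (1 + c) * e^-1 / (1 + c + e^-1) = (1 + c) / (1 + e * (1 + c)).
  field; do ? (apply/andP; split); apply: lt0r_neq0 => //; nra.
rewrite -[(W j - _) ^+ 2]sqrrN opprB; lra.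
Qed.

(** One step of the recursion raises [c] by [(1 - e c (c + 1)) / (1 + e (1 + c))]. This is at least
    [d] as long as [c <= C], and a value above [C] stays above it. *)
Lemma tail_conductance_lim e C : 0 < e -> 0 < C -> e * (C * (C + 1)) < 1 ->
  exists m0 : nat, forall m, (m0 <= m)%N -> C <= tail_conductance e m.
Proof.
move=> e0 C0 eC.
pose d := (1 - e * (C * (C + 1))) / (1 + e * (1 + C)).
have pos x : 0 <= x -> 0 < 1 + e * (1 + x).
  by move=> x0; rewrite ltr_wpDr // mulr_ge0 ?addr_ge0 // ltW.
have D0 := pos C (ltW C0).
have d0 : 0 < d by rewrite /d divr_gt0 //; lra.
have step c : 0 <= c -> c <= C -> c + d <= (1 + c) / (1 + e * (1 + c)).
  move=> c0 cC; have E0 : 0 < 1 + e * (1 + c) by apply: pos; lra.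
  rewrite -lerBrDl.
  have -> : (1 + c) / (1 + e * (1 + c)) - c
     = (1 - e * (c * (c + 1))) / (1 + e * (1 + c)).
    by field; apply: lt0r_neq0.
  have h1 : 1 - e * (C * (C + 1)) <= 1 - e * (c * (c + 1)).
    by rewrite lerB // ler_wpM2l ?(ltW e0) // ler_pM ?lerD2r ?addr_ge0.
  rewrite /d ler_pdivlMr // mulrAC ler_pdivrMr //.
  by apply: ler_pM => //; [lra|lra|nra].
have big c : C <= c -> C <= (1 + c) / (1 + e * (1 + c)).
  move=> cC; have E0 : 0 < 1 + e * (1 + c) by apply: pos; lra.
  rewrite ler_pdivlMr //.
  have : e * (C * (C + 1)) + e * C * (c - C) <= 1 + (c - C).
    have eC1 : e * C <= 1 by nra.
    have : e * C * (c - C) <= 1 * (c - C) by apply: ler_wpM2r => //; lra.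
    lra.
  lra.
exists (Num.bound (C / d)) => m hm.
have [hC|hC] := lerP C (m%:R * d).
  have : Num.min C (m%:R * d) <= tail_conductance e m.
    elim: m {hm hC} => [|m IH] /=; first by rewrite mul0r ge_min lexx orbT.
    have c0 := tail_conductance_ge0 m e0.
    set c := tail_conductance e m in IH c0 *.
    have [hc|/ltW hc] := lerP C c; first by rewrite ge_min; apply/orP; left; apply: big.
    have h := step c c0 hc; rewrite -natr1 [X in Num.min C X]mulrDl mul1r ge_min.
    move: IH; rewrite ge_min => /orP[h'|h']; first by apply/orP; left; apply: big.
    by apply/orP; right; apply: le_trans h; rewrite lerD2r.
  by rewrite ge_min => /orP[//|]; apply: le_trans.
exfalso; move: hC; apply/negP; rewrite -leNgt -ler_pdivrMr //.
apply: le_trans (ltW (archi_boundP _)) _; last by rewrite ler_nat.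
by rewrite divr_ge0 // ltW.
Qed.
End Tail.

(** * Rearranging a function on a tree into a decreasing sequence *)

Section Rearrangement.
Variable R : realDomainType.
Implicit Types (w W : nat -> R).

Lemma sum_nat_split (F : nat -> R) a b c : (a <= b)%N -> (b <= c)%N ->
  \sum_(a <= i < c) F i = \sum_(a <= i < b) F i + \sum_(b <= i < c) F i.
Proof. by move=> ab bc; exact: big_cat_nat. Qed.

Lemma sum_sq_gaps W a b : (a <= b)%N ->
  (forall i, (a <= i < b)%N -> W i.+1 <= W i) ->
  \sum_(a <= i < b) (W i - W i.+1) ^+ 2 <= (W a - W b) ^+ 2 /\ W b <= W a.
Proof.
move=> ab; rewrite -(subnKC ab); elim: (b - a)%N => [|m IH] h.
  by rewrite addn0 big_geq // sqr_ge0.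
have [|h1 h2] := IH.
  by move=> i /andP[ai im]; apply: h; rewrite ai addnS ltnS ltnW.
have h3 : W (a + m).+1 <= W (a + m)%N by apply: h; rewrite leq_addr addnS /=.
rewrite addnS big_nat_recr ?leq_addr //=; split; last exact: le_trans h2.
nra.
Qed.

(** Otherwise [X] is constant from child to parent, hence equal to its value at the root [0]. *)
Lemma tree_connected (par : nat -> nat) n (X : pred nat) i k :
  (forall j, (0 < j < n)%N -> (par j < j)%N) ->
  (i < n)%N -> (k < n)%N -> X i -> ~~ X k ->
  exists2 j, (0 < j < n)%N & X j != X (par j).
Proof.
move=> hp hi hk Xi Xk.
case: (boolP (has (fun j => X j != X (par j)) (iota 1 n.-1))).
  by case/hasP => j; rewrite mem_iota => /andP[j0 jn] h; exists j => //; lia.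
move/hasPn => H; exfalso.
have all0 j : (j < n)%N -> X j = X 0%N.
  elim/ltn_ind: j => -[//|j] IH hj.
  have /negPn/eqP -> : ~~ (X j.+1 != X (par j.+1)) by apply: H; rewrite mem_iota; lia.
  apply: IH; rewrite ?hp //; exact: ltn_trans (hp _ _) _.
by move: Xk; rewrite all0 // -(all0 i) // Xi.
Qed.

(** [W] lists the values of [w] in decreasing order. Every gap between consecutive values is
    straddled by some tree edge, and the square of a tree edge dominates the sum of the squares of
    the gaps it straddles. So the half line is the cheapest tree. *)
Lemma tree_rearrangement n (par : nat -> nat) w :
  (forall j, (0 < j < n)%N -> (par j < j)%N) ->
  exists W : nat -> R,
  [/\ forall F : R -> R, \sum_(0 <= j < n) F (w j) = \sum_(0 <= i < n) F (W i),
      forall S : pred nat, \sum_(0 <= j < n | S j) w j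
         <= \sum_(0 <= i < count S (index_iota 0 n)) W i &
      \sum_(0 <= i < n.-1) (W i - W i.+1) ^+ 2
         <= \sum_(1 <= j < n) (w j - w (par j)) ^+ 2].
Proof.
move=> hp.
pose sg := sort (fun i j => w j <= w i) (iota 0 n).
have tot : total (fun i j => w j <= w i) by move=> i j; exact: le_total.
have trn : transitive (fun i j => w j <= w i) by move=> j i k h1 h2; exact: le_trans h1.
have pe : perm_eq sg (iota 0 n) by rewrite perm_sort.
have sz : size sg = n by rewrite size_sort size_iota.
have uq : uniq sg by rewrite sort_uniq iota_uniq.
pose W i := w (nth 0%N sg i).
have memsg j : (j \in sg) = (j < n)%N by rewrite (perm_mem pe) mem_iota.
have Wmono i k : (i <= k)%N -> (k < n)%N -> W k <= W i.
  move=> ik kn; have := sort_sorted tot (iota 0 n); rewrite -/sg => srt.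
  have := sorted_leq_nth trn (fun x => lexx _) 0%N srt.
  by apply; rewrite ?inE ?sz //; exact: leq_ltn_trans kn.
have sumW (P : pred nat) (F : nat -> R) : \sum_(0 <= j < n | P j) F j =
    \sum_(0 <= i < n | P (nth 0%N sg i)) F (nth 0%N sg i).
  by rewrite -[in RHS]sz -(big_nth 0%N P F) (perm_big _ pe) /index_iota subn0.
exists W; split=> [F|S|].
- exact: (sumW xpredT (fun j => F (w j))).
- set N := count _ _.
  have hN : (N <= n)%N by rewrite /N (leq_trans (count_size _ _)) // size_iota subn0.
  have -> : \sum_(0 <= j < n | S j) w j = \sum_(0 <= i < n | S (nth 0%N sg i)) W i.
    exact: sumW.
  have cN : (\sum_(0 <= i < n) S (nth 0%N sg i))%N = N.
    have -> : N = (\sum_(i <- sg) S i)%N.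
      rewrite (perm_big _ pe) /N -sum1_count [LHS]big_mkcond /index_iota subn0.
      by apply: eq_bigr => i _; case: (S i).
    by rewrite [RHS](big_nth 0%N) sz.
  case: (posnP N) => [N0|N0].
    rewrite N0 [X in _ <= X]big_geq // big_mkcond big1_seq // => i /= hi.
    move: cN; rewrite N0 => /eqP; rewrite sum_nat_seq_eq0 => /allP/(_ i hi) /=.
    by case: (S _).
  (* After subtracting the smallest of the [N] largest values the comparison holds term by term. *)
  pose c := W N.-1.
  have E1 : \sum_(0 <= i < n | S (nth 0%N sg i)) W i =
     \sum_(0 <= i < n) (S (nth 0%N sg i))%:R * (W i - c) + N%:R * c.
    rewrite -[in N%:R]cN natr_sum mulr_suml -big_split big_mkcond /=.
    by apply: eq_bigr => i _; case: (S _); rewrite /= ?mul1r ?mul0r ?subrK ?addr0.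
  have E2 : \sum_(0 <= i < N) W i = \sum_(0 <= i < n) (i < N)%N%:R * (W i - c) + N%:R * c.
    have -> : N%:R * c = \sum_(0 <= i < N) c by rewrite big_const_nat subn0 iter_addr_0 mulr_natl.
    rewrite (@sum_nat_split (fun i => (i < N)%N%:R * (W i - c)) 0 N n) //.
    have -> : \sum_(N <= i < n) (i < N)%N%:R * (W i - c) = 0.
      by apply: big1_seq => i /=; rewrite mem_index_iota => /andP[h _]; rewrite ltnNge h mul0r.
    rewrite addr0 -big_split /=; apply: eq_big_nat => i /andP[_ ->].
    by rewrite mul1r subrK.
  rewrite E1 E2 lerD2r; apply: ler_sum_nat => i /andP[_ iN].
  have [h|h] := ltnP i N.
    have : c <= W i by apply: Wmono; lia.
    by case: (S _); rewrite /= ?mul0r ?mul1r ?subr_ge0.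
  have : W i <= c by apply: Wmono; lia.
  by case: (S _); rewrite /= ?mul0r ?mul1r ?subr_le0.
(* The test [rk j <= i] says that [j] lies on the high side of gap [i]; an edge straddles the gap
   when its ends give different answers. *)
pose rk j := index j sg.
have rkn j : (j < n)%N -> (rk j < n)%N by move=> h; rewrite -sz index_mem memsg.
have Wrk j : (j < n)%N -> W (rk j) = w j by move=> h; rewrite /W nth_index // memsg.
have key j : (0 < j < n)%N ->
   \sum_(0 <= i < n.-1) ((rk j <= i) != (rk (par j) <= i))%N%:R * (W i - W i.+1) ^+ 2
     <= (w j - w (par j)) ^+ 2.
  move=> hj; have hpj : (par j < n)%N by have := hp _ hj; lia.
  have hjn : (j < n)%N by lia.
  rewrite -(Wrk _ hpj) -(Wrk _ hjn); move: (rkn _ hpj) (rkn _ hjn).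
  move: (rk j) (rk (par j)) => a b hb ha.
  wlog ab : a b ha hb / (a <= b)%N.
    move=> H; case: (leqP a b) => [|/ltnW] h; first exact: H.
    have := H b a hb ha h; rewrite -[(W b - _) ^+ 2]sqrrN opprB.
    by apply: le_trans; apply: ler_sum => i _; rewrite eq_sym.
  have [] := @sum_sq_gaps W a b ab.
    by move=> i /andP[ai ib]; apply: Wmono => //; lia.
  move=> h _; apply: le_trans h.
  pose G i := ((a <= i) != (b <= i))%N%:R * (W i - W i.+1) ^+ 2.
  change (\sum_(0 <= i < n.-1) G i <= \sum_(a <= i < b) (W i - W i.+1) ^+ 2).
  have an : (a <= n.-1)%N by lia.
  have bn : (b <= n.-1)%N by lia.
  rewrite (sum_nat_split G (leq0n a) an) (sum_nat_split G ab bn).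
  have -> : \sum_(0 <= i < a) G i = 0.
    apply: big1_seq => i /=; rewrite mem_index_iota /G => /andP[_ h].
    have -> : (a <= i)%N = false by lia.
    have -> : (b <= i)%N = false by lia.
    by rewrite eqxx mul0r.
  have -> : \sum_(b <= i < n.-1) G i = 0.
    apply: big1_seq => i /=; rewrite mem_index_iota /G => /andP[h _].
    by rewrite h (leq_trans ab) // eqxx mul0r.
  rewrite add0r addr0; apply: ler_sum => i _; rewrite /G.
  by case: (_ != _); rewrite ?mul1r ?mul0r ?sqr_ge0.
have h1 : \sum_(1 <= j < n) \sum_(0 <= i < n.-1)
      ((rk j <= i) != (rk (par j) <= i))%N%:R * (W i - W i.+1) ^+ 2
   <= \sum_(1 <= j < n) (w j - w (par j)) ^+ 2.
  by apply: ler_sum_nat => j hj; apply: key.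
apply: le_trans h1; rewrite exchange_big /=.
apply: ler_sum_nat => i /andP[_ hi].
have [] := @tree_connected par n (fun j => rk j <= i)%N (nth 0%N sg 0) (nth 0%N sg i.+1) hp.
- by rewrite -memsg mem_nth // sz; lia.
- by rewrite -memsg mem_nth // sz; lia.
- by rewrite /rk index_uniq ?sz //; lia.
- by rewrite /rk index_uniq ?sz ?ltnn //; lia.
move=> j hj hne; rewrite (bigD1_seq j) /= ?mem_index_iota //; last exact: iota_uniq.
rewrite hne mul1r lerDl sumr_ge0 // => k _.
by rewrite mulr_ge0 ?sqr_ge0.
Qed.
End Rearrangement.

(** * Integral potentials of low energy *)

Section HalfLine.
Variable R : archiRealFieldType.
Variables (e C : R) (m0 : nat).
Hypotheses (e0 : 0 < e) (hC : subcrit C) (eC : e < (C * (C + 1))^-1)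
  (hm0 : forall m, (m0 <= m)%N -> C <= tail_conductance e m).
Implicit Types (W w f : nat -> R) (n N : nat).
Local Notation k := (C * (C + 1)).

Lemma k_ge42 : 42 <= k.
Proof. by have := subcrit_ge6 hC; nra. Qed.

Lemma k_le_einv : k <= e^-1.
Proof.
have k0 : 0 < k by have := k_ge42; lra.
by rewrite -(invrK k) lef_pV2 ?posrE ?invr_gt0 // ltW.
Qed.

Lemma tail_bound W n j : (j < n)%N -> (m0 <= n.-1 - j)%N ->
  C * W j ^+ 2 <= \sum_(j.+1 <= i < n) W i ^+ 2
     + e^-1 * \sum_(j <= i < n.-1) (W i - W i.+1) ^+ 2.
Proof.
move=> jn hm; have := tail_energy W j (n.-1 - j) e0.
have -> : (j + (n.-1 - j) = n.-1)%N by lia.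
rewrite big_split /= -mulr_sumr => h.
apply: le_trans (ler_wpM2r (sqr_ge0 _) (hm0 hm)) (le_trans h _).
rewrite lerD2r; case: n jn {hm h} => // n jn /=.
by rewrite big_add1.
Qed.

(** A zero costs [w ^+ 2] and a nonzero integer [(1 - w) ^+ 2]. The error is clipped at 1 so that
    the second bound survives a large [|x - y|]. *)
Lemma vertex_cost (x : int) (y : R) (w := Num.min `|x%:~R - y| 1) :
  w ^+ 2 + (x != 0)%:R * (1 - 2 * w) <= y ^+ 2.
Proof.
rewrite /w; have [->|x0] := eqVneq x 0.
  rewrite mul0r addr0 sub0r normrN; case: (leP `|y| 1) => h.
    by rewrite real_normK ?num_real.
  by rewrite expr1n -(real_normK (num_real y)); nra.
rewrite mul1r.
have h1 : (1 : R) <= `|x%:~R| by rewrite -intr_norm ler1z; lia.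
have h2 : `|x%:~R : R| - `|x%:~R - y| <= `|y|.
  by rewrite lerBlDr -{1}(subrK y x%:~R) addrC ler_normD.
rewrite -(real_normK (num_real y)).
have := normr_ge0 y; have := normr_ge0 (x%:~R - y).
case: (leP `|x%:~R - y| 1); nra.
Qed.

Lemma min1_lip (x y : R) : (Num.min `|x| 1 - Num.min `|y| 1) ^+ 2 <= (x - y) ^+ 2.
Proof.
rewrite -(real_normK (num_real (x - y))).
have h1 : `|x| - `|y| <= `|x - y| by exact: lerB_dist.
have h2 : `|y| - `|x| <= `|x - y| by rewrite distrC; exact: lerB_dist.
have := normr_ge0 (x - y).
case: (leP `|x| 1); case: (leP `|y| 1) => a b c.
- have := normr_ge0 x; have := normr_ge0 y; nra.
- have := normr_ge0 x; have := normr_ge0 y; nra.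
- have := normr_ge0 x; have := normr_ge0 y; nra.
- nra.
Qed.

Lemma count_pred2 n a b : a != b -> (a < n)%N -> (b < n)%N ->
  count (pred2 a b) (index_iota 0 n) = 2%N.
Proof.
move=> ab an bn; rewrite (@eq_count _ _ (predU (pred1 a) (pred1 b))) //.
have := count_predUI (pred1 a) (pred1 b) (index_iota 0 n).
rewrite (@eq_count _ (predI _ _) pred0) ?count_pred0 ?addn0.
  by rewrite !count_uniq_mem ?iota_uniq // !mem_index_iota an bn.
by move=> x /=; case: eqP => // ->; rewrite (negbTE ab).
Qed.

Lemma sum_pred2 w n a b : a != b -> (a < n)%N -> (b < n)%N ->
  \sum_(0 <= j < n | pred2 a b j) w j = w a + w b.
Proof.
move=> ab an bn; rewrite big_mkcond.
rewrite (eq_bigr (fun j => (if j == a then w j else 0) + (if j == b then w j else 0))).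
  by rewrite big_split -!big_mkcond !big_nat1_eq /= an bn.
move=> j _ /=; case: (eqVneq j a) => [->|]; first by rewrite (negbTE ab) addr0.
by case: (j == b); rewrite ?add0r.
Qed.

Section Potential.
Variables (n : nat) (par : nat -> nat) (f : nat -> R) (fb : nat -> int).
Hypothesis hpar : forall j, (0 < j < n)%N -> (par j < j)%N.
Hypothesis hinc : forall j, (0 < j < n)%N -> `|fb j - fb (par j)| <= 1.

Definition vertex_energy := \sum_(0 <= j < n) f j ^+ 2.
(** The increments of [fb] are the prescribed ones; those of [f] only approximate them. *)
Definition tree_energy := \sum_(1 <= j < n)
  ((fb j - fb (par j))%:~R - (f j - f (par j))) ^+ 2.
Let supp := [pred j | fb j != 0].
Let N := count supp (index_iota 0 n).

(** Moving the support of [fb] onto the [N] largest errors only lowers the energy. The left-hand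
    side of the first bound is the sum of [(1 - W i) ^+ 2] for [i < N] and of [W i ^+ 2] beyond. *)
Lemma clipped_rearrangement : exists W : nat -> R,
  [/\ \sum_(0 <= i < n) W i ^+ 2 + N%:R - 2 * \sum_(0 <= i < N) W i <= vertex_energy,
      \sum_(0 <= i < n.-1) (W i - W i.+1) ^+ 2 <= tree_energy &
      forall a b, a != b -> (a < n)%N -> (b < n)%N ->
        Num.min `|(fb a)%:~R - f a| 1 + Num.min `|(fb b)%:~R - f b| 1 <= W 0%N + W 1%N].
Proof.
pose w j := Num.min `|(fb j)%:~R - f j| 1.
have [W [h1 h2 h3]] := @tree_rearrangement _ n par w hpar.
exists W; split.
- rewrite -(h1 (fun x => x ^+ 2)).
  have E : \sum_(0 <= j < n) (w j ^+ 2 + (supp j)%:R * (1 - 2 * w j))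
     = \sum_(0 <= j < n) w j ^+ 2 + N%:R - 2 * \sum_(0 <= j < n | supp j) w j.
    rewrite big_split -addrA; congr (_ + _).
    rewrite /N -sum1_count natr_sum mulr_sumr -sumrB [RHS]big_mkcond /=.
    by apply: eq_bigr => j _; case: (fb j != 0); rewrite ?mul1r ?mul0r.
  have H : \sum_(0 <= j < n) (w j ^+ 2 + (supp j)%:R * (1 - 2 * w j)) <= vertex_energy.
    by apply: ler_sum => j _; exact: vertex_cost.
  by have := h2 supp; rewrite E in H; rewrite -/N; lra.
- apply: le_trans h3 _; apply: ler_sum => j _; apply: le_trans (min1_lip _ _) _.
  rewrite le_eqVlt; apply/orP; left; apply/eqP; congr (_ ^+ 2).
  by rewrite intrB; ring.
by move=> a b ab an bn; have := h2 (pred2 a b); rewrite count_pred2 // sum_pred2 //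
  big_nat_recl // big_nat1.
Qed.

(** [hE] is the budget; [hz] and [hn] leave [m0] places for a tail behind the support, and behind
    the second place. *)
Hypothesis hE : vertex_energy + e^-1 * tree_energy <= 2 + e.
Hypothesis hz : (m0 <= n - N)%N.
Hypothesis hn : (m0 + 3 <= n)%N.

Let N_le_n : (N <= n)%N.
Proof. by rewrite /N (leq_trans (count_size _ _)) // size_iota subn0. Qed.

Let below (x : R) : 2 + k^-1 <= x -> x <= 2 + e -> False.
Proof. by move=> h1 h2; have := le_trans h1 h2; rewrite lerD2l leNgt eC. Qed.

Let einv_mono (x y : R) : 0 <= x -> x <= y -> k * x <= e^-1 * y.
Proof.
move=> x0 xy; apply: ler_pM => //; last exact: k_le_einv.
by have := k_ge42; lra.
Qed.

(** Of a larger support only the last three places in the sorted order are kept, together with the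
    tail behind them; [three_high] then breaks the budget. *)
Lemma support_le2 : (N <= 2)%N.
Proof.
rewrite leqNgt; apply/negP => N3.
have [W [h1 h2 _]] := clipped_rearrangement.
have [M eM] : exists M, N = M.+3 by exists (N - 3)%N; lia.
have hN : (N <= n)%N := N_le_n.
have t := @tail_bound W n N.-1 ltac:(lia) ltac:(lia).
move: t h1; rewrite eM /= (@sum_nat_split _ _ 0 M.+3 n) -?eM //.
set A := \sum_(N <= i < n) W i ^+ 2; set B := \sum_(_ <= i < n.-1) _.
move=> t h1.
have E1 : \sum_(0 <= i < N) (1 - W i) ^+ 2
    = \sum_(0 <= i < N) W i ^+ 2 + N%:R - 2 * \sum_(0 <= i < N) W i.
  have -> : N%:R = \sum_(0 <= i < N) (1 : R) by rewrite big_const_nat subn0 iter_addr_0.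
  rewrite mulr_sumr -big_split -sumrB; apply: eq_bigr => i _ /=; ring.
have E2 : (1 - W M) ^+ 2 + (1 - W M.+1) ^+ 2 + (1 - W M.+2) ^+ 2
     <= \sum_(0 <= i < N) (1 - W i) ^+ 2.
  rewrite eM !big_nat_recr //= -!addrA lerDr sumr_ge0 // => i _; exact: sqr_ge0.
have E3 : (W M - W M.+1) ^+ 2 + (W M.+1 - W M.+2) ^+ 2 + B
    <= \sum_(0 <= i < n.-1) (W i - W i.+1) ^+ 2.
  rewrite (@sum_nat_split _ _ 0 M.+2 n.-1) ?lerD2r //; last by lia.
  by rewrite !big_nat_recr //= -addrA lerDr sumr_ge0 // => i _; exact: sqr_ge0.
have E4 := three_high (W M) (W M.+1) (W M.+2) hC.
have ei : 0 < e^-1 by rewrite invr_gt0.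
have E5 := einv_mono (addr_ge0 (sqr_ge0 (W M - W M.+1)) (sqr_ge0 (W M.+1 - W M.+2))) (lexx _).
have E6 := ler_wpM2l (ltW ei) E3.
have E7 := ler_wpM2l (ltW ei) h2.
apply: (below E4); rewrite mulrDr in E6; have := hE; move: (N%:R : R) h1 E1 => NN h1 E1; lra.
Qed.

Let tail1 W : C * W 1%N ^+ 2 <= \sum_(2 <= i < n) W i ^+ 2
     + e^-1 * \sum_(1 <= i < n.-1) (W i - W i.+1) ^+ 2.
Proof. by apply: tail_bound; lia. Qed.

Let split01 (F : nat -> R) : \sum_(0 <= i < n) F i = F 0%N + F 1%N + \sum_(2 <= i < n) F i.
Proof. by rewrite big_ltn 1?big_ltn ?addrA //; lia. Qed.

Let split0 (F : nat -> R) : \sum_(0 <= i < n.-1) F i = F 0%N + \sum_(1 <= i < n.-1) F i.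
Proof. by rewrite big_ltn //; lia. Qed.

Lemma tree_edge_le j : (0 < j < n)%N ->
  k * ((fb j - fb (par j))%:~R - (f j - f (par j))) ^+ 2 <= 2 + e.
Proof.
move=> hj.
have V0 : 0 <= vertex_energy by apply: sumr_ge0 => i _; exact: sqr_ge0.
apply: le_trans hE; rewrite -[X in X <= _]add0r lerD //.
apply: einv_mono; first exact: sqr_ge0.
rewrite /tree_energy (bigD1_seq j) /= ?mem_index_iota ?iota_uniq //.
by rewrite lerDl; apply: sumr_ge0 => i _; exact: sqr_ge0.
Qed.

(** Increments are at most 1 and the value 0 occurs, so a value beyond 1 yields a tree edge with
    absolute values 2 and 1. Clipped errors would not see the difference between 1 and 2; here they
    are rearranged unclipped. *)
Lemma potential_le1 a : (a < n)%N -> `|fb a| <= 1.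
Proof.
move=> an; rewrite leNgt; apply/negP => ha.
have [z zn fz] : exists2 z, (z < n)%N & fb z = 0.
  have : ~~ all supp (index_iota 0 n).
    apply: contraTN support_le2; rewrite all_count -/N size_iota subn0 => /eqP ->.
    by rewrite -ltnNge; lia.
  case/allPn => z; rewrite mem_index_iota => /andP[_ zn] /negPn/eqP fz.
  by exists z.
have [j hj hne] := @tree_connected par n [pred j | 1 < `|fb j| ] a z hpar an zn ha ltac:(by rewrite /= fz).
have hp := hpar hj; have pn : (par j < n)%N by lia.
have hi := hinc hj.
have [x [y [xn yn xy fx fy]]] : exists x y, [/\ (x < n)%N, (y < n)%N, x != y, `|fb x| = 2
    & `|fb y| = 1].
  move: hne; rewrite /=; case: (ltrP 1 `|fb j|); case: (ltrP 1 `|fb (par j)|) => // h1 h2 _.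
    by exists j, (par j); split; lia.
  by exists (par j), j; split; lia.
have [W [h1 h2 h3]] := @tree_rearrangement _ n par (fun j => `|(fb j)%:~R - f j|) hpar.
have hx := h2 (pred1 x); have hxy := h2 (pred2 x y); move: hx hxy.
rewrite count_pred2 // sum_pred2 // count_uniq_mem ?iota_uniq // mem_index_iota xn.
rewrite big_nat1_eq /= xn [X in X -> _]/= big_nat1 big_nat_recl // big_nat1 => hx hxy.
have hV : \sum_(0 <= i < n) W i ^+ 2 + 5 - 4 * W 0%N - 2 * W 1%N <= vertex_energy.
  have : \sum_(0 <= j < n) (`|(fb j)%:~R - f j| ^+ 2 + (if pred2 x y j then
     (`|fb j|%:~R) ^+ 2 - 2 * `|fb j|%:~R * `|(fb j)%:~R - f j| else 0)) <= vertex_energy.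
    apply: ler_sum_nat => i /andP[_ iN].
    have h0 : `|(fb i)%:~R : R| - `|(fb i)%:~R - f i| <= `|f i|.
      by rewrite lerBlDr -{1}(subrK (f i) (fb i)%:~R) addrC ler_normD.
    have h4 : `|(fb i)%:~R - f i| - `|(fb i)%:~R : R| <= `|f i|.
      by rewrite lerBlDl ler_normB.
    rewrite -(real_normK (num_real (f i))) intr_norm.
    case: ifP => [_|/negbT nxy]; first by have := normr_ge0 (f i); nra.
    have [->|fi] := eqVneq (fb i) 0; first by rewrite sub0r normrN addr0.
    have x0 : fb x != 0 by rewrite -normr_eq0 fx.
    have y0 : fb y != 0 by rewrite -normr_eq0 fy.
    exfalso; have := support_le2; apply/negP; rewrite -ltnNge /N -size_filter.
    apply: (@uniq_leq_size _ [:: x; y; i]).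
      by move: nxy; rewrite /= !inE !negb_or xy (eq_sym x i) (eq_sym y i) => /andP[-> ->].
    by move=> l; rewrite !inE mem_filter mem_index_iota /= => /or3P[] /eqP ->;
      rewrite ?xn ?yn ?iN ?andbT.
  rewrite big_split -big_mkcond sum_pred2 //= fx fy (h1 (fun x => x ^+ 2)).
  by move: (\sum_(0 <= i < n) W i ^+ 2) => Q; lra.
have hT : \sum_(0 <= i < n.-1) (W i - W i.+1) ^+ 2 <= tree_energy.
  apply: le_trans h3 _; apply: ler_sum => i _.
  have -> : (fb i - fb (par i))%:~R - (f i - f (par i))
     = ((fb i)%:~R - f i) - ((fb (par i))%:~R - f (par i)) by rewrite intrB; ring.
  move: (_ - f i) (_ - f (par i)) => u v.
  rewrite -(real_normK (num_real (u - v))).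
  have := lerB_dist u v; have := lerB_dist v u; rewrite (distrC v u).
  by have := normr_ge0 (u - v); nra.
have t := tail1 W; move: hV hT; rewrite split01 split0.
have E4 := high_two (W 0%N) (W 1%N) hC.
have ei : 0 < e^-1 by rewrite invr_gt0.
have E5 := einv_mono (sqr_ge0 (W 0%N - W 1%N)) (lexx _).
move: t; set A := \sum_(2 <= i < n) _; set B := \sum_(1 <= i < _) _ => t hV hT.
have E7 := ler_wpM2l (ltW ei) hT.
by apply: (below E4); have := hE; lra.
Qed.

(** A wrong integer is off by at least 1, so the residual is at least 1 minus the errors at [a] and
    [b]. Supports of size 0, 1 and 2 lead to the three defect lemmas. *)
Lemma potential_consistent a b (c d s : int) :
  a != b -> (a < n)%N -> (b < n)%N -> `|c| = 1 -> `|d| = 1 ->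
  vertex_energy + e^-1 * (tree_energy + (s%:~R - (c%:~R * f a + d%:~R * f b)) ^+ 2) <= 2 + e ->
  s = c * fb a + d * fb b.
Proof.
move=> ab an bn c1 d1 hE2; apply/eqP/negPn/negP => hne.
have [W [h1 h2 h3]] := clipped_rearrangement.
have hab := h3 a b ab an bn.
pose z := `|s%:~R - (c%:~R * f a + d%:~R * f b)|.
have hz0 : 1 - W 0%N - W 1%N <= z.
  have k1 : (1 : R) <= `|(s - (c * fb a + d * fb b))%:~R|.
    by rewrite -intr_norm ler1z; lia.
  have e1 : (s - (c * fb a + d * fb b))%:~R = s%:~R - (c%:~R * f a + d%:~R * f b)
     - (c%:~R * ((fb a)%:~R - f a) + d%:~R * ((fb b)%:~R - f b)) :> R.
    by rewrite !rmorphB !rmorphD !rmorphM /=; ring.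
  have k2 : 1 <= z + (`|(fb a)%:~R - f a| + `|(fb b)%:~R - f b|).
    apply: le_trans k1 _; rewrite e1; apply: le_trans (ler_normB _ _) _.
    rewrite lerD2l; apply: le_trans (ler_normD _ _) _.
    by rewrite !normrM -!intr_norm c1 d1 !mul1r.
  have z0 : 0 <= z by exact: normr_ge0.
  (* If one of the two errors is clipped, [W 0 + W 1] is at least 1 and the bound is trivial. *)
  move: hab; have := normr_ge0 ((fb a)%:~R - f a); have := normr_ge0 ((fb b)%:~R - f b).
  case: (leP `|(fb a)%:~R - f a| 1); case: (leP `|(fb b)%:~R - f b| 1); lra.
have ez : z ^+ 2 = (s%:~R - (c%:~R * f a + d%:~R * f b)) ^+ 2.
  by rewrite real_normK ?num_real.
rewrite -ez in hE2.
have t := tail1 W; move: h1 h2; rewrite split01 split0.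
have ei : 0 < e^-1 by rewrite invr_gt0.
move: t; set A := \sum_(2 <= i < n) _; set B := \sum_(1 <= i < _) _ => t h1 h2.
have E5 := einv_mono (addr_ge0 (sqr_ge0 (W 0%N - W 1%N)) (sqr_ge0 z)) (lexx _).
have E7 := ler_wpM2l (ltW ei) h2.
case: (N) support_le2 h1 => [|[|[|//]]] _; rewrite ?(big_geq (leqnn 0)) ?big_nat1
  ?(big_nat_recl 1) ?big_nat1 // => h1.
- by apply: (below (defect_none hC hz0)); lra.
- by apply: (below (defect_one hC hz0)); lra.
- by apply: (below (defect_two hC hz0)); lra.
Qed.
End Potential.

Lemma pigeonhole_seq (L : seq int) (F : nat -> int) n m :
  (forall i, (i < n)%N -> F i \in L) ->
  (size L * m < n)%N -> exists2 v, v \in L & (m < count (fun i => F i == v) (index_iota 0 n))%N.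
Proof.
move=> hF hL.
case: (boolP (has (fun v => m < count (fun i => F i == v) (index_iota 0 n))%N L)).
  by case/hasP => v; exists v.
move/hasPn => H; exfalso; move: hL; apply/negP; rewrite -leqNgt.
have step (L' : seq int) : {subset L' <= L} ->
   (count (fun i => F i \in L') (index_iota 0 n) <= size L' * m)%N.
  elim: L' => [_|v L' IH sub] /=; first by rewrite (@eq_count _ _ pred0) ?count_pred0.
  rewrite mulSn.
  have h1 : (count (fun i => F i == v) (index_iota 0 n) <= m)%N.
    by have := H v (sub v (mem_head _ _)); rewrite -leqNgt.
  have h2 := IH (fun x xL => sub x (mem_behead (s := v :: L') xL)).
  apply: leq_trans (leq_add h1 h2).
  rewrite -count_predUI; apply: leq_trans (leq_addr _ _).
  by apply: sub_count => i /=; rewrite inE.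
apply: leq_trans (step L _) => //.
have : all (fun i => F i \in L) (index_iota 0 n).
  by apply/allP => i; rewrite mem_index_iota; apply: hF.
by rewrite all_count size_iota subn0 => /eqP ->.
Qed.

Lemma tree_potential n (par : nat -> nat) (s : nat -> int) :
  (forall j, (0 < j < n)%N -> (par j < j)%N) ->
  exists F : nat -> int, forall j, (0 < j < n)%N -> F j - F (par j) = s j.
Proof.
elim: n => [|n IH] hp; first by exists (fun _ => 0) => j; rewrite andbF.
have [|F hF] := IH; first by move=> j hj; apply: hp; lia.
exists (fun j => if j == n then F (par n) + s n else F j) => j hj.
have := hp j hj; have [->|jn] := eqVneq j n; first by case: eqP; lia.
by case: (eqVneq (par j) n) => [|_ _]; [lia|apply: hF; lia].
Qed.

(** The tree determines the potential up to a constant. The budget allows so few values that one of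
    them is taken more than [m0 + 3] times; this value is shifted to 0, which provides the tail. *)
Lemma integral_potential n (par : nat -> nat) (f : nat -> R) (s : nat -> int) :
  (43 * (m0 + 3) < n)%N ->
  (forall j, (0 < j < n)%N -> (par j < j)%N) ->
  (forall j, (0 < j < n)%N -> `|s j| <= 1) ->
  let V := \sum_(0 <= j < n) f j ^+ 2 in
  let T := \sum_(1 <= j < n) ((s j)%:~R - (f j - f (par j))) ^+ 2 in
  V + e^-1 * T <= 2 + e ->
  exists F : nat -> int,
  [/\ forall j, (0 < j < n)%N -> F j - F (par j) = s j,
      forall j, (j < n)%N -> `|F j| <= 1,
      (count (fun j => F j != 0) (index_iota 0 n) <= 2)%N &
      forall a b (c d s' : int), a != b -> (a < n)%N -> (b < n)%N -> `|c| = 1 -> `|d| = 1 ->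
        V + e^-1 * (T + (s'%:~R - (c%:~R * f a + d%:~R * f b)) ^+ 2) <= 2 + e ->
        s' = c * F a + d * F b].
Proof.
move=> hn hp hs V T hE.
have [F0 hF0] := tree_potential s hp.
have eT F : (forall j, (0 < j < n)%N -> F j - F (par j) = s j) -> tree_energy n par f F = T.
  by move=> hF; apply: eq_big_nat => j hj; rewrite hF.
have e2 : e <= 1/42.
  have := k_ge42 => k42; apply: ltW (lt_le_trans eC _).
  by rewrite invf_ple ?posrE //; lra.
have hi0 j : (0 < j < n)%N -> `|F0 j - F0 (par j)| <= 1 by move=> hj; rewrite hF0 ?hs.
(* Fifteen coordinates with [|f j| >= 3/8] would cost [135/64], more than [2 + 1/42]. *)
pose B := [seq j <- index_iota 0 n | (3/8 : R) <= `|f j|].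
have sB : (size B <= 14)%N.
  have : (size B)%:R * (9/64) <= V.
    rewrite size_filter -sum1_count natr_sum mulr_suml big_mkcond /=.
    apply: ler_sum => j _; case: ifP => h; last exact: sqr_ge0.
    by rewrite -(real_normK (num_real (f j))); nra.
  have : 0 <= e^-1 * T.
    rewrite mulr_ge0 ?invr_ge0 ?(ltW e0) // sumr_ge0 // => i _; exact: sqr_ge0.
  move=> h1 h2; rewrite leqNgt; apply/negP => h3.
  have : (15%:R : R) <= (size B)%:R by rewrite ler_nat.
  lra.
(* With both ends outside [B] a nonzero increment leaves a residual of at least 1/4, and [42/16]
   exceeds the budget. *)
have hB j : (0 < j < n)%N -> s j != 0 -> (j \in B) || (par j \in B).
  move=> hj sj; have hpj := hp j hj.
  rewrite !mem_filter !mem_index_iota /=.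
  have -> : (j < n)%N by lia.
  have -> : (par j < n)%N by lia.
  rewrite !andbT; apply: contraT; rewrite negb_or -!ltNge => /andP[u1 u2]; exfalso.
  have hE' : vertex_energy n f + e^-1 * tree_energy n par f F0 <= 2 + e by rewrite eT.
  have := tree_edge_le hE' hj; rewrite hF0 //.
  have k42 := k_ge42.
  have s1 : 1 <= `|(s j)%:~R : R| by rewrite -intr_norm ler1z; lia.
  set y := (s j)%:~R - _ => hy.
  have : 2/8 <= `|y|.
    have : `|(s j)%:~R : R| <= `|y| + (`|f j| + `|f (par j)|).
      rewrite -[in leLHS](subrK (f j - f (par j)) (s j)%:~R) -/y.
      by apply: le_trans (ler_normD _ _) _; rewrite lerD2l ler_normB.
    lra.
  move: hy; rewrite -(real_normK (num_real y)) => h1 h2.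
  have : (2/8) ^+ 2 <= `|y| ^+ 2 by rewrite ler_sqr ?nnegrE //; lra.
  nra.
(* A value other than [F0 0] is reached through an edge with nonzero increment, hence with an end in
   [B]. So at most [1 + 3 * 14 = 43] values occur. *)
pose L := F0 0%N :: [seq F0 j | j <- B] ++ [seq F0 j - 1 | j <- B] ++ [seq F0 j + 1 | j <- B].
have [||v vL cv] := @pigeonhole_seq L F0 n (m0 + 3).
    move=> i iN; rewrite inE; case: (eqVneq (F0 i) (F0 0%N)) => //= ne.
    have n0 : (0 < n)%N by lia.
    have memL j v : j \in B -> [|| v == F0 j, v == F0 j - 1 | v == F0 j + 1] ->
      v \in [seq F0 j | j <- B] ++ [seq F0 j - 1 | j <- B] ++ [seq F0 j + 1 | j <- B].
      move=> jB; rewrite !mem_cat => /or3P[] /eqP ->.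
      - by rewrite map_f.
      - by rewrite (map_f (fun j => F0 j - 1)) ?orbT.
      - by rewrite (map_f (fun j => F0 j + 1)) ?orbT.
    case: (ltrP (F0 i) (F0 0%N)) => hlt.
      have [|j hj hne] := @tree_connected par n [pred j | F0 j <= F0 i] i 0 hp iN n0 (lexx _).
        by rewrite /= -ltNge.
      have := hi0 j hj; move: hne; rewrite /= => hne h1.
      have sj : s j != 0 by rewrite -hF0 //; move: hne; case: leP; case: leP; lia.
      case/orP: (hB j hj sj) => jB; apply: (memL _ _ jB); move: hne; case: leP; case: leP; lia.
    have [|j hj hne] := @tree_connected par n [pred j | F0 i <= F0 j] i 0 hp iN n0 (lexx _).
      by rewrite /= -ltNge; lia.
    have := hi0 j hj; move: hne; rewrite /= => hne h1.
    have sj : s j != 0 by rewrite -hF0 //; move: hne; case: leP; case: leP; lia.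
    case/orP: (hB j hj sj) => jB; apply: (memL _ _ jB); move: hne; case: leP; case: leP; lia.
  apply: leq_ltn_trans hn; rewrite leq_mul2r; apply/orP; right.
  by rewrite /= !size_cat !size_map; lia.
pose F j := F0 j - v.
have hF j : (0 < j < n)%N -> F j - F (par j) = s j by move=> hj; rewrite -hF0 // /F; lia.
have hi j : (0 < j < n)%N -> `|F j - F (par j)| <= 1 by move=> hj; rewrite hF ?hs.
have hE' : vertex_energy n f + e^-1 * tree_energy n par f F <= 2 + e by rewrite eT.
have hz : (m0 <= n - count [pred j | F j != 0] (index_iota 0 n))%N.
  have E : (count [pred j | F j != 0] (index_iota 0 n)
     + count (predC [pred j | F j != 0]) (index_iota 0 n))%N = n.
    by rewrite count_predC size_iota subn0.
  rewrite -[X in (_ <= X - _)%N]E addKn; apply: leq_trans (leq_addr 3 m0) _.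
  by apply: leq_trans (ltnW cv) _; apply: sub_count => j /=; rewrite /F subr_eq0 negbK.
have hn' : (m0 + 3 <= n)%N by apply: ltnW; apply: leq_ltn_trans hn; rewrite leq_pmull.
exists F; split => //.
- by move=> j; apply: (potential_le1 hp hi hE' hz hn').
- exact: (support_le2 hp hE' hz hn').
move=> a b c d s' ab an bn c1 d1; rewrite -(eT F) //.
exact: (potential_consistent hp hE' hz hn').
Qed.
End HalfLine.

(** * Representations by roots *)

Section Forms.
Variables (R : realFieldType) (T : finType).
Implicit Types (a : T -> T -> int) (x y : T -> R) (P S : {set T}).

Definition signed_symmetric a : Prop :=
  [/\ forall u v, a u v = a v u, forall u, a u u = 0 & forall u v, `|a u v| <= 1].

Definition adj_form a x y : R := \sum_u \sum_v (a u v)%:~R * x u * y v.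

(** The principal submatrix on [S] has no eigenvalue above [l], in a form that passes to subsets at
    once. *)
Definition spec_le a (l : R) S : Prop :=
  forall x, (forall u, u \notin S -> x u = 0) -> adj_form a x x <= l * \sum_u x u ^+ 2.

(** Regularised least squares: [e I + B B^T] is positive definite, hence invertible. *)
Lemma ridge m n (B : 'M[R]_(m, n)) (e : R) (s : 'rV[R]_m) : 0 < e ->
  exists y : 'rV[R]_m, s = e *: y + y *m B *m B^T.
Proof.
move=> e0; pose M := e%:M + B *m B^T.
suff Mu : M \in unitmx.
  exists (s *m invmx M); rewrite -mulmxA -mul_mx_scalar -mulmxDr -/M.
  by rewrite -mulmxA mulVmx // mulmx1.
rewrite -row_free_unit -kermx_eq0; apply/eqP/row_matrixP => i.
set z := row i _; rewrite row0.
have zM : z *m M = 0 by rewrite /z -row_mul mulmx_ker row0.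
have : e * (z *m z^T) 0 0 + ((z *m B) *m (z *m B)^T) 0 0 = 0.
  have : (z *m M *m z^T) 0 0 = 0 by rewrite zM mul0mx mxE.
  rewrite mulmxDr mulmxDl mxE mul_mx_scalar -scalemxAl mxE => <-.
  by rewrite trmx_mul !mulmxA.
have sq k (w : 'rV[R]_k) : (w *m w^T) 0 0 = \sum_j w 0 j ^+ 2.
  by rewrite mxE; apply: eq_bigr => j _; rewrite mxE expr2.
rewrite !sq => h.
have h1 : 0 <= \sum_j z 0 j ^+ 2 by apply: sumr_ge0 => j _; exact: sqr_ge0.
have h2 : 0 <= \sum_j (z *m B) 0 j ^+ 2 by apply: sumr_ge0 => j _; exact: sqr_ge0.
have h0 : \sum_j z 0 j ^+ 2 = 0.
  apply/eqP; rewrite eq_le h1 andbT -(pmulr_rle0 _ e0); lra.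
apply/rowP => j; rewrite [RHS]mxE; apply/eqP; rewrite -sqrf_eq0.
by move/eqP: h0; rewrite psumr_eq0 => [/allP/(_ j (mem_index_enum _))|k _]; rewrite ?sqr_ge0.
Qed.

Lemma ridge_fun n (b : T -> 'I_n -> R) (e : R) (s : T -> R) : 0 < e ->
  exists y : T -> R, forall u, s u = e * y u + \sum_j (\sum_w y w * b w j) * b u j.
Proof.
move=> e0.
have [y hy] := @ridge _ _ (\matrix_(i < #|T|, j < n) b (enum_val i) j) e
  (\row_i s (enum_val i)) e0.
exists (fun u => y 0 (enum_rank u)) => u.
have := congr1 (fun z : 'rV_#|T| => z 0 (enum_rank u)) hy.
rewrite !mxE enum_rankK => ->; congr (_ + _).
apply: eq_bigr => j _; rewrite !mxE enum_rankK; congr (_ * _).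
rewrite (reindex enum_rank) /=; last by apply: onW_bij; exact: enum_rank_bij.
by apply: eq_bigr => w _; rewrite mxE enum_rankK.
Qed.
End Forms.

Section RootRep.
Variables (T : finType) (a : T -> T -> int).
Hypothesis ha : signed_symmetric a.
Implicit Types (P S : {set T}) (u v w : T).

Record root_data := RootData {
  end1 : T -> nat; end2 : T -> nat; sgn1 : T -> int; sgn2 : T -> int; dim : nat; tree : nat -> T }.

(* The vector attached to [u] is [sgn1 u * e_(end1 u) + sgn2 u * e_(end2 u)]. *)
Definition coord (r : root_data) u (j : nat) : int :=
  sgn1 r u * (j == end1 r u)%:R + sgn2 r u * (j == end2 r u)%:R.

Definition root_ip (r : root_data) (F : nat -> int) u : int :=
  sgn1 r u * F (end1 r u) + sgn2 r u * F (end2 r u).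

(* The last clause says that the edges [tree j] form a spanning tree of the
   graph with one edge [{end1 u, end2 u}] for each [u \in P]. *)
Definition represents (r : root_data) P : Prop :=
  [/\ (0 < dim r)%N,
      forall u, u \in P -> [/\ (end1 r u < dim r)%N, (end2 r u < dim r)%N,
        end1 r u != end2 r u, `|sgn1 r u| = 1 & `|sgn2 r u| = 1],
      forall u v, u \in P -> v \in P ->
        root_ip r (coord r u) v = 2 * (u == v)%:R - a u v &
      forall j, (0 < j < dim r)%N -> [/\ tree r j \in P, end2 r (tree r j) = j,
        (end1 r (tree r j) < j)%N & sgn2 r (tree r j) = - sgn1 r (tree r j)] ].

Lemma root_ip_sym r u v : root_ip r (coord r u) v = root_ip r (coord r v) u.
Proof.
rewrite /root_ip /coord (eq_sym (end1 r v) (end1 r u)) (eq_sym (end1 r v) (end2 r u)).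
rewrite (eq_sym (end2 r v) (end1 r u)) (eq_sym (end2 r v) (end2 r u)); ring.
Qed.

Section Real.
Variable R : archiRealFieldType.
Implicit Types (x y : T -> R) (f : nat -> R).

Lemma coord_sum r u f : (end1 r u < dim r)%N -> (end2 r u < dim r)%N ->
  \sum_(j < dim r) (coord r u j)%:~R * f j
    = (sgn1 r u)%:~R * f (end1 r u) + (sgn2 r u)%:~R * f (end2 r u).
Proof.
move=> h1 h2; rewrite /coord.
transitivity (\sum_(0 <= j < dim r) ((if j == end1 r u then (sgn1 r u)%:~R * f j else 0)
    + (if j == end2 r u then (sgn2 r u)%:~R * f j else 0))).
  rewrite big_mkord; apply: eq_bigr => j _.
  rewrite rmorphD !rmorphM /= mulrDl; congr (_ + _); case: eqP => _;
    by rewrite ?rmorph1 ?rmorph0 ?mulr1 ?mulr0 ?mul0r.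
by rewrite big_split -!big_mkcond !big_nat1_eq /= h1 h2.
Qed.

(** The Gram matrix of the roots is [2 I - A]. *)
Lemma rep_form r P x : represents r P -> (forall u, u \notin P -> x u = 0) ->
  \sum_(j < dim r) (\sum_u x u * (coord r u j)%:~R) ^+ 2
    = 2 * \sum_u x u ^+ 2 - adj_form a x x.
Proof.
move=> [_ hP hip _] hx.
transitivity (\sum_u \sum_v x u * x v * (\sum_(j < dim r) (coord r u j)%:~R * (coord r v j)%:~R)).
  under eq_bigr => j _ do rewrite expr2 big_distrlr /=.
  rewrite exchange_big; apply: eq_bigr => u _ /=; rewrite exchange_big; apply: eq_bigr => v _ /=.
  by rewrite mulr_sumr; apply: eq_bigr => j _; ring.
rewrite /adj_form mulr_sumr -sumrB; apply: eq_bigr => u _.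
rewrite (bigD1 u) //= [X in _ - X](bigD1 u) //= opprD addrA -sumrN.
case: (boolP (u \in P)) => uP; last first.
  rewrite hx // !(mul0r, mulr0) expr0n /= mulr0 subr0 add0r.
  by rewrite !big1 ?addr0 // => v _; rewrite ?(mul0r, mulr0, oppr0).
congr (_ + _).
  have [h1 h2 _ _ _] := hP u uP.
  rewrite (@coord_sum r u (fun j => (coord r u j)%:~R)) //.
  have := congr1 (fun z : int => z%:~R : R) (hip u u uP uP).
  rewrite /root_ip eqxx mulr1 /= rmorphB rmorphD !rmorphM /= => ->.
  ring.
apply: eq_bigr => v vu.
case: (boolP (v \in P)) => vP; last by rewrite (hx v) // !(mul0r, mulr0) oppr0.
have [h1 h2 _ _ _] := hP v vP.
under eq_bigr => j _ do rewrite mulrC.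
rewrite (@coord_sum r v (fun j => (coord r u j)%:~R)) //.
have := congr1 (fun z : int => z%:~R : R) (hip u v uP vP).
rewrite /root_ip eq_sym (negbTE vu) mulr0 sub0r /= rmorphN rmorphD !rmorphM /= => ->.
ring.
Qed.

Lemma rep_spec_le2 r P : represents r P -> spec_le a (2 : R) P.
Proof.
move=> hr x hx; rewrite -subr_ge0 -(rep_form hr hx) sumr_ge0 // => j _; exact: sqr_ge0.
Qed.

(** [y] solves the inner-product conditions with penalty [e], and [f] is the combination of the
    roots with weights [y], so the residual at [u] is [e * y u]. The claim is [spec_le] tested on
    the vector equal to 1 at [v] and to [- y] elsewhere. *)
Lemma step_energy r P v (e : R) : 0 < e -> represents r P -> v \notin P ->
  spec_le a (2 + e) (v |: P) ->
  exists f : nat -> R, \sum_(0 <= j < dim r) f j ^+ 2 + e^-1 *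
    \sum_(u in P) ((- a v u)%:~R - ((sgn1 r u)%:~R * f (end1 r u)
       + (sgn2 r u)%:~R * f (end2 r u))) ^+ 2 <= 2 + e.
Proof.
move=> e0 hr vP hsp; have [as_ a0 _] := ha.
have [_ hP hip _] := hr.
have [y hy] := @ridge_fun R T (dim r) (fun u j => if u \in P then (coord r u j)%:~R else 0) e
  (fun u => if u \in P then (- a v u)%:~R else 0) e0.
have y0 u : u \notin P -> y u = 0.
  move=> uP; have := hy u; rewrite (negbTE uP) big1 => [/eqP|j _]; last by rewrite mulr0.
  by rewrite addr0 eq_sym mulf_eq0 (gt_eqF e0) => /eqP.
pose f j := \sum_w y w * (coord r w j)%:~R.
have hf (j : 'I_(dim r)) : \sum_w y w * (if w \in P then (coord r w j)%:~R else 0) = f j.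
  by apply: eq_bigr => w _; case: ifP => // /negbT/y0 ->; rewrite !mul0r.
have hy' u : u \in P -> (- a v u)%:~R = e * y u + ((sgn1 r u)%:~R * f (end1 r u)
       + (sgn2 r u)%:~R * f (end2 r u)).
  move=> uP; have [h1 h2 _ _ _] := hP u uP.
  rewrite -(@coord_sum r u f) //; have := hy u; rewrite uP => ->; congr (_ + _).
  by apply: eq_bigr => j _; rewrite hf mulrC.
exists f.
have -> : \sum_(u in P) ((- a v u)%:~R - ((sgn1 r u)%:~R * f (end1 r u)
       + (sgn2 r u)%:~R * f (end2 r u))) ^+ 2 = e ^+ 2 * \sum_u y u ^+ 2.
  rewrite mulr_sumr big_mkcond; apply: eq_bigr => u _.
  by case: ifP => [/hy' ->|/negbT/y0 ->]; [rewrite addrK exprMn|rewrite expr0n mulr0].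
have hform := rep_form hr y0.
pose x u := if u == v then 1 else - y u.
have yv : y v = 0 by exact: y0.
have hx u : u \notin v |: P -> x u = 0.
  by rewrite !inE negb_or /x => /andP[/negbTE -> /y0 ->]; rewrite oppr0.
have sx : \sum_u x u ^+ 2 = 1 + \sum_u y u ^+ 2.
  rewrite (bigD1 v) //= [in RHS](bigD1 v) //= {1}/x eqxx expr1n yv expr0n add0r.
  by congr (_ + _); apply: eq_bigr => u uv; rewrite /x (negbTE uv) sqrrN.
have sa : \sum_u \sum_w (a u w)%:~R * x u * x w = adj_form a y y
    - 2 * \sum_u (a v u)%:~R * y u.
  transitivity (\sum_u ((\sum_w (a u w)%:~R * y u * y w) - (a v u)%:~R * y u
     - (u == v)%:R * \sum_w (a v w)%:~R * y w)).
    apply: eq_bigr => u _; rewrite (bigD1 v) //= {2}/x eqxx mulr1.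
    rewrite [X in _ = X - _ - _](bigD1 v) //= yv mulr0 add0r.
    have [->|uv] := eqVneq u v.
      rewrite a0 rmorph0 !mul0r add0r subr0 mul1r.
      rewrite [X in _ = _ - X](bigD1 v) //= yv mulr0 add0r.
      rewrite [X in _ = X - _]big1 => [|w _]; last by rewrite mulr0 mul0r.
      rewrite sub0r -sumrN; apply: eq_bigr => w wv.
      by rewrite /x eqxx (negbTE wv) mulr1 mulrN.
    rewrite mul0r subr0 /x (negbTE uv) as_ mulrN addrC; congr (_ - _).
    by apply: eq_bigr => w wv; rewrite (negbTE wv) mulrN mulrN mulNr opprK.
  rewrite !sumrB [X in _ - _ - X](bigD1 v) //= eqxx mul1r.
  rewrite [X in _ - (_ + X)]big1 => [|w /negbTE ->]; last by rewrite mul0r.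
  by rewrite addr0 /adj_form; ring.
have := hsp x hx; rewrite sx {1}/adj_form sa => h.
have sy : - \sum_u (a v u)%:~R * y u = e * \sum_u y u ^+ 2 + \sum_(j < dim r) f j ^+ 2.
  have -> : \sum_(j < dim r) f j ^+ 2 = \sum_u y u * \sum_(j < dim r) (coord r u j)%:~R * f j.
    under [RHS]eq_bigr => u _ do rewrite mulr_sumr.
    rewrite [RHS]exchange_big; apply: eq_bigr => j _ /=.
    by rewrite expr2 {1}/f mulr_suml; apply: eq_bigr => w _; rewrite mulrA.
  rewrite -sumrN mulr_sumr -big_split; apply: eq_bigr => u _ /=.
  case: (boolP (u \in P)) => uP; last by rewrite y0 // expr0n /= !(mulr0, mul0r) addr0 oppr0.
  have [h1 h2 _ _ _] := hP u uP.
  by rewrite coord_sum // -mulNr -rmorphN /= hy' //; ring.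
rewrite big_mkord mulrA.
have -> : e^-1 * e ^+ 2 = e by rewrite expr2 mulrA mulVf ?mul1r // gt_eqF.
move: h sy hform; rewrite -/f.
move: (\sum_(j < dim r) f j ^+ 2) (\sum_u y u ^+ 2) (adj_form a y y) => A B D.
lra.
Qed.

End Real.

Lemma count_le2_cases n (F : nat -> int) : (count (fun j => F j != 0) (iota 0 n) <= 2)%N ->
  (exists2 j, (j < n)%N & F j != 0) ->
  (exists x, [/\ (x < n)%N, F x != 0 & forall j, (j < n)%N -> j != x -> F j = 0]) \/
  (exists x y, [/\ (x < n)%N, (y < n)%N, x != y, F x != 0 /\ F y != 0
     & forall j, (j < n)%N -> j != x -> j != y -> F j = 0]).
Proof.
rewrite -size_filter => hs [j0 j0n Fj0].
have memE j : (j \in [seq j <- iota 0 n | F j != 0]) = (F j != 0) && (j < n)%N.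
  by rewrite mem_filter mem_iota.
have : uniq [seq j <- iota 0 n | F j != 0] by rewrite filter_uniq ?iota_uniq.
move: hs memE; case: [seq j <- iota 0 n | F j != 0] => [|x [|y [|//]]] _ memE.
- by have := memE j0; rewrite Fj0 j0n.
- have := memE x; rewrite mem_head => /esym/andP[Fx xn] _; left; exists x; split=> // j jn jx.
  by have := memE j; rewrite jn andbT inE (negbTE jx) => /esym/negbFE/eqP.
rewrite /= inE andbT => xy; right; exists x, y.
have := memE x; rewrite mem_head => /esym/andP[Fx xn].
have := memE y; rewrite !inE eqxx orbT => /esym/andP[Fy yn].
split=> // j jn jx jy.
by have := memE j; rewrite jn andbT !inE (negbTE jx) (negbTE jy) => /esym/negbFE/eqP.
Qed.

(** With two nonzero coordinates [F] is itself the new root. With a single one, the root gets a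
    fresh coordinate with the opposite sign, and [v] becomes the tree edge leading to it. *)
Lemma add_root r P v (F : nat -> int) : represents r P -> v \notin P ->
  (forall u, u \in P -> - a v u = root_ip r F u) ->
  (forall j, (j < dim r)%N -> `|F j| <= 1) ->
  (count (fun j => F j != 0) (iota 0 (dim r)) <= 2)%N ->
  (exists2 j, (j < dim r)%N & F j != 0) ->
  exists2 r', represents r' (v |: P) & (dim r <= dim r')%N.
Proof.
move=> hr vP hv F1 F2 F3; have [n0 hP hip ht] := hr; have [as_ a0 _] := ha.
have abs1 j : (j < dim r)%N -> F j != 0 -> `|F j| = 1 by move=> /F1; lia.
pose upd (A : Type) (g : T -> A) (z : A) u := if u == v then z else g u.
have updP (A : Type) (g : T -> A) z u : u \in P -> upd A g z u = g u.
  by move=> uP; rewrite /upd; case: eqP => // E; rewrite -E uP in vP.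
have updv (A : Type) (g : T -> A) z : upd A g z v = z by rewrite /upd eqxx.
(* both cases provide a vector whose first [dim r] coordinates are those of [F] *)
suff main (x y m : nat) (cx cy : int) tr' :
    let r' := RootData (upd _ (end1 r) x) (upd _ (end2 r) y) (upd _ (sgn1 r) cx)
       (upd _ (sgn2 r) cy) m tr' in
    (dim r <= m)%N -> (x < m)%N -> (y < m)%N -> x != y -> `|cx| = 1 -> `|cy| = 1 ->
    (forall j, (j < dim r)%N -> F j = cx * (j == x)%:R + cy * (j == y)%:R) ->
    (forall j, (0 < j < m)%N -> [/\ tr' j \in v |: P, end2 r' (tr' j) = j,
        (end1 r' (tr' j) < j)%N & sgn2 r' (tr' j) = - sgn1 r' (tr' j)]) ->
    represents r' (v |: P).
  case: (count_le2_cases F2 F3) => [[x [xn Fx hF]]|[x [y [xn yn xy [Fx Fy] hF]]]].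
    pose tr' j := if j == dim r then v else tree r j.
    exists (RootData (upd _ (end1 r) x) (upd _ (end2 r) (dim r)) (upd _ (sgn1 r) (F x))
       (upd _ (sgn2 r) (- F x)) (dim r).+1 tr') => //.
    apply: main => //=; rewrite ?normrN ?abs1 ?neq_ltn ?xn //.
    - exact: ltnW.
    - move=> j jn; rewrite (ltn_eqF jn) mulr0 addr0.
      by have [->|/(hF j jn) ->] := eqVneq j x; rewrite ?mulr1 ?mulr0.
    move=> j hj; rewrite /tr'; case: (eqVneq j (dim r)) => [->|jn].
      by rewrite !updv setU11.
    have [|t1 t2 t3 t4] := ht j; first by lia.
    by rewrite !updP // setU1r.
  exists (RootData (upd _ (end1 r) x) (upd _ (end2 r) y) (upd _ (sgn1 r) (F x))
       (upd _ (sgn2 r) (F y)) (dim r) (tree r)) => //.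
  apply: main => //=; rewrite ?abs1 //.
    move=> j jn; have [->|jx] := eqVneq j x; first by rewrite (negbTE xy) mulr1 mulr0 addr0.
    have [->|jy] := eqVneq j y; first by rewrite mulr0 mulr1 add0r.
    by rewrite hF // !mulr0 addr0.
  move=> j hj; have [t1 t2 t3 t4] := ht j hj.
  by rewrite !updP // setU1r.
move=> r' nm xm ym xy cx1 cy1 hF ht'.
have cP u j : u \in P -> coord r' u j = coord r u j by move=> uP; rewrite /coord /= !updP.
have cv j : (j < dim r)%N -> coord r' v j = F j by move=> jn; rewrite /coord /= !updv hF.
have ipv u : u \in P -> root_ip r' (coord r' v) u = - a v u.
  move=> uP; have [h1 h2 _ _ _] := hP u uP.
  by rewrite hv // /root_ip /= !updP // !cv.
split=> //=.
- exact: leq_trans nm.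
- move=> u; rewrite in_setU1 => /orP[/eqP ->|uP]; first by rewrite !updv.
  by rewrite !updP //; have [h1 h2 h3 h4 h5] := hP u uP; split=> //; exact: leq_trans nm.
move=> u w; rewrite !in_setU1.
case: (boolP (w \in P)) => wP; last rewrite orbF.
  have vw : (v == w) = false by apply: contraNF vP => /eqP ->.
  case: (boolP (u \in P)) => uP; last rewrite orbF.
    by move=> _ _; rewrite -hip // /root_ip /= !updP // !cP.
  by move=> /eqP -> _; rewrite ipv // vw mulr0 sub0r.
case: (boolP (u \in P)) => uP; last rewrite orbF.
  have uv : (u == v) = false by apply: contraNF vP => /eqP <-.
  by move=> _ /eqP ->; rewrite root_ip_sym ipv // uv mulr0 sub0r as_.
move=> /eqP -> /eqP ->; rewrite eqxx a0 /root_ip /coord /= !updv !eqxx (negbTE xy).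
rewrite eq_sym (negbTE xy).
have : cx * cx = 1 by lia.
have : cy * cy = 1 by lia.
lia.
Qed.

(** The [i]-th vertex becomes [sg i] times [e_i - e_(i+1)], the signs being accumulated so that
    consecutive inner products match [a]. The telescoping sum in the last clause is used by
    [induced_path_short]. *)
Lemma represents_path (s : seq T) u0 : uniq s -> (0 < size s)%N ->
  (forall i j, (i < size s)%N -> (j < size s)%N -> (a (nth u0 s i) (nth u0 s j) != 0)
     = (i == j.+1) || (j == i.+1)) ->
  exists r, [/\ represents r [set u in s], dim r = (size s).+1 &
    forall j, \sum_(u <- s) sgn1 r u * coord r u j = (j == 0%N)%:R - (j == size s)%:R].
Proof.
move=> us s0 hs; have [as_ a0 a1] := ha.
pose fix sg (i : nat) : int := if i is i'.+1 then sg i' * a (nth u0 s i') (nth u0 s i) else 1.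
have sg1 i : (i < size s)%N -> `|sg i| = 1.
  elim: i => // i IH hi; rewrite /= normrM IH; last exact: ltnW.
  by have := hs i i.+1 (ltnW hi) hi; rewrite eqxx orbT; have := a1 (nth u0 s i) (nth u0 s i.+1); lia.
exists (RootData (fun u => index u s) (fun u => (index u s).+1) (fun u => sg (index u s))
   (fun u => - sg (index u s)) (size s).+1 (fun j => nth u0 s j.-1)).
split=> //; last first.
  move=> j; rewrite (big_nth u0) /coord /=.
  transitivity (\sum_(0 <= i < size s) ((- (j == i.+1)%:R) - (- (j == i)%:R)) : int).
    apply: eq_big_nat => i /andP[_ hi]; rewrite index_uniq //; have := sg1 i hi.
    by do 2 case: eqP => _; lia.
  rewrite telescope_sumr //; lia.
split=> //=.
- move=> u; rewrite inE -index_mem => hu; rewrite !ltnS normrN sg1 //; split=> //; last by lia.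
  exact: ltnW.
- move=> u v; rewrite !inE => us' vs.
  have := nth_index u0 us'; have := nth_index u0 vs.
  move: us' vs; rewrite -!index_mem /root_ip /coord /=.
  move: (index u s) (index v s) => i j hi hj <- <-.
  rewrite nth_uniq // !eqSS.
  have ss l : (l < size s)%N -> sg l * sg l = 1 by move/sg1; lia.
  have step l : (l.+1 < size s)%N ->
     sg l * sg l.+1 = a (nth u0 s l) (nth u0 s l.+1).
    by move=> hl; rewrite /= mulrA ss ?mul1r // ltnW.
  have [eij|ij] := eqVneq i j.
    subst j; rewrite a0; have -> : (i == i.+1) = false by lia.
    have -> : (i.+1 == i) = false by lia.
    have := ss i hi; rewrite ?eqxx /=; lia.
  have [eij|ji] := eqVneq j i.+1.
    subst j; have -> : (i.+2 == i) = false by lia.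
    have := step i hj; have := ss i hi; move: (sg i.+1) => z; lia.
  have [eij|ij1] := eqVneq i j.+1.
    subst i; have := step j hi; rewrite as_; move: (sg j.+1) => z; lia.
  have : a (nth u0 s i) (nth u0 s j) = 0.
    by apply/eqP/negbNE; rewrite hs // negb_or ij1 ji.
  by move=> ->; lia.
move=> [|j] //=; rewrite ltnS => hj; rewrite index_uniq //.
by split=> //; rewrite inE mem_nth.
Qed.

End RootRep.

(** * Growing a representation along a connected graph *)

Section Key.
Variables (R : archiRealFieldType) (e C : R) (m0 : nat).
Hypotheses (e0 : 0 < e) (hC : subcrit C) (eC : e < (C * (C + 1))^-1)
  (hm0 : forall m, (m0 <= m)%N -> C <= tail_conductance e m).
Variables (T : finType) (a : T -> T -> int).
Hypothesis ha : signed_symmetric a.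
Implicit Types (P S X : {set T}) (u v : T).

Definition connected_on S : Prop := forall X, X \subset S -> X != set0 -> X != S ->
  exists u v, [/\ u \in X, v \in S :\: X & a v u != 0].

Lemma spec_le_sub (l : R) P S : P \subset S -> spec_le a l S -> spec_le a l P.
Proof.
move=> PS h x hx; apply: h => u uS; apply: hx; apply: contra uS; exact: (subsetP PS).
Qed.

Lemma extend_step r P v : (43 * (m0 + 3) < dim r)%N -> represents a r P -> v \notin P ->
  (exists2 u, u \in P & a v u != 0) -> spec_le a (2 + e) (v |: P) ->
  exists2 r', represents a r' (v |: P) & (dim r <= dim r')%N.
Proof.
move=> hn hr vP [u0 u0P au0] hsp; have [n0 hP hip ht] := hr; have [as_ a0 a1] := ha.
have [f hf] := step_energy ha e0 hr vP hsp.
pose G u := ((- a v u)%:~R - ((sgn1 r u)%:~R * f (end1 r u)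
       + (sgn2 r u)%:~R * f (end2 r u))) ^+ 2.
pose par j := end1 r (tree r j).
pose s j := sgn1 r (tree r j) * a v (tree r j).
have hpar j : (0 < j < dim r)%N -> (par j < j)%N by case/ht.
have c1 j : (0 < j < dim r)%N -> `|sgn1 r (tree r j)| = 1 by case/ht => /hP[].
have hs j : (0 < j < dim r)%N -> `|s j| <= 1.
  by move=> hj; rewrite normrM c1 // mul1r a1.
have eT j : (0 < j < dim r)%N -> ((s j)%:~R - (f j - f (par j))) ^+ 2 = G (tree r j).
  move=> hj; have [_ h2 _ h4] := ht j hj; rewrite /G h2 h4 /par /s.
  have : (sgn1 r (tree r j))%:~R ^+ 2 = 1 :> R.
    by rewrite -rmorphXn /= -[_ ^+ 2]real_normK ?num_real // c1.
  rewrite !rmorphN rmorphM /=; move: (sgn1 r _)%:~R (a v _)%:~R => c b hc.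
  transitivity (c ^+ 2 * (c * b - (f j - f (end1 r (tree r j)))) ^+ 2); first by rewrite hc mul1r.
  rewrite -[RHS]sqrrN -exprMn; congr (_ ^+ 2); rewrite mulrBr mulrA -expr2 hc; ring.
have hsum A : uniq A -> {subset A <= P} -> \sum_(u <- A) G u <= \sum_(u in P) G u.
  move=> uA AP; rewrite big_uniq // (bigID [in A] [in P]) /= -[leLHS]addr0; apply: lerD.
    rewrite le_eqVlt; apply/orP; left; apply/eqP; apply: eq_bigl => u.
    by rewrite andbC; case: (boolP (u \in A)) => //= /AP ->.
  by apply: sumr_ge0 => u _; exact: sqr_ge0.
pose A := [seq tree r j | j <- index_iota 1 (dim r)].
have uA : uniq A.
  rewrite map_inj_in_uniq ?iota_uniq // => i j; rewrite !mem_index_iota => /ht[_ h1 _ _] /ht[_ h2 _ _] E.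
  by rewrite -h1 -h2 E.
have AP : {subset A <= P}.
  by move=> u /mapP[j]; rewrite mem_index_iota => /ht[h _ _ _] ->.
have TA : \sum_(1 <= j < dim r) ((s j)%:~R - (f j - f (par j))) ^+ 2 = \sum_(u <- A) G u.
  by rewrite big_map; apply: eq_big_nat => j /eT.
have ei : 0 < e^-1 by rewrite invr_gt0.
have [|F [F1 F2 F3 F4]] := integral_potential e0 hC eC hm0 hn hpar hs (f := f).
  by apply: le_trans hf; rewrite lerD2l ler_wpM2l ?(ltW ei) // TA hsum.
have FE u : u \in P -> - a v u = root_ip r F u.
  move=> uP; case: (boolP (u \in A)) => uA'.
    case/mapP: uA' => j; rewrite mem_index_iota => hj ->.
    have [_ h2 _ h4] := ht j hj; have := F1 j hj; have := c1 j hj.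
    rewrite /root_ip h2 h4 /s -/(par j) => hc.
    by have : sgn1 r (tree r j) * sgn1 r (tree r j) = 1; [lia|nia].
  have [h1 h2 h3 h4 h5] := hP u uP.
  apply: (F4 _ _ _ _ _ h3 h1 h2 h4 h5).
  apply: le_trans hf; rewrite lerD2l ler_wpM2l ?(ltW ei) //.
  have := hsum (u :: A); rewrite big_cons TA addrC; apply; first by rewrite /= uA'.
  by move=> w; rewrite inE => /orP[/eqP ->|/AP].
apply: (add_root ha hr vP FE F2); first by move: F3; rewrite /index_iota subn0.
(* The neighbour [u0] of [v] shows that [F] is not zero. *)
have [h1 h2 _ _ _] := hP u0 u0P.
have := FE u0 u0P; rewrite /root_ip => h.
have [z|h'] := eqVneq (F (end1 r u0)) 0; last by exists (end1 r u0).
by exists (end2 r u0) => //; apply: contraNneq au0 => z'; apply/eqP; move: h; rewrite z z'; lia.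
Qed.

Definition induced_path (s : seq T) u0 : Prop := uniq s /\
  forall i j, (i < size s)%N -> (j < size s)%N -> (a (nth u0 s i) (nth u0 s j) != 0)
     = (i == j.+1) || (j == i.+1).

Lemma represents_connected S s u0 : connected_on S -> spec_le a (2 + e) S ->
  {subset s <= S} -> induced_path s u0 -> (43 * (m0 + 3) < size s)%N ->
  exists2 r, represents a r S & (size s < dim r)%N.
Proof.
move=> cS hsp sS [us ps] ns.
have [|r0 [hr0 dr0 _]] := represents_path ha us _ ps; first exact: leq_ltn_trans ns.
pose P0 := [set u in s].
suff H k P r : (#|S :\: P| <= k)%N -> P \subset S -> P != set0 -> represents a r P ->
    (size s < dim r)%N -> exists2 r, represents a r S & (size s < dim r)%N.
  apply: (H _ P0 r0 (leqnn _)) => //; last by rewrite dr0.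
    by apply/subsetP => u; rewrite inE => /sS.
  apply/set0Pn; exists (nth u0 s 0); rewrite inE mem_nth //; exact: leq_ltn_trans ns.
elim: k P r => [|k IH] P r hk PS P0' hr hd.
  exists r => //; suff -> : S = P by [].
  by apply/eqP; rewrite eqEsubset PS andbT -setD_eq0 -cards_eq0 -leqn0.
have [<-|PnS] := eqVneq P S; first by exists r.
have [u [v [uP vSP avu]]] := cS P PS P0' PnS.
move: (vSP); rewrite inE => /andP[vP vS].
have vPS : v |: P \subset S by rewrite subUset sub1set vS.
have [|r' hr' hd'] := extend_step (ltn_trans ns hd) hr vP _ (spec_le_sub vPS hsp).
  by exists u.
apply: (IH (v |: P) r' _ vPS) => //; last exact: leq_trans hd'.
- by move: hk; rewrite (cardsD1 v) vSP add1n ltnS setDDl setUC.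
- by apply/set0Pn; exists v; rewrite setU11.
Qed.

End Key.

(** With suitable signs the roots of a path add up to [e_0 - e_n], of squared norm 2. Hence the sign
    vector has form at least [2 n - 2], while [spec_le] allows at most [l n]. *)
Lemma induced_path_short (R : archiRealFieldType) (T : finType) (a : T -> T -> int)
    (S : {set T}) s u0 (l : R) :
  signed_symmetric a -> spec_le a l S -> {subset s <= S} -> induced_path a s u0 ->
  (0 < size s)%N -> (2 - l) * (size s)%:R <= 2.
Proof.
move=> ha hsp sS [us ps] s0.
have [r [hr dr hc]] := represents_path ha us s0 ps.
have [n0 hP hip ht] := hr.
pose c u : R := if u \in s then (sgn1 r u)%:~R else 0.
have c0 u : u \notin [set u in s] -> c u = 0 by rewrite inE /c => /negbTE ->.
have h1 : \sum_u c u ^+ 2 = (size s)%:R.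
  rewrite -(card_uniqP us) -sum1_card natr_sum [RHS]big_mkcond; apply: eq_bigr => u _.
  rewrite /c; case: ifP => us'; last by rewrite expr0n.
  have [|_ _ _ h _] := hP u; first by rewrite inE.
  by rewrite -[LHS]real_normK ?num_real // -intr_norm h expr1n.
have h2 : \sum_(j < dim r) (\sum_u c u * (coord r u j)%:~R) ^+ 2 <= 2.
  have -> : \sum_(j < dim r) (\sum_u c u * (coord r u j)%:~R) ^+ 2
     = \sum_(0 <= j < dim r) ((j == 0%N)%:R + (j == size s)%:R).
    rewrite big_mkord; apply: eq_bigr => j _.
    have -> : \sum_u c u * (coord r u j)%:~R = (((j : nat) == 0%N)%:R - ((j : nat) == size s)%:R : int)%:~R.
      rewrite -hc rmorph_sum /= (big_uniq _ us) [RHS]big_mkcond; apply: eq_bigr => u _.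
      by rewrite /c; case: ifP; rewrite ?mul0r // rmorphM.
    have [->|j0] := eqVneq (j : nat) 0%N; first by rewrite eq_sym (gtn_eqF s0) /= subr0 addr0 expr1n.
    by case: eqP => _ /=; rewrite !sub0r ?oppr0 ?add0r ?rmorphN ?sqrrN ?expr1n ?expr0n ?addr0.
  rewrite big_split /= -!natr_sum -natrD ler_nat.
  have E x : (\sum_(0 <= j < dim r) (j == x : nat) <= 1)%N.
    rewrite -[X in (X <= _)%N]/(\sum_(0 <= j < dim r) nat_of_bool (j == x))%N.
    rewrite (eq_bigr (fun j => if j == x then 1 else 0)%N); last by move=> j _; case: eqP.
    by rewrite -big_mkcond big_nat1_eq; case: ifP.
  exact: (leq_add (E 0%N) (E (size s))).
move: h2; rewrite (rep_form hr c0) h1.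
have := spec_le_sub _ hsp; rewrite /spec_le => /(_ [set u in s] _ c c0).
rewrite h1 => h3 h4.
have := h3 ltac:(by apply/subsetP => u; rewrite inE => /sS).
lra.
Qed.

Lemma leq_card_bigcup (I T : finType) (A : {set I}) (F : I -> {set T}) :
  (#|\bigcup_(i in A) F i| <= \sum_(i in A) #|F i|)%N.
Proof.
elim/big_rec2: _ => [|i m B _ h]; first by rewrite cards0.
by apply: leq_trans (leq_card_setU _ _).1 _; rewrite leq_add2l.
Qed.

(** * Balls, layers and bounded obstructions *)

Section Balls.
Variables (T : finType) (a : T -> T -> int).
Hypothesis ha : signed_symmetric a.
Variables (S : {set T}) (D : nat) (o : T).
Hypotheses (hdeg : forall u, u \in S -> (#|[set v in S | a u v != 0%R]| <= D)%N)
  (cS : connected_on a S) (oS : o \in S).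

Fixpoint ball (k : nat) : {set T} :=
  if k is k'.+1 then ball k' :|: [set v in S | [exists u in ball k', a u v != 0%R]] else [set o].

Lemma ball_sub k : ball k \subset S.
Proof.
elim: k => [|k IH] /=; first by rewrite sub1set.
by rewrite subUset IH; apply/subsetP => v; rewrite inE => /andP[].
Qed.

Lemma ball_mono k l : (k <= l)%N -> ball k \subset ball l.
Proof.
move=> kl; rewrite -(subnKC kl); elim: (l - k)%N => [|m IH]; first by rewrite addn0.
by rewrite addnS; apply: subset_trans IH _; rewrite /= subsetUl.
Qed.

Lemma center_ball k : o \in ball k.
Proof. by apply: (subsetP (ball_mono (leq0n k))); rewrite inE. Qed.

Lemma ball_step k u v : u \in ball k -> v \in S -> a u v != 0 -> v \in ball k.+1.
Proof.
by move=> uk vS auv; rewrite /= !inE vS; apply/orP; right; apply/existsP; exists u; rewrite uk.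
Qed.

Lemma card_ball k : (#|ball k| <= (D + 1) ^ k)%N.
Proof.
elim: k => [|k IH]; first by rewrite cards1.
have h : ball k.+1 \subset \bigcup_(u in ball k) (u |: [set v in S | a u v != 0]).
  apply/subsetP => v; rewrite /= inE => /orP[vk|].
    by apply/bigcupP; exists v => //; rewrite setU11.
  rewrite inE => /andP[vS /existsP[u /andP[uk auv]]].
  by apply/bigcupP; exists u => //; rewrite !inE vS auv orbT.
apply: leq_trans (subset_leq_card h) _; apply: leq_trans (leq_card_bigcup _ _) _.
rewrite expnS mulnC; apply: leq_trans (_ : \sum_(u in ball k) (D + 1) <= _)%N.
  apply: leq_sum => u uk; rewrite addnC; apply: leq_trans (leq_card_setU _ _).1 _.
  by rewrite cards1 leq_add2l hdeg // (subsetP (ball_sub k)).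
by rewrite sum_nat_const leq_mul2r IH orbT.
Qed.

Lemma ball_grows k : ball k != S -> exists2 v, v \in ball k.+1 & v \notin ball k.
Proof.
move=> hk; have k0 : ball k != set0 by apply/set0Pn; exists o; exact: center_ball.
have [u [v [uk vk auv]]] := cS (ball_sub k) k0 hk.
move: vk; rewrite inE => /andP[vk vS]; exists v => //; apply: (ball_step uk vS); have [as_ _ _] := ha; by rewrite as_.
Qed.

(** A shortest path is induced: a chord would put its far end into a smaller ball. *)
Lemma geodesic k v : v \in ball k -> (0 < k -> v \notin ball k.-1)%N ->
  exists s, [/\ size s = k.+1, last o s = v, {subset s <= S}, induced_path a s o &
    forall i, (i <= k)%N -> nth o s i \in ball i /\ ((0 < i)%N -> nth o s i \notin ball i.-1)].
Proof.
have [as_ a0 _] := ha.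
elim: k v => [|k IH] v.
  rewrite inE => /eqP -> _; exists [:: o]; split=> //.
  - by move=> u; rewrite inE => /eqP ->.
  - by split=> // -[|//] [|//] _ _; rewrite /= a0.
  - by case=> // _; rewrite inE.
move=> vk /(_ isT) /= vnk.
have [u uk /andP[auv vS]] : exists2 u, u \in ball k & (a u v != 0) && (v \in S).
  move: vk; rewrite /= inE (negbTE vnk) inE => /andP[vS /existsP[u /andP[uk auv]]].
  by exists u; rewrite ?auv.
have [|s [sz ls sS [us hs] hl]] := IH u uk.
  move=> k0; apply: contra vnk => uk'.
  by have := ball_step uk' vS auv; rewrite prednK.
have nv i : (i <= k)%N -> (a (nth o s i) v != 0) = (i == k).
  move=> ik; have [->|ik'] := eqVneq i k.
    by rewrite (_ : nth o s k = u) ?auv // -ls -nth_last sz.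
  apply: contraNF vnk => h; have [h1 _] := hl i ik.
  apply: (subsetP (ball_mono (_ : i.+1 <= k)%N)); first by lia.
  exact: ball_step h1 vS h.
have sE i : (i <= k)%N -> nth o (rcons s v) i = nth o s i by move=> ik; rewrite nth_rcons sz ltnS ik.
have sv : nth o (rcons s v) k.+1 = v by rewrite nth_rcons sz ltnn eqxx.
exists (rcons s v); split.
- by rewrite size_rcons sz.
- by rewrite last_rcons.
- by move=> w; rewrite mem_rcons inE => /orP[/eqP ->|/sS].
- split.
    rewrite rcons_uniq us andbT; apply: contra vnk => /(nthP o)[i]; rewrite sz ltnS => ik <-.
    by have [h _] := hl i ik; exact: (subsetP (ball_mono ik)).
  move=> i j; rewrite size_rcons sz !ltnS => hi hj.
  move: hi hj; rewrite leq_eqVlt => /orP[/eqP ->|hi]; rewrite leq_eqVlt => /orP[/eqP ->|hj].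
  - by rewrite a0 /=; lia.
  - rewrite sv sE // as_ nv //; lia.
  - rewrite sv sE // nv //; lia.
  - by rewrite !sE // hs ?sz.
- move=> i; rewrite leq_eqVlt => /orP[/eqP ->|hi]; first by rewrite sv.
  rewrite sE //; exact: hl.
Qed.

Lemma long_induced_path k : ((D + 1) ^ k < #|S|)%N ->
  exists s, [/\ (k < size s)%N, {subset s <= S} & induced_path a s o].
Proof.
move=> hk.
have hb : ball k != S by apply: contraTneq hk => <-; rewrite -leqNgt card_ball.
have [v v1 v2] := ball_grows hb.
have [|s [sz _ sS hs _]] := @geodesic k.+1 v v1; first by [].
by exists s; split=> //; rewrite sz.
Qed.


Lemma sum_deg_le (R : realDomainType) (x : T -> R) :
  \sum_(u in S) \sum_(v in S) (`|a u v|)%:~R * (x u ^+ 2 + x v ^+ 2)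
    <= 2 * D%:R * \sum_(u in S) x u ^+ 2.
Proof.
have [as_ _ a1] := ha.
have h : \sum_(u in S) \sum_(v in S) (`|a u v|)%:~R * x u ^+ 2
    <= D%:R * \sum_(u in S) x u ^+ 2.
  rewrite mulr_sumr; apply: ler_sum => u uS; rewrite -mulr_suml; apply: ler_wpM2r; first exact: sqr_ge0.
  apply: le_trans (_ : (#|[set v in S | a u v != 0]|)%:R <= _); last by rewrite ler_nat hdeg.
  rewrite -sum1_card natr_sum big_mkcond [leRHS]big_mkcond /=.
  apply: ler_sum => v _; rewrite inE; case: ifP => //= vS.
  case: eqP => [->|_] /=; first by rewrite normr0.
  by rewrite (_ : 1 = 1%:~R) // ler_int.
under eq_bigr => u _ do (under eq_bigr => v _ do rewrite mulrDr; rewrite big_split /=).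
rewrite big_split /= [X in _ + X]exchange_big /=.
under [X in _ + X]eq_bigr => u _ do under eq_bigr => v _ do rewrite as_.
rewrite -mulrA mulr2n mulrDl mul1r; exact: lerD.
Qed.

(** Cut [x] at the boundary of [ball j]. Both pieces live on proper subsets, so only edges leaving
    the ball can push the form above [l]. An ordered edge leaves at most one of the balls, so over
    all [k] radii the excess totals at most [2 D |x|^2]; averaging leaves a [k]-th of it. *)
Lemma layer_cut (R : archiRealFieldType) (l : R) k : (0 < k)%N -> ((D + 1) ^ k < #|S|)%N ->
  (forall S' : {set T}, S' \proper S -> spec_le a l S') ->
  spec_le a (l + 2 * D%:R / k%:R) S.
Proof.
move=> k0 hk hp x hx; have [as_ a0 a1] := ha.
pose b j (u : T) : R := (u \in ball j)%:R.
pose cr j : R := \sum_(u in S) \sum_(v in S) b j u * (1 - b j v) * ((`|a u v|)%:~R * (x u ^+ 2 + x v ^+ 2)).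
have cut j : (j < k)%N -> adj_form a x x <= l * (\sum_u x u ^+ 2) + cr j.
  move=> jk.
  have jS : ball j \proper S.
    rewrite properEneq ball_sub andbT; apply: contraTneq hk => <-; rewrite -leqNgt.
    by apply: leq_trans (card_ball j) _; rewrite leq_pexp2l ?addn1 // ltnW.
  have jS' : S :\: ball j \proper S.
    rewrite properEneq subsetDl andbT; apply/eqP => E.
    by have := oS; rewrite -E inE center_ball.
  pose x1 u := b j u * x u; pose x2 u := (1 - b j u) * x u.
  have h1 : adj_form a x1 x1 <= l * \sum_u x1 u ^+ 2.
    by apply: hp jS _ _ => u /negbTE h; rewrite /x1 /b h mul0r.
  have h2 : adj_form a x2 x2 <= l * \sum_u x2 u ^+ 2.
    apply: hp jS' _ _ => u; rewrite inE negb_and negbK /x2 /b => /orP[->|uS].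
      by rewrite subrr mul0r.
    by rewrite hx // mulr0.
  have bb u : b j u * b j u = b j u by rewrite /b; case: (_ \in _); rewrite ?mulr1 ?mulr0.
  have b01 u : 0 <= b j u <= 1 by rewrite /b; case: (_ \in _) => /=; rewrite ?lexx ?ler01.
  have e3 : \sum_u x u ^+ 2 = \sum_u x1 u ^+ 2 + \sum_u x2 u ^+ 2.
    rewrite -big_split; apply: eq_bigr => u _ /=; rewrite /x1 /x2.
    have := bb u; move: (b j u) => z hz.
    have -> : (z * x u) ^+ 2 + ((1 - z) * x u) ^+ 2 = (z * z + 1 - 2 * z + z * z) * x u ^+ 2 by ring.
    by rewrite hz; ring.
  have e4 : adj_form a x x = adj_form a x1 x1 + adj_form a x2 x2 + 2 * adj_form a x1 x2.
    have sy : adj_form a x1 x2 = adj_form a x2 x1.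
      rewrite /adj_form exchange_big; apply: eq_bigr => u _; apply: eq_bigr => v _.
      by rewrite as_; ring.
    rewrite mulr2n mulrDl mul1r {2}sy /adj_form -!big_split; apply: eq_bigr => u _ /=.
    by rewrite -!big_split; apply: eq_bigr => v _ /=; rewrite /x1 /x2; ring.
  have h5 : 2 * adj_form a x1 x2 <= cr j.
    have -> : adj_form a x1 x2 = \sum_(u in S) \sum_(v in S) (a u v)%:~R * x1 u * x2 v.
      rewrite [RHS]big_mkcond; apply: eq_bigr => u _; case: ifP => uS; last first.
        by rewrite big1 // => v _; rewrite /x1 hx ?uS // !mulr0 mul0r.
      rewrite [RHS]big_mkcond; apply: eq_bigr => v _; case: ifP => vS //.
      by rewrite /x2 (hx v) ?vS // !mulr0.
    rewrite mulr_sumr; apply: ler_sum => u _; rewrite mulr_sumr; apply: ler_sum => v _.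
    rewrite /x1 /x2; have : 0 <= b j u * (1 - b j v).
      by rewrite mulr_ge0 ?subr_ge0; case/andP: (b01 u) => // ? _; case/andP: (b01 v).
    move: (b j u) (b j v) => p q pq.
    have -> : 2 * ((a u v)%:~R * (p * x u) * ((1 - q) * x v))
      = p * (1 - q) * (2 * (a u v)%:~R * x u * x v) by ring.
    apply: ler_wpM2l => //.
    have : `|(a u v)%:~R : R| <= 1 by rewrite -intr_norm (_ : 1 = 1%:~R) // ler_int.
    have [z|z] : a u v = 0 \/ `|a u v| = 1 by have := a1 u v; lia.
      by rewrite z normr0 !(mulr0, mul0r).
    rewrite z mul1r; have [->|->] : a u v = 1 \/ a u v = -1 by lia.
      by have := sqr_ge0 (x u - x v); lra.
    by rewrite rmorphN1; have := sqr_ge0 (x u + x v); lra.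
  rewrite e4 e3 mulrDr; lra.
have hcr : \sum_(j < k) cr j <= 2 * D%:R * \sum_u x u ^+ 2.
  apply: le_trans (_ : 2 * D%:R * \sum_(u in S) x u ^+ 2 <= _); last first.
    apply: ler_wpM2l; first by rewrite mulr_ge0.
    by rewrite [leLHS]big_mkcond; apply: ler_sum => u _; case: ifP => // _; exact: sqr_ge0.
  apply: le_trans (sum_deg_le x); rewrite exchange_big; apply: ler_sum => u uS /=.
  rewrite exchange_big; apply: ler_sum => v vS /=; rewrite -mulr_suml -[leRHS]mul1r.
  have [z|z] := eqVneq (a u v) 0; first by rewrite z normr0 mul0r !mulr0.
  apply: ler_wpM2r; first by rewrite mulr_ge0 ?addr_ge0 ?sqr_ge0 // ler0z.
  case: (boolP [exists j : 'I_k, u \in ball j]) => [/existsP[j0 uj0]|/existsPn h]; last first.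
    by rewrite big1 ?ler01 // => j _; rewrite /b (negbTE (h j)) mul0r.
  (* [i] is the first radius whose ball contains [u]; from the next radius on [v] is inside as
     well. *)
  have [i ui imin] := @arg_minnP _ j0 (fun j : 'I_k => u \in ball j) (fun j => j : nat) uj0.
  rewrite (bigD1 i) //= [X in _ + X]big1 ?addr0; last first.
    move=> j ji; rewrite /b; case: (boolP (u \in ball j)) => uj; last by rewrite mul0r.
    have : (i < j)%N by rewrite ltn_neqAle imin // andbT eq_sym.
    by move=> /ball_mono/subsetP/(_ _ (ball_step ui vS z)) ->; rewrite subrr mulr0.
  by rewrite /b; do 2 case: (_ \in _) => /=; rewrite ?subrr ?subr0 ?mulr0 ?mul0r ?mul1r ?ler01.
have : \sum_(j < k) adj_form a x x <= \sum_(j < k) (l * (\sum_u x u ^+ 2) + cr j).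
  by apply: ler_sum => j _; exact: cut.
rewrite big_split /= !sumr_const card_ord -(mulr_natl (adj_form _ _ _)) -(mulr_natl (l * _)) => h.
have k0' : (0 : R) < k%:R by rewrite ltr0n.
rewrite -(ler_pM2l k0'); apply: le_trans h _; rewrite mulrDl mulrDr lerD2l.
apply: le_trans hcr _; rewrite le_eqVlt; apply/orP; left; apply/eqP.
by field; rewrite gt_eqF.
Qed.
End Balls.

(** * Obstructions of bounded size *)

Section Obstruction.
Variable R : archiRealFieldType.
Implicit Types (T : finType) (t l : R).

(** For [C = 1 / (t - 1)] one has [1 / (C (C + 1)) = t + 1 / t - 2]. The strict gap between this and
    [max (l - 2) 0] allows [e] to be taken midway. *)
Lemma threshold_params t l : 1 < t -> t ^+ 6 <= t ^+ 2 + 1 -> l < t + t^-1 ->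
  exists e C m0, [/\ 0 < e, subcrit C, e < (C * (C + 1))^-1,
    (forall m, (m0 <= m)%N -> C <= tail_conductance e m) & l < 2 + e].
Proof.
move=> t1 t6 lt; pose C := (t - 1)^-1.
have u0 : 0 < t - 1 by lra.
have C0 : 0 < C by rewrite invr_gt0.
have tC : t = (C + 1) / C by rewrite /C; field; rewrite gt_eqF.
have C1 : C != 0 by rewrite gt_eqF.
have hC : subcrit C.
  split=> //; have h : 0 <= C ^+ 6 * (t ^+ 2 + 1 - t ^+ 6).
    by rewrite mulr_ge0 ?subr_ge0 // exprn_ge0 // ltW.
  rewrite -subr_ge0; suff -> : C ^+ 6 - (4 * C ^+ 5 + 14 * C ^+ 4 + 20 * C ^+ 3 + 15 * C ^+ 2
    + 6 * C + 1) = C ^+ 6 * (t ^+ 2 + 1 - t ^+ 6) by [].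
  by rewrite tC; field.
have kE : (C * (C + 1))^-1 = t + t^-1 - 2.
  rewrite tC; field; apply/andP; split=> //; rewrite gt_eqF //; lra.
have k0 : 0 < (C * (C + 1))^-1 by rewrite invr_gt0 mulr_gt0 //; lra.
pose m := Num.max (l - 2) 0.
have mk : m < (C * (C + 1))^-1 by rewrite /m gt_max k0 kE andbT; lra.
have m0 : 0 <= m by rewrite /m le_max lexx orbT.
have ml : l - 2 <= m by rewrite /m le_max lexx.
pose e := (m + (C * (C + 1))^-1) / 2.
have e0 : 0 < e by rewrite /e; lra.
have ek : e < (C * (C + 1))^-1 by rewrite /e; lra.
have [|n hn] := tail_conductance_lim e0 C0.
  have : 0 < C * (C + 1) by rewrite mulr_gt0 //; lra.
  by move=> h; rewrite -ltr_pdivlMr // div1r.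
by exists e, C, n; split=> //; rewrite /e; lra.
Qed.

Definition deg_le T (a : T -> T -> int) (S : {set T}) (D : nat) : Prop :=
  forall u, u \in S -> (#|[set v in S | a u v != 0]| <= D)%N.

Lemma large_connected t l D N0 : 1 < t -> t ^+ 6 <= t ^+ 2 + 1 -> l < t + t^-1 ->
  exists M0 : nat, forall T (a : T -> T -> int) (S : {set T}),
    signed_symmetric a -> deg_le a S D -> connected_on a S -> spec_le a l S ->
    (M0 < #|S|)%N -> 2 <= l /\ exists2 r, represents a r S & (N0 <= dim r)%N.
Proof.
move=> t1 t6 lt; have [e [C [m0 [e0 hC eC hm0 le]]]] := threshold_params t1 t6 lt.
(* The path length serves three purposes: enough coordinates to extend the representation, dimension
   at least [N0], and a contradiction with [induced_path_short] when [l < 2]. *)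
pose K := (43 * (m0 + 3) + N0 + Num.bound (2 / (2 - l)))%N.
exists ((D + 1) ^ K)%N => T a S ha hdeg cS hsp hS.
have [o oS] : exists o, o \in S by apply/set0Pn; rewrite -card_gt0; exact: leq_ltn_trans hS.
have [s [hs sS ps]] := long_induced_path ha hdeg cS oS hS.
split.
  rewrite leNgt; apply/negP => l2.
  have := induced_path_short ha hsp sS ps (leq_ltn_trans (leq0n _) hs); apply/negP.
  rewrite -ltNge mulrC -ltr_pdivrMr ?subr_gt0 //.
  apply: lt_le_trans (archi_boundP _) _; first by rewrite divr_ge0 // subr_ge0 ltW.
  by rewrite ler_nat; apply: leq_trans (ltnW hs); rewrite /K leq_addl.
have hsp' : spec_le a (2 + e) S.
  move=> x hx; apply: le_trans (hsp x hx) _; apply: ler_wpM2r (ltW le).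
  by apply: sumr_ge0 => u _; exact: sqr_ge0.
have [|r hr hd] := represents_connected e0 hC eC hm0 ha cS hsp' sS ps.
  by apply: leq_ltn_trans hs; rewrite /K -addnA leq_addr.
exists r => //; apply: leq_trans (ltnW hd); apply: leq_trans (ltnW hs).
by rewrite /K addnAC leq_addl.
Qed.

Lemma spec_le_split T (a : T -> T -> int) l (S X : {set T}) : signed_symmetric a ->
  X \subset S -> (forall u v, u \in X -> v \in S :\: X -> a u v = 0) ->
  spec_le a l X -> spec_le a l (S :\: X) -> spec_le a l S.
Proof.
move=> [as_ _ _] XS h0 h1 h2 x hx.
pose b u : R := (u \in X)%:R.
pose x1 u := b u * x u; pose x2 u := (1 - b u) * x u.
have k1 := h1 x1 _; have k2 := h2 x2 _.
have {}k1 : adj_form a x1 x1 <= l * \sum_u x1 u ^+ 2.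
  by apply: k1 => u /negbTE h; rewrite /x1 /b h mul0r.
have {}k2 : adj_form a x2 x2 <= l * \sum_u x2 u ^+ 2.
  apply: k2 => u; rewrite inE negb_and negbK /x2 /b => /orP[->|uS].
    by rewrite subrr mul0r.
  by rewrite hx // mulr0.
have e3 : \sum_u x u ^+ 2 = \sum_u x1 u ^+ 2 + \sum_u x2 u ^+ 2.
  rewrite -big_split; apply: eq_bigr => u _ /=; rewrite /x1 /x2 /b.
  by case: (_ \in _) => /=; rewrite ?subrr ?subr0 ?mul0r ?mul1r ?expr0n ?addr0 ?add0r.
have e4 : adj_form a x x = adj_form a x1 x1 + adj_form a x2 x2.
  rewrite /adj_form -!big_split; apply: eq_bigr => u _ /=.
  rewrite -!big_split; apply: eq_bigr => v _ /=; rewrite /x1 /x2 /b.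
  case: (boolP (u \in X)) => uX; case: (boolP (v \in X)) => vX /=;
    rewrite ?subrr ?subr0 ?mul0r ?mul1r ?mulr0 ?mul0r ?addr0 ?add0r //.
    case: (boolP (v \in S)) => vS; last by rewrite (hx v) ?mulr0.
    by rewrite h0 ?mul0r ?mulr0 ?mul0r // inE vX.
  case: (boolP (u \in S)) => uS; last by rewrite (hx u) ?mulr0 ?mul0r.
  by rewrite as_ h0 ?mul0r // inE uX.
by rewrite e3 e4 mulrDr lerD.
Qed.

Lemma minimal_obstruction T (a : T -> T -> int) l (S : {set T}) :
  ~ spec_le a l S -> exists S' : {set T}, [/\ S' \subset S, ~ spec_le a l S' &
    forall S'' : {set T}, S'' \proper S' -> spec_le a l S''].
Proof.
elim: {S}#|S| {-2}S (leqnn #|S|) => [|n IH] S hS hn.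
  exists S; split=> // S'' /proper_card; lia.
have [h|] := EM (forall S'' : {set T}, S'' \proper S -> spec_le a l S''); first by exists S.
move/existsNP => [S'' /not_implyP[pS nS]].
have [|S' [h1 h2 h3]] := IH S'' _ nS; first by have := proper_card pS; lia.
by exists S'; split=> //; apply: subset_trans h1 (proper_sub pS).
Qed.

Lemma minimal_connected T (a : T -> T -> int) l (S : {set T}) : signed_symmetric a ->
  ~ spec_le a l S -> (forall S' : {set T}, S' \proper S -> spec_le a l S') ->
  connected_on a S.
Proof.
move=> ha hn hp X XS X0 XnS; apply: contrapT => H; apply: hn.
apply: (spec_le_split ha XS).
- move=> u v uX vX; apply/eqP/negPn/negP => h; apply: H.
  by exists u, v; split=> //; have [as_ _ _] := ha; rewrite as_.
- by apply: hp; rewrite properEneq XnS XS.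
apply: hp; rewrite properEneq subsetDl andbT; apply/eqP => E.
have /set0Pn[o oX] := X0; have := subsetP XS _ oX; by rewrite -E inE oX.
Qed.

(** By [layer_cut] a large minimal obstruction exceeds [l] only slightly, so it is represented by
    roots and has eigenvalues at most 2. This is no obstruction when [2 <= l], and the choice of [d]
    excludes [l < 2]. *)
Lemma small_obstruction t l D : 1 < t -> t ^+ 6 <= t ^+ 2 + 1 -> l < t + t^-1 ->
  exists M : nat, forall T (a : T -> T -> int) (S : {set T}),
    signed_symmetric a -> deg_le a S D -> ~ spec_le a l S ->
    exists S' : {set T}, [/\ S' \subset S, (#|S'| <= M)%N & ~ spec_le a l S'].
Proof.
move=> t1 t6 lt.
(* The perturbed bound must stay below the threshold and, if [l < 2], also below 2. *)
pose d := if l < 2 then Num.min (t + t^-1 - l) (2 - l) else t + t^-1 - l.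
have d0 : 0 < d by rewrite /d; case: ifP => h; rewrite ?lt_min !subr_gt0 ?lt // h.
pose k := (Num.bound (2 * D%:R / d)).+1.
have k0 : (0 : R) < k%:R by rewrite ltr0n.
have kd : 2 * D%:R / k%:R < d.
  rewrite ltr_pdivrMr // [X in _ < X]mulrC -ltr_pdivrMr //.
  apply: lt_le_trans (archi_boundP _) _; first by rewrite divr_ge0 ?mulr_ge0 // ltW.
  by rewrite ler_nat.
have [|M0 hM0] := @large_connected t (l + 2 * D%:R / k%:R) D 0 t1 t6.
  by move: kd; rewrite /d; case: ifP => _; rewrite ?lt_min => h; [case/andP: h|]; lra.
exists (M0 + (D + 1) ^ k)%N => T a S ha hdeg hn.
have [S' [S'S nS' hp]] := minimal_obstruction hn.
exists S'; split=> //; rewrite leqNgt; apply/negP => hbig.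
have hdeg' : deg_le a S' D.
  move=> u uS; apply: leq_trans (hdeg u (subsetP S'S _ uS)); apply: subset_leq_card.
  by apply/subsetP => v; rewrite !inE => /andP[/(subsetP S'S) -> ->].
have cS := minimal_connected ha nS' hp.
have [o oS] : exists o, o \in S' by apply/set0Pn; rewrite -card_gt0; lia.
have hk : ((D + 1) ^ k < #|S'|)%N by lia.
have hsp := layer_cut ha hdeg' oS (ltn0Sn _) hk hp.
have [|h2 [r hr _]] := hM0 T a S' ha hdeg' cS hsp; first by lia.
apply: nS' => x hx; apply: le_trans (rep_spec_le2 hr hx) _.
apply: ler_wpM2r; first by apply: sumr_ge0 => u _; exact: sqr_ge0.
rewrite leNgt; apply/negP => l2; move: kd; rewrite /d l2 lt_min => /andP[_ h]; lra.
Qed.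

End Obstruction.

(** * Almost complete multipartite graphs *)

Section NatScope.
Local Open Scope nat_scope.

Lemma subset_of_card (T : finType) (A : {set T}) k : k <= #|A| ->
  exists2 B : {set T}, B \subset A & #|B| = k.
Proof.
move=> kA; exists [set x in take k (enum A)].
  by apply/subsetP => x; rewrite inE => /mem_take; rewrite mem_enum.
rewrite cardsE (card_uniqP _) ?take_uniq ?enum_uniq // size_take -cardE.
by move: kA; case: ltngtP.
Qed.

Definition independent (T : finType) (b : rel T) (A : {set T}) : Prop :=
  {in A &, forall u v, ~~ b u v}.

Definition clique (T : finType) (b : rel T) (A : {set T}) : Prop :=
  {in A &, forall u v, u != v -> b u v}.

Lemma ramsey s c : exists n, forall (T : finType) (b : rel T) (X : {set T}),
  symmetric b -> irreflexive b -> n <= #|X| ->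
  exists2 A : {set T}, A \subset X & (independent b A /\ #|A| = s) \/ (clique b A /\ #|A| = c).
Proof.
elim: s c => [|s IHs] c.
  exists 0 => T b X _ _ _; exists set0; rewrite ?sub0set ?cards0 //.
  by left; split=> // u v; rewrite inE.
elim: c => [|c [n2 IHc]].
  exists 0 => T b X _ _ _; exists set0; rewrite ?sub0set ?cards0 //.
  by right; split=> // u v; rewrite inE.
have [n1 h1] := IHs c.+1; exists (n1 + n2).+1 => T b X bs bi hX.
have [x xX] : exists x, x \in X by apply/set0Pn; rewrite -card_gt0; lia.
pose X1 := [set y in X | (y != x) && ~~ b x y]; pose X2 := [set y in X | b x y].
have hc : #|X| <= (#|X1| + #|X2|).+1.
  have : X \subset x |: (X1 :|: X2).
    by apply/subsetP => y yX; rewrite !inE yX /=; case: (y == x); case: (b x y).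
  move/subset_leq_card => h; apply: leq_trans h _; apply: leq_trans (leq_card_setU _ _).1 _.
  rewrite cards1 add1n ltnS; exact: (leq_card_setU _ _).1.
have [h|h] : n1 <= #|X1| \/ n2 <= #|X2| by lia.
  have [A AX [[hi hA]|hcl]] := h1 T b X1 bs bi h; last first.
    by exists A; [apply: subset_trans AX _; apply/subsetP => y; rewrite inE => /andP[]|right].
  exists (x |: A).
    rewrite subUset sub1set xX; apply: subset_trans AX _.
    by apply/subsetP => y; rewrite inE => /andP[].
  have xA : x \notin A by apply/negP => /(subsetP AX); rewrite inE eqxx andbF.
  left; split; last by rewrite cardsU1 xA hA.
  move=> u v; rewrite !in_setU1 => /orP[/eqP ->|uA] /orP[/eqP ->|vA]; rewrite ?bi //.
  - by have := subsetP AX _ vA; rewrite inE => /and3P[].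
  - by have := subsetP AX _ uA; rewrite inE bs => /and3P[].
  - exact: hi.
have [A AX [hi|[hcl hA]]] := IHc T b X2 bs bi h.
  by exists A; [apply: subset_trans AX _; apply/subsetP => y; rewrite inE => /andP[]|left].
exists (x |: A).
  rewrite subUset sub1set xX; apply: subset_trans AX _.
  by apply/subsetP => y; rewrite inE => /andP[].
have xA : x \notin A by apply/negP => /(subsetP AX); rewrite inE bi andbF.
right; split; last by rewrite cardsU1 xA hA.
move=> u v; rewrite !in_setU1 => /orP[/eqP ->|uA] /orP[/eqP ->|vA]; rewrite ?eqxx //.
- by have := subsetP AX _ vA; rewrite inE => /andP[].
- by have := subsetP AX _ uA; rewrite inE bs => /andP[].
- exact: hcl.
Qed.

Section Structure.
Variables (T : finType) (b : rel T).
Hypothesis bs : symmetric b.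
Variables (p K n0 base n1 : nat).
Hypotheses (p0 : 0 < p)
  (no_split : forall z (A B : {set T}), #|A| = K -> #|B| = K -> [disjoint A & B] ->
     independent b (A :|: B) -> {in A, forall u, b z u} -> {in B, forall u, ~~ b z u} ->
     z \notin B -> False).

Definition multipartite q s : Prop := exists f : 'I_q -> {set T},
  [/\ forall i, independent b (f i), forall i, #|f i| = s &
      forall i j u v, i != j -> u \in f i -> v \in f j -> b u v].

(** Each vertex of a new part costs every old part at most [K] vertices, hence the factor [K + 1]
    for each additional part. *)
Local Notation sz q := (base * (K + 1) ^ (p.+1 - q)).
Hypotheses (hK : 0 < K) (hbase : K * K + 3 * K + 3 <= base)
  (no_mp : ~ multipartite p.+1 base)
  (hn0 : forall X : {set T}, n0 <= #|X| ->
     exists2 A : {set T}, A \subset X & independent b A /\ #|A| = K)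
  (hn1 : forall q (X : {set T}), n1 <= #|X| -> exists2 A : {set T}, A \subset X & independent b A /\ #|A| = sz q.+1).

Let sz_ge q : base <= sz q.
Proof. by rewrite leq_pmulr // expn_gt0 addn1. Qed.

Let sz_step q : q <= p -> sz q.+1 * (K + 1) <= sz q.
Proof. by move=> qp; rewrite subSS -mulnA -expnSr subSn. Qed.

Lemma avail (F Y : {set T}) k : #|Y| = k -> (forall y, y \in Y -> #|[set z in F | b y z]| <= K) ->
  #|F| <= #|[set z in F | [forall y in Y, ~~ b y z]]| + k * K.
Proof.
move=> hY h; have : F \subset [set z in F | [forall y in Y, ~~ b y z]] :|:
    \bigcup_(y in Y) [set z in F | b y z].
  apply/subsetP => z zF; rewrite in_setU inE zF /=.
  case: (boolP [forall y in Y, ~~ b y z]) => //= /forall_inPn[y yY]; rewrite negbK => byz.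
  by apply/bigcupP; exists y => //; rewrite inE zF.
move/subset_leq_card => h1; apply: leq_trans h1 _; apply: leq_trans (leq_card_setU _ _).1 _.
rewrite leq_add2l; apply: leq_trans (leq_card_bigcup _ _) _.
by rewrite -hY -sum_nat_const; apply: leq_sum.
Qed.

Lemma availC (F Y : {set T}) k : #|Y| = k -> (forall y, y \in Y -> #|[set z in F | ~~ b y z]| <= K) ->
  #|F| <= #|[set z in F | [forall y in Y, b y z]]| + k * K.
Proof.
move=> hY h; have : F \subset [set z in F | [forall y in Y, b y z]] :|:
    \bigcup_(y in Y) [set z in F | ~~ b y z].
  apply/subsetP => z zF; rewrite in_setU inE zF /=.
  case: (boolP [forall y in Y, b y z]) => //= /forall_inPn[y yY] byz.
  by apply/bigcupP; exists y => //; rewrite inE zF.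
move/subset_leq_card => h1; apply: leq_trans h1 _; apply: leq_trans (leq_card_setU _ _).1 _.
rewrite leq_add2l; apply: leq_trans (leq_card_bigcup _ _) _.
by rewrite -hY -sum_nat_const; apply: leq_sum.
Qed.

(** By [no_split] a vertex sees almost all or almost none of a large independent set. *)
Lemma near_complete (F : {set T}) x : independent b F -> K <= #|[set y in F | b x y]| ->
  #|[set y in F | ~~ b x y]| <= K.
Proof.
move=> iF h; rewrite leqNgt; apply/negP => h2.
have [A AF hA] := subset_of_card h.
have [|B BF hB] := @subset_of_card _ ([set y in F | ~~ b x y] :\ x) K.
  have := cardsD1 x [set y in F | ~~ b x y]; case: (x \in _); lia.
apply: (no_split (z := x) hA hB).
- rewrite disjoint_subset; apply/subsetP => y /(subsetP AF); rewrite !inE => /andP[_ h3].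
  by apply/negP => /(subsetP BF); rewrite !inE h3 !andbF.
- have sub : A :|: B \subset F.
    by rewrite subUset; apply/andP; split; apply/subsetP => y; [move/(subsetP AF)|move/(subsetP BF)];
      rewrite !inE => /andP[h3] // /andP[].
  by move=> u v /(subsetP sub) uF /(subsetP sub); exact: iF.
- by move=> u /(subsetP AF); rewrite inE => /andP[].
- by move=> u /(subsetP BF); rewrite !inE => /and3P[].
by apply/negP => /(subsetP BF); rewrite !inE eqxx.
Qed.

(** Take the largest [q] for which [q] parts exist. Many vertices almost complete to every part
    would supply one more part, and many vertices almost empty to two parts contradict [no_split].
    Any other vertex is almost empty to exactly one part, and this part is its colour. *)
Lemma structure : exists (W : {set T}) (c : T -> 'I_p),
  #|~: W| <= n1 + p * p * n0 /\
  forall x, x \in W ->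
    #|[set y in W | (y != x) && (b x y == (c x == c y))]| <= (p + 1) * n0.
Proof.
have [q [qp [f [fi fs fc]] hq]] : exists q, [/\ q <= p, multipartite q (sz q) & ~ multipartite q.+1 (sz q.+1)].
  apply: contrapT => H; apply: no_mp.
  have all q : q <= p.+1 -> multipartite q (sz q).
    elim: q => [_|q IH qp]; first by exists (fun _ => set0); split; case.
    by apply: contrapT => h; apply: H; exists q; split=> //; apply: IH; apply: ltnW.
  by have := all p.+1 (leqnn _); rewrite subnn muln1.
pose na x i := #|[set y in f i | b x y]|.
have nn x i : K <= na x i -> #|[set y in f i | ~~ b x y]| <= K by exact: near_complete.
pose bad0 := [set x | [forall i, K <= na x i]].
pose bad2 (ij : 'I_q * 'I_q) := [set x | [&& ij.1 != ij.2, na x ij.1 < K & na x ij.2 < K]].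
pose W := ~: (bad0 :|: \bigcup_(ij in [set: 'I_q * 'I_q]) bad2 ij).
have h0 : #|bad0| <= n1.
  rewrite leqNgt; apply/negP => h; have [Y Yb [iY sY]] := hn1 q (ltnW h).
  apply: hq.
  have g_ex i : exists B : {set T}, B \subset [set z in f i | [forall y in Y, b y z]] /\ #|B| = sz q.+1.
    have [|B] := @subset_of_card _ [set z in f i | [forall y in Y, b y z]] (sz q.+1); last by exists B.
    have hy y : y \in Y -> #|[set z in f i | ~~ b y z]| <= K.
      by move/(subsetP Yb); rewrite inE => /forallP/(_ i); exact: nn.
    have := availC sY hy; rewrite fs.
    by have := sz_step qp; lia.
  have [g hg] := choice g_ex.
  exists (fun i => if unlift ord_max i is Some j then g j else Y); split.
  - move=> i; case: unliftP => [j _|_] //; have [gs _] := hg j.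
    move=> u v /(subsetP gs); rewrite inE => /andP[uf _] /(subsetP gs); rewrite inE => /andP[vf _].
    exact: fi uf vf.
  - by move=> i; case: unliftP => [j _|_] //; have [] := hg j.
  move=> i j u v; case: unliftP => [i' ->|->]; case: unliftP => [j' ->|->].
  - rewrite (inj_eq (@lift_inj _ _)) => ij; have [g1 _] := hg i'; have [g2 _] := hg j'.
    move=> /(subsetP g1); rewrite inE => /andP[u1 _] /(subsetP g2); rewrite inE => /andP[v1 _].
    exact: (fc i' j').
  - move=> _; have [g1 _] := hg i'; move=> /(subsetP g1); rewrite inE => /andP[_ /forall_inP h1] vY.
    by rewrite bs; exact: h1.
  - move=> _ uY; have [g1 _] := hg j'; move=> /(subsetP g1); rewrite inE => /andP[_ /forall_inP h1].
    exact: h1.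
  - by rewrite eqxx.
(* Too many such vertices contain an independent set [Y]. Some [z] in [f j] is complete to a set [A]
   inside [f i] but empty to [Y], and [A :|: Y] is independent. *)
have h2 ij : #|bad2 ij| <= n0.
  rewrite leqNgt; apply/negP => h; have [Y Yb [iY sY]] := hn0 (ltnW h).
  case: ij Yb {h} => i j /= Yb.
  have Yij y : y \in Y -> [/\ i != j, na y i < K & na y j < K].
    by move=> /(subsetP Yb); rewrite inE => /and3P[].
  have [|A AF hA] := @subset_of_card _ ([set z in f i | [forall y in Y, ~~ b y z]] :\: Y) K.
    have hy y : y \in Y -> #|[set z in f i | b y z]| <= K by move/Yij => [_ /ltnW].
    have h := avail sY hy; rewrite fs in h.
    have := leq_card_setU ([set z in f i | [forall y in Y, ~~ b y z]] :\: Y) Y.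
    move=> [h3 _]; have : #|[set z in f i | [forall y in Y, ~~ b y z]]| <=
      #|([set z in f i | [forall y in Y, ~~ b y z]] :\: Y) :|: Y|.
      by apply: subset_leq_card; apply/subsetP => z hz; rewrite in_setU in_setD hz andbT; case: (z \in Y).
    have := sz_ge q; lia.
  have [z zF] : exists z, z \in [set z in f j | [forall y in Y, ~~ b y z]] :\: Y.
    apply/set0Pn; rewrite -card_gt0.
    have hy y : y \in Y -> #|[set z in f j | b y z]| <= K by move/Yij => [_ _ /ltnW].
    have h := avail sY hy; rewrite fs in h.
    have := leq_card_setU ([set z in f j | [forall y in Y, ~~ b y z]] :\: Y) Y.
    move=> [h3 _]; have : #|[set z in f j | [forall y in Y, ~~ b y z]]| <=
      #|([set z in f j | [forall y in Y, ~~ b y z]] :\: Y) :|: Y|.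
      by apply: subset_leq_card; apply/subsetP => w hw; rewrite in_setU in_setD hw andbT; case: (w \in Y).
    have := sz_ge q; lia.
  have [y0 y0Y] : exists y, y \in Y by apply/set0Pn; rewrite -card_gt0 sY.
  have [ij _ _] := Yij y0 y0Y.
  move: zF; rewrite in_setD inE => /and3P[zY zf /forall_inP zn].
  have Af u : u \in A -> [/\ u \notin Y, u \in f i & forall y, y \in Y -> ~~ b y u].
    by move=> /(subsetP AF); rewrite in_setD inE => /and3P[? ? /forall_inP].
  apply: (no_split (z := z) hA sY) => //.
  - rewrite disjoint_subset; apply/subsetP => u /Af[h _ _]; exact: h.
  - move=> u v; rewrite !in_setU => /orP[/Af[_ uf uy]|uY] /orP[/Af[_ vf vy]|vY].
    + exact: fi uf vf.
    + by rewrite bs; exact: uy.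
    + exact: vy.
    + exact: iY.
  - by move=> u /Af[_ uf _]; apply: (fc j i); rewrite // eq_sym.
  - by move=> u uY; rewrite bs; exact: zn.
have hW : #|~: W| <= n1 + p * p * n0.
  rewrite setCK; apply: leq_trans (leq_card_setU _ _).1 _; apply: leq_add => //.
  apply: leq_trans (leq_card_bigcup _ _) _; apply: leq_trans (_ : \sum_(ij in [set: 'I_q * 'I_q]) n0 <= _).
    by apply: leq_sum => ij _; exact: h2.
  by rewrite sum_nat_const cardsT card_prod card_ord leq_mul2r leq_mul ?orbT.
(* The default colour is given only to vertices of [bad0], which are outside [W]. *)
pose c x : 'I_p := if [pick i | na x i < K] is Some i then widen_ord qp i else Ordinal p0.
have hc x : x \in W -> exists i, [/\ na x i < K, forall j, j != i -> K <= na x j & c x = widen_ord qp i].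
  rewrite !inE negb_or => /andP[/forallPn[i0 hi0] /bigcupP hn].
  rewrite /c; case: pickP => [i hi|/(_ i0)]; last by rewrite ltnNge hi0.
  exists i; split=> // j ji; rewrite leqNgt; apply/negP => hj; apply: hn.
  by exists (i, j); rewrite ?inE //= eq_sym ji hi hj.
exists W, c; split=> // x xW; have [i [hi hni ci]] := hc x xW.
have same : #|[set y in W | [&& y != x, c y == c x & b x y]]| <= n0.
  rewrite leqNgt; apply/negP => h; have [Y Yb [iY sY]] := hn0 (ltnW h).
  have hY y : y \in Y -> [/\ y \in W, c y = c x & b x y].
    by move=> /(subsetP Yb); rewrite inE => /andP[? /and3P[_ /eqP]].
  have hyi y : y \in Y -> na y i <= K.
    move=> yY; have [yW cy _] := hY y yY; have [i' [hi' _ ci']] := hc y yW.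
    suff -> : i = i' by exact: ltnW.
    by apply: val_inj; move: cy; rewrite ci ci' => /(congr1 val) /=.
  have hx := near_complete.
  have [|B BF hB] := @subset_of_card _ ([set z in f i | [forall y in Y, ~~ b y z]] :\: (x |: [set z in f i | b x z])) K.
    have h3 := avail sY hyi; rewrite fs in h3.
    have [h4 _] := leq_card_setU ([set z in f i | [forall y in Y, ~~ b y z]] :\: (x |: [set z in f i | b x z])) (x |: [set z in f i | b x z]).
    have : #|[set z in f i | [forall y in Y, ~~ b y z]]| <=
      #|([set z in f i | [forall y in Y, ~~ b y z]] :\: (x |: [set z in f i | b x z])) :|: (x |: [set z in f i | b x z])|.
      by apply: subset_leq_card; apply/subsetP => w hw; rewrite in_setU in_setD hw andbT; case: (w \in _ |: _).
    have h6 := cardsU1 x [set z in f i | b x z].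
    have h7 : (x \notin [set z in f i | b x z]) <= 1 by case: (_ \notin _).
    have := sz_ge q; rewrite /na in hi; lia.
  have Bf u : u \in B -> [/\ u != x, ~~ b x u, u \in f i & forall y, y \in Y -> ~~ b y u].
    move=> /(subsetP BF); rewrite in_setD in_setU1 negb_or !inE => /andP[/andP[ux h3] /andP[uf /forall_inP hu]].
    by split=> //; move: h3; rewrite uf.
  apply: (no_split (z := x) sY hB) => //.
  - rewrite disjoint_subset; apply/subsetP => u /hY[_ _ h3]; apply/negP => /Bf[_]; by rewrite h3.
  - move=> u v; rewrite !in_setU => /orP[uY|/Bf[_ _ uf uy]] /orP[vY|/Bf[_ _ vf vy]].
    + exact: iY.
    + exact: vy.
    + by rewrite bs; exact: uy.
    + exact: fi uf vf.
  - by move=> u /hY[].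
  - by move=> u /Bf[].
  - by apply/negP => /Bf[]; rewrite eqxx.
have diff (j : 'I_q) : j != i -> #|[set y in W | (c y == widen_ord qp j) && ~~ b x y]| <= n0.
  move=> ji; rewrite leqNgt; apply/negP => h; have [Y Yb [iY sY]] := hn0 (ltnW h).
  have hY y : y \in Y -> [/\ y \in W, c y = widen_ord qp j & ~~ b x y].
    by move=> /(subsetP Yb); rewrite inE => /andP[? /andP[/eqP]].
  have hyj y : y \in Y -> na y j <= K.
    move=> yY; have [yW cy _] := hY y yY; have [i' [hi' _ ci']] := hc y yW.
    suff -> : j = i' by exact: ltnW.
    by apply: val_inj; move: cy; rewrite ci' => /(congr1 val) /=.
  have hx := nn x j (hni j ji).
  have [|A AF hA] := @subset_of_card _ ([set z in f j | [forall y in Y, ~~ b y z]] :\: [set z in f j | ~~ b x z]) K.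
    have h3 := avail sY hyj; rewrite fs in h3.
    have [h4 _] := leq_card_setU ([set z in f j | [forall y in Y, ~~ b y z]] :\: [set z in f j | ~~ b x z]) [set z in f j | ~~ b x z].
    have : #|[set z in f j | [forall y in Y, ~~ b y z]]| <=
      #|([set z in f j | [forall y in Y, ~~ b y z]] :\: [set z in f j | ~~ b x z]) :|: [set z in f j | ~~ b x z]|.
      by apply: subset_leq_card; apply/subsetP => w hw; rewrite in_setU in_setD hw andbT; case: (w \in [set z in f j | ~~ b x z]).
    have := sz_ge q; lia.
  have Af u : u \in A -> [/\ b x u, u \in f j & forall y, y \in Y -> ~~ b y u].
    move=> /(subsetP AF); rewrite in_setD !inE => /andP[h3 /andP[uf /forall_inP hu]].
    by split=> //; move: h3; rewrite uf negbK.
  apply: (no_split (z := x) hA sY) => //.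
  - rewrite disjoint_subset; apply/subsetP => u /Af[h3 _ _]; apply/negP => /hY[_ _]; by rewrite h3.
  - move=> u v; rewrite !in_setU => /orP[/Af[_ uf uy]|uY] /orP[/Af[_ vf vy]|vY].
    + exact: fi uf vf.
    + by rewrite bs; exact: uy.
    + exact: vy.
    + exact: iY.
  - by move=> u /Af[].
  - by move=> u /hY[].
  - apply/negP => /hY[_ cx _]; move: ji; rewrite ci in cx; move/(congr1 val): cx => /= /val_inj ->.
    by rewrite eqxx.
have sub : [set y in W | (y != x) && (b x y == (c x == c y))] \subset
   [set y in W | [&& y != x, c y == c x & b x y]] :|:
   \bigcup_(j in [set j : 'I_q | j != i]) [set y in W | (c y == widen_ord qp j) && ~~ b x y].
  apply/subsetP => y; rewrite inE => /andP[yW /andP[yx /eqP hb]].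
  rewrite in_setU; case: (boolP (c y == c x)) => cyx; apply/orP; [left|right].
    by rewrite inE yW yx cyx hb eq_sym cyx.
  have [j [_ _ cj]] := hc y yW; apply/bigcupP; exists j; last first.
    by rewrite inE yW cj eqxx hb eq_sym (negbTE cyx).
  by rewrite inE; apply: contra cyx => /eqP ji; rewrite cj ci ji.
apply: leq_trans (subset_leq_card sub) _; apply: leq_trans (leq_card_setU _ _).1 _.
rewrite mulnDl mul1n addnC leq_add //; apply: leq_trans (leq_card_bigcup _ _) _.
apply: leq_trans (_ : \sum_(j in [set j : 'I_q | j != i]) n0 <= _).
  by apply: leq_sum => j; rewrite inE; exact: diff.
rewrite sum_nat_const leq_mul2r; apply/orP; right; apply: leq_trans (max_card _) _.
by rewrite card_ord.
Qed.
End Structure.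

End NatScope.

(** * The Gram form of a code *)

Section GramStructure.
Variable R : archiRealFieldType.
Variables (lam gam : R) (p : nat).
Hypotheses (lam0 : 0 < lam) (gam0 : 0 <= gam) (gam1 : gam < 1)
  (p0 : (0 < p)%N) (hp : 1 < p.+1%:R * (1 - gam)).

Definition rel_form (T : finType) (b : rel T) (x : T -> R) : R :=
  \sum_u \sum_v (b u v)%:R * x u * x v.

(* The Gram matrix of the code divided by [alpha - beta] is
   [lam I - b + gam J]. *)
Definition gram_form (T : finType) (b : rel T) (x : T -> R) : R :=
  lam * \sum_u x u ^+ 2 - rel_form b x + gam * (\sum_u x u) ^+ 2.

Section Tests.
Variables (T : finType) (b : rel T).
Hypotheses (bs : symmetric b) (bi : irreflexive b)
  (psd : forall x : T -> R, 0 <= gram_form b x).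

Lemma sum_ind (A : {set T}) (c : R) : \sum_u (u \in A)%:R * c = #|A|%:R * c.
Proof.
rewrite -mulr_suml; congr (_ * _); rewrite -sum1_card natr_sum [RHS]big_mkcond.
by apply: eq_bigr => u _; case: (_ \in _).
Qed.

Lemma clique_bound (A : {set T}) : clique b A -> #|A|%:R * (1 - gam) <= lam + 1.
Proof.
move=> hA; have [->|A0] := posnP #|A|; first by rewrite mul0r addr_ge0 // ltW.
have := psd (fun u => (u \in A)%:R).
rewrite /gram_form /rel_form.
have e1 : \sum_u (u \in A)%:R = #|A|%:R :> R.
  by have := sum_ind A 1; rewrite mulr1 => <-; apply: eq_bigr => u _; rewrite mulr1.
have -> : \sum_u ((u \in A)%:R : R) ^+ 2 = #|A|%:R.
  by rewrite -e1; apply: eq_bigr => u _; case: (_ \in _); rewrite ?expr1n ?expr0n.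
have -> : \sum_u \sum_v (b u v)%:R * (u \in A)%:R * (v \in A)%:R = #|A|%:R * (#|A|%:R - 1) :> R.
  rewrite -(sum_ind A); apply: eq_bigr => u _; case: (boolP (u \in A)) => uA; last first.
    by rewrite mul0r big1 // => v _; rewrite mulr0 mul0r.
  rewrite mul1r -e1 (bigD1 u) //= [in RHS](bigD1 u) //= bi !mul0r add0r uA addrAC subrr add0r.
  apply: eq_bigr => v vu; case: (boolP (v \in A)) => vA; last by rewrite mulr0.
  by rewrite hA // ?mulr1 // eq_sym.
rewrite e1; have : (0 : R) < #|A|%:R by rewrite ltr0n.
move: (#|A|%:R : R) => m m0 h; rewrite -(ler_pM2l m0); lra.
Qed.

(** Test the vector with value 1 at [z], [tau] on [A] and [- tau] on [B]. Its entries sum to 1, so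
    the [J] term is only [gam], while the edges from [z] to [A] contribute [- 2 tau k]. The value
    [1 / (2 lam)] of [tau] is optimal. *)
Lemma split_bound z (A B : {set T}) k : #|A| = k -> #|B| = k -> [disjoint A & B] ->
  independent b (A :|: B) -> {in A, forall u, b z u} -> {in B, forall u, ~~ b z u} ->
  z \notin B -> k%:R <= 2 * lam * (lam + 1).
Proof.
move=> cA cB dAB iAB zA zB znB.
have znA : z \notin A by apply/negP => /zA; rewrite bi.
pose tau := (2 * lam)^-1.
pose y u : R := (u \in A)%:R - (u \in B)%:R.
pose x u : R := (u == z)%:R + tau * y u.
have yz : y z = 0 by rewrite /y (negbTE znA) (negbTE znB) subrr.
have sy : \sum_u y u = 0.
  rewrite sumrB; have h (S : {set T}) : \sum_u (u \in S)%:R = #|S|%:R :> R.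
    by have := sum_ind S 1; rewrite mulr1 => <-; apply: eq_bigr => u _; rewrite mulr1.
  by rewrite !h cA cB subrr.
have sy2 : \sum_u y u ^+ 2 = 2 * k%:R.
  transitivity (\sum_u ((u \in A)%:R * 1 + (u \in B)%:R * 1 : R)).
    apply: eq_bigr => u _; rewrite /y; case: (boolP (u \in A)) => uA.
      by rewrite (disjointFr dAB uA) subr0 expr1n mul0r addr0 mulr1.
    by rewrite sub0r mul0r add0r sqrrN mulr1; case: (_ \in _); rewrite ?expr1n ?expr0n.
  by rewrite big_split /= !sum_ind cA cB; ring.
have sx : \sum_u x u = 1.
  rewrite big_split /= -mulr_sumr sy mulr0 addr0 (bigD1 z) //= eqxx big1 ?addr0 //.
  by move=> u /negbTE ->.
have sx2 : \sum_u x u ^+ 2 = 1 + tau ^+ 2 * (2 * k%:R).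
  rewrite -sy2 mulr_sumr (bigD1 z) //= [in RHS](bigD1 z) //= /x eqxx yz mulr0 addr0.
  rewrite expr1n expr0n /= mulr0 add0r; congr (_ + _); apply: eq_bigr => u /negbTE ->.
  by rewrite add0r exprMn.
have yy : rel_form b y = 0.
  rewrite /rel_form big1 // => u _; rewrite big1 // => v _; rewrite /y.
  case: (boolP (u \in A :|: B)) => uAB; last first.
    move: uAB; rewrite in_setU negb_or => /andP[/negbTE -> /negbTE ->].
    by rewrite subrr mulr0 mul0r.
  case: (boolP (v \in A :|: B)) => vAB; last first.
    move: vAB; rewrite in_setU negb_or => /andP[/negbTE -> /negbTE ->].
    by rewrite subrr mulr0.
  by rewrite (negbTE (iAB u v uAB vAB)) !mul0r.
have zy : \sum_u (b z u)%:R * y u = k%:R.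
  rewrite -cA -[RHS]mulr1 -sum_ind; apply: eq_bigr => u _; rewrite /y mulr1.
  case: (boolP (u \in A)) => uA; first by rewrite (disjointFr dAB uA) zA // subr0 mul1r.
  case: (boolP (u \in B)) => uB; first by rewrite (negbTE (zB u uB)) mul0r.
  by rewrite subrr mulr0.
have xx : rel_form b x = 2 * tau * k%:R.
  transitivity (\sum_u ((u == z)%:R * (tau * \sum_v (b z v)%:R * y v)
      + (tau * ((b z u)%:R * y u) + tau ^+ 2 * \sum_v (b u v)%:R * y u * y v))).
    apply: eq_bigr => u _; rewrite (bigD1 z) //= [X in _ = _ + (_ + _ * X)](bigD1 z) //= yz mulr0 add0r.
    rewrite /x eqxx yz mulr0 addr0; case: eqP => [->|uz].
      have -> : \sum_v (b z v)%:R * y v = \sum_(v | v != z) (b z v)%:R * y v.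
        by rewrite (bigD1 z) //= yz mulr0 add0r.
      have -> : \sum_(v | v != z) (b z v)%:R * y z * y v = 0.
        by rewrite big1 // => v _; rewrite yz mulr0 mul0r.
      rewrite bi yz /= !(mulr0, mul0r, add0r, addr0, mul1r) mulr_sumr.
      by apply: eq_bigr => v /negbTE ->; rewrite /=; ring.
    rewrite mul0r !add0r bs /= !mulr1n ?mulr0n; congr (_ + _); first by ring.
    by rewrite mulr_sumr; apply: eq_bigr => v /negbTE ->; rewrite /= ?mulr0n; ring.
  rewrite !big_split /= -!mulr_sumr -/(rel_form b y) yy mulr0 addr0 zy.
  rewrite (bigD1 z) //= eqxx big1 ?addr0; last by move=> u /negbTE ->; rewrite mul0r.
  by rewrite mul1r; ring.
have := psd x; rewrite /gram_form sx sx2 xx expr1n mulr1 => h.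
have t0 : tau * (2 * lam) = 1 by rewrite /tau mulVf // gt_eqF // mulr_gt0.
have : 0 <= 2 * lam * (lam * (1 + tau ^+ 2 * (2 * k%:R)) - 2 * tau * k%:R + gam).
  by rewrite mulr_ge0 // mulr_ge0 // ltW.
have -> : 2 * lam * (lam * (1 + tau ^+ 2 * (2 * k%:R)) - 2 * tau * k%:R + gam)
   = 2 * lam * (lam + gam) + (tau * (2 * lam)) * (tau * (2 * lam)) * k%:R - 2 * (tau * (2 * lam)) * k%:R by ring.
rewrite t0; have : lam * gam <= lam * 1 by rewrite ler_pM2l // ltW.
lra.
Qed.

(** Test the indicator of the union of the parts; [hp] makes the coefficient of [s] positive. *)
Lemma multipartite_bound s : multipartite b p.+1 s ->
  s%:R * (p.+1%:R * (1 - gam) - 1) <= lam.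
Proof.
move=> [f [fi fs fc]]; have [->|s0] := posnP s; first by rewrite mul0r ltW.
have dis i j u : u \in f i -> u \in f j -> i = j.
  by move=> ui uj; apply/eqP/negPn/negP => ij; have := fc _ _ _ _ ij ui uj; rewrite bi.
pose x u : R := \sum_i (u \in f i)%:R.
have sx : \sum_u x u = p.+1%:R * s%:R.
  rewrite exchange_big /=; under eq_bigr => i _.
    rewrite (_ : \sum_u (u \in f i)%:R = s%:R); first over.
    by have := sum_ind (f i) 1; rewrite mulr1 fs => <-; apply: eq_bigr => u _; rewrite mulr1.
  by rewrite sumr_const card_ord mulr_natl.
have x01 u : x u = 0 \/ x u = 1.
  case: (boolP [exists i, u \in f i]) => [/existsP[i ui]|/existsPn h]; [right|left].
    rewrite /x (bigD1 i) //= ui big1 ?addr0 // => j ji.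
    by case: (boolP (u \in f j)) => // /(dis _ _ _ ui) E; rewrite E eqxx in ji.
  by rewrite /x big1 // => i _; rewrite (negbTE (h i)).
have sx2 : \sum_u x u ^+ 2 = p.+1%:R * s%:R.
  by rewrite -sx; apply: eq_bigr => u _; case: (x01 u) => ->; rewrite ?expr0n ?expr1n.
have xx : rel_form b x = p.+1%:R * s%:R * (p%:R * s%:R).
  transitivity (\sum_u x u * (p%:R * s%:R)); last by rewrite -mulr_suml sx.
  apply: eq_bigr => u _; case: (boolP [exists i, u \in f i]) => [/existsP[i ui]|/existsPn h]; last first.
    have -> : x u = 0 by rewrite /x big1 // => i _; rewrite (negbTE (h i)).
    by rewrite mul0r big1 // => v _; rewrite mulr0 mul0r.
  have -> : x u = 1.
    rewrite /x (bigD1 i) //= ui big1 ?addr0 // => j ji.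
    by case: (boolP (u \in f j)) => // /(dis _ _ _ ui) E; rewrite E eqxx in ji.
  rewrite mul1r; transitivity (\sum_v (\sum_j (v \in f j)%:R - (v \in f i)%:R : R)).
    apply: eq_bigr => v _; rewrite mulr1.
    case: (boolP [exists j, v \in f j]) => [/existsP[j vj]|/existsPn h]; last first.
      rewrite (negbTE (h i)) subr0 /x [in LHS]big1 ?mulr0; last by move=> j _; rewrite (negbTE (h j)).
      by rewrite big1 // => j _; rewrite (negbTE (h j)).
    have xv : \sum_l (v \in f l)%:R = 1 :> R.
      rewrite (bigD1 j) //= vj big1 ?addr0 // => l lj.
      by case: (boolP (v \in f l)) => // /(dis _ _ _ vj) E; rewrite E eqxx in lj.
    rewrite /x xv mulr1; have [ij|ij] := eqVneq i j.
      by rewrite ij vj subrr (negbTE (fi i u v ui _)) // ij.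
    rewrite (fc i j) //; case: (boolP (v \in f i)) => [/(dis _ _ _ vj) E|]; last by rewrite subr0.
    by rewrite E eqxx in ij.
  rewrite sumrB -/(\sum_u x u) sx.
  have := sum_ind (f i) 1; rewrite mulr1 fs => <-.
  rewrite (eq_bigr (fun u => (u \in f i)%:R)) => [|v _]; last by rewrite mulr1.
  by rewrite -natr1 mulrDl mul1r; ring.
have := psd x; rewrite /gram_form sx sx2 xx.
have s0' : (0 : R) < s%:R by rewrite ltr0n.
have p0' : (0 : R) < p.+1%:R by rewrite ltr0n.
rewrite -natr1 in p0' *; move: (s%:R : R) (p%:R : R) s0' p0' => S P s0' p0' h.
have : 0 <= (P + 1) * S * (lam - S * ((P + 1) * (1 - gam) - 1)) by lra.
by rewrite pmulr_rge0 ?mulr_gt0 // subr_ge0.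
Qed.
End Tests.

Lemma near_multipartite : exists C D : nat, forall (T : finType) (b : rel T),
  symmetric b -> irreflexive b -> (forall x : T -> R, 0 <= gram_form b x) ->
  exists (W : {set T}) (c : T -> 'I_p), (#|~: W| <= C)%N /\
    forall x, x \in W -> (#|[set y in W | (y != x) && (b x y == (c x == c y))]| <= D)%N.
Proof.
pose K := (Num.bound (2 * lam * (lam + 1))).+1.
pose m := (Num.bound ((lam + 1) / (1 - gam))).+1.
pose base := (K * K + 3 * K + 3 + Num.bound (lam / (p.+1%:R * (1 - gam) - 1)))%N.
pose big := (base * (K + 1) ^ p.+1)%N.
have [n0 h0] := ramsey K m; have [n1 h1] := ramsey big m.
have g0 : 0 < 1 - gam by rewrite subr_gt0.
exists (n1 + p * p * n0)%N, ((p + 1) * n0)%N => T b bs bi psd.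
have ncl (A : {set T}) : clique b A -> #|A| = m -> False.
  move=> /(clique_bound bi psd) + E; rewrite E; apply/negP; rewrite -ltNge -ltr_pdivrMr //.
  apply: lt_le_trans (archi_boundP _) _; first by rewrite divr_ge0 ?(addr_ge0 (ltW lam0)) // ltW.
  by rewrite ler_nat.
apply: (@structure T b bs p K n0 base n1 p0).
- move=> z A B cA cB dAB iAB zA zB znB.
  have := split_bound bs bi psd cA cB dAB iAB zA zB znB; apply/negP; rewrite -ltNge.
  apply: lt_le_trans (archi_boundP _) _; last by rewrite ler_nat.
  by rewrite mulr_ge0 ?addr_ge0 ?mulr_ge0 // ltW.
- by [].
- by rewrite /base leq_addr.
- move=> /(multipartite_bound bi psd); apply/negP; rewrite -ltNge -ltr_pdivrMr ?subr_gt0 //.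
  apply: lt_le_trans (archi_boundP _) _; first by apply: divr_ge0; rewrite ?subr_ge0 ltW.
  by rewrite ler_nat /base leq_addl.
- move=> X /(h0 T b X bs bi)[A AX [hA|[hA cA]]]; first by exists A.
  by case: (ncl A hA cA).
move=> q X /(h1 T b X bs bi)[A AX [[hA cA]|[hA cA]]]; last by case: (ncl A hA cA).
have [|B BA hB] := @subset_of_card _ A (base * (K + 1) ^ (p.+1 - q.+1)).
  by rewrite cA /big leq_mul2l leq_pexp2l ?addn1 ?orbT // leq_subr.
exists B; first exact: subset_trans AX.
by split=> // u v uB vB; apply: hA; apply: (subsetP BA).
Qed.

(** What remains is [1] on edges inside a colour and [-1] on missing edges between colours, so [c]
    is a valid colouring by construction. *)
Definition signed_diff (T : finType) (b : rel T) (c : T -> 'I_p) (u v : T) : int :=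
  if u == v then 0 else (b u v : nat)%:Z - (c u != c v : nat)%:Z.

Section Diff.
Variables (T : finType) (b : rel T) (c : T -> 'I_p).
Hypotheses (bs : symmetric b) (bi : irreflexive b)
  (psd : forall x : T -> R, 0 <= gram_form b x).
Local Notation a := (signed_diff b c).

Lemma signed_diff_symmetric : signed_symmetric a.
Proof.
split=> [u v|u|u v]; rewrite /signed_diff.
- by rewrite eq_sym bs (eq_sym (c u)).
- by rewrite eqxx.
by case: eqP => // _; case: (b u v); case: (_ != _).
Qed.

Lemma signed_diff_neq0 u v : (a u v != 0) = (v != u) && (b u v == (c u == c v)).
Proof.
rewrite /signed_diff; case: (eqVneq u v) => //= _.
by case: (b u v); case: (c u == c v).
Qed.

(** Zero sums on the colour classes annihilate both [J] and the complete multipartite matrix. *)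
Lemma diff_form_le x : (forall i, \sum_(u | c u == i) x u = 0) ->
  adj_form a x x <= lam * \sum_u x u ^+ 2.
Proof.
move=> hs.
have part f : \sum_u f u = \sum_i \sum_(u | c u == i) f u :> R.
  by rewrite (partition_big c xpredT).
have s0 : \sum_u x u = 0 by rewrite part big1.
have := psd x; rewrite /gram_form s0 expr0n mulr0 addr0 subr_ge0; apply: le_trans.
rewrite le_eqVlt; apply/orP; left; apply/eqP.
apply: eq_bigr => u _.
transitivity (\sum_v ((b u v)%:R * x u * x v - x u * x v + x u * ((c v == c u)%:R * x v))).
  apply: eq_bigr => v _; rewrite /signed_diff; have [->|uv] := eqVneq u v.
    by rewrite bi eqxx /= !mul0r mul1r; ring.
  by rewrite (eq_sym (c v)) rmorphB /=; case: (b u v); case: (c u == c v) => /=; ring.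
rewrite big_split sumrB /= -!mulr_sumr s0 mulr0 subr0.
have -> : \sum_v (c v == c u)%:R * x v = 0.
  rewrite -[RHS](hs (c u)) [RHS]big_mkcond; apply: eq_bigr => v _.
  by case: eqP; rewrite ?mul1r ?mul0r.
by rewrite mulr0 addr0.
Qed.

Definition separated j (M : nat) (W : {set T}) : Prop :=
  exists (xs : 'I_j -> T -> R) (Ss : 'I_j -> {set T}),
  [/\ forall i, Ss i \subset W /\ (#|Ss i| <= M)%N,
      forall i u, u \notin Ss i -> xs i u = 0,
      forall i, lam * (\sum_u xs i u ^+ 2) < adj_form a (xs i) (xs i) &
      forall i k u v, i != k -> u \in Ss i -> v \in Ss k -> u != v /\ a u v = 0].

(** Among more than [p] test vectors some nonzero combination has zero sum on all [p] colours. The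
    obstructions do not interact, so the combination still exceeds [lam], against [diff_form_le]. *)
Lemma separated_le j M W : separated j M W -> (j <= p)%N.
Proof.
move=> [xs [Ss [h1 h2 h3 h4]]]; rewrite leqNgt; apply/negP => jp.
pose B := \matrix_(i < j, k < p) \sum_(u | c u == k) xs i u.
have : kermx B != 0.
  rewrite -mxrank_eq0 mxrank_ker subn_eq0 -ltnNge; exact: leq_ltn_trans (rank_leq_col B) jp.
move=> /rowV0Pn[t /sub_kermxP tB t0].
pose x u := \sum_i t 0 i * xs i u.
have hs k : \sum_(u | c u == k) x u = 0.
  have := congr1 (fun z : 'rV_p => z 0 k) tB; rewrite !mxE => E.
  transitivity (\sum_i t 0 i * B i k); last exact: E.
  by rewrite /x exchange_big; apply: eq_bigr => i _; rewrite mxE mulr_sumr.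
have cross i k : i != k -> adj_form a (xs i) (xs k) = 0.
  move=> ik; rewrite /adj_form big1 // => u _; rewrite big1 // => v _.
  case: (boolP (u \in Ss i)) => ui; last by rewrite h2 // mulr0 mul0r.
  case: (boolP (v \in Ss k)) => vk; last by rewrite (h2 k) // mulr0.
  by have [_ ->] := h4 i k u v ik ui vk; rewrite !mul0r.
have dis i k u : i != k -> xs i u * xs k u = 0.
  move=> ik; case: (boolP (u \in Ss i)) => ui; last by rewrite h2 // mul0r.
  case: (boolP (u \in Ss k)) => uk; last by rewrite (h2 k) // mulr0.
  by have [/eqP] := h4 i k u u ik ui uk.
have e1 : adj_form a x x = \sum_i t 0 i ^+ 2 * adj_form a (xs i) (xs i).
  transitivity (\sum_i \sum_k t 0 i * t 0 k * adj_form a (xs i) (xs k)); last first.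
    apply: eq_bigr => i _; rewrite (bigD1 i) //= big1 ?addr0 // => k ki.
    by rewrite cross ?mulr0 // eq_sym.
  under [RHS]eq_bigr => i _ do under eq_bigr => k _ do rewrite mulr_sumr.
  under [RHS]eq_bigr => i _ do rewrite exchange_big.
  rewrite [RHS]exchange_big; apply: eq_bigr => u _ /=.
  under [RHS]eq_bigr => i _ do under eq_bigr => k _ do rewrite mulr_sumr.
  under [RHS]eq_bigr => i _ do rewrite exchange_big.
  rewrite [RHS]exchange_big; apply: eq_bigr => v _ /=.
  rewrite /x -mulrA big_distrlr mulr_sumr; apply: eq_bigr => i _ /=.
  by rewrite mulr_sumr; apply: eq_bigr => k _; ring.
have e2 : \sum_u x u ^+ 2 = \sum_i t 0 i ^+ 2 * \sum_u xs i u ^+ 2.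
  under [RHS]eq_bigr => i _ do rewrite mulr_sumr.
  rewrite [RHS]exchange_big; apply: eq_bigr => u _ /=.
  rewrite expr2 big_distrlr; apply: eq_bigr => i _ /=.
  rewrite (bigD1 i) //= big1 ?addr0 => [|k ki]; first by ring.
  have -> : t 0 i * xs i u * (t 0 k * xs k u) = t 0 i * t 0 k * (xs i u * xs k u) by ring.
  by rewrite dis ?mulr0 // eq_sym.
have [i0 ti0] : exists i, t 0 i != 0.
  apply: contrapT => H; move/eqP: t0; apply; apply/rowP => i; rewrite mxE.
  by apply/eqP/negPn/negP => h; apply: H; exists i.
have := diff_form_le hs; apply/negP; rewrite -ltNge e1 e2 mulr_sumr.
rewrite (bigD1 i0) //= [X in _ < X](bigD1 i0) //=; apply: ltr_leD.
  by rewrite mulrCA ltr_pM2l ?h3 // lt0r sqr_ge0 sqrf_eq0 ti0.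
by apply: ler_sum => i _; rewrite mulrCA ler_wpM2l ?sqr_ge0 // ltW.
Qed.

(** Delete a maximal separated family together with its neighbours: any obstruction left would
    enlarge the family. *)
Lemma remove_obstructions D M (W : {set T}) : deg_le a W D ->
  (forall S : {set T}, S \subset W -> ~ spec_le a lam S ->
     exists S' : {set T}, [/\ S' \subset S, (#|S'| <= M)%N & ~ spec_le a lam S']) ->
  exists W' : {set T}, [/\ W' \subset W, (#|W :\: W'| <= p * (M * (D + 1)))%N & spec_le a lam W'].
Proof.
move=> hdeg hobs; have [as_ a0 a1] := signed_diff_symmetric.
have [j hj [[xs [Ss [h1 h2 h3 h4]]] hmax]] : exists2 j, (j <= p)%N & separated j M W /\ ~ separated j.+1 M W.
  apply: contrapT => H.
  have all j : (j <= p.+1)%N -> separated j M W.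
    elim: j => [_|j IH jp]; first by exists (fun _ _ => 0), (fun _ => set0); split; case.
    by apply: contrapT => h; apply: H; exists j => //; split=> //; apply: IH; apply: ltnW.
  by have := separated_le (all p.+1 (leqnn _)); rewrite ltnn.
pose nb u := u |: [set v in W | a u v != 0].
pose U := \bigcup_(i in [set: 'I_j]) \bigcup_(u in Ss i) nb u.
exists (W :\: U); split; first exact: subsetDl.
  have : W :\: (W :\: U) \subset U by rewrite setDDr setDv set0U subsetIr.
  move/subset_leq_card => h; apply: leq_trans h _.
  apply: leq_trans (leq_card_bigcup _ _) _; apply: (@leq_trans (j * (M * (D + 1)))).
    rewrite -[X in (_ <= X * _)%N](card_ord j) -cardsT -sum_nat_const; apply: leq_sum => i _.
    apply: leq_trans (leq_card_bigcup _ _) _; apply: (@leq_trans (#|Ss i| * (D + 1))).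
      rewrite -sum_nat_const; apply: leq_sum => u ui; rewrite /nb addnC.
      apply: leq_trans (leq_card_setU _ _).1 _; rewrite cards1 leq_add2l hdeg //.
      exact: (subsetP (h1 i).1).
    by rewrite leq_mul2r; have [_ ->] := h1 i; rewrite orbT.
  by rewrite leq_mul2r hj orbT.
apply: contrapT => nsp; apply: hmax.
have [S' [S'W cS' nS']] := hobs _ (subsetDl _ _) nsp.
move/existsNP: nS' => [y /not_implyP[hy /negP]]; rewrite -ltNge => hlt.
exists (fun i => if unlift ord_max i is Some k then xs k else y),
       (fun i => if unlift ord_max i is Some k then Ss k else S'); split.
- move=> i; case: unliftP => [k _|_]; first exact: h1.
  by split=> //; apply: subset_trans S'W (subsetDl _ _).
- by move=> i u; case: unliftP => [k _|_]; [exact: h2|exact: hy].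
- by move=> i; case: unliftP => [k _|_].
have new i u v : u \in Ss i -> v \in S' -> u != v /\ a u v = 0.
  move=> ui /(subsetP S'W); rewrite in_setD => /andP[vU vW].
  have : v \notin nb u.
    apply: contra vU => vn; apply/bigcupP; exists i => //.
    by apply/bigcupP; exists u.
  by rewrite !inE vW negb_or /= negbK eq_sym => /andP[-> /eqP].
move=> i k u v; case: unliftP => [i' ->|->]; case: unliftP => [k' ->|->].
- by rewrite (inj_eq (@lift_inj _ _)); exact: h4.
- by move=> _; exact: new.
- by move=> _ uS vS; have [h5 h6] := new k' v u vS uS; rewrite eq_sym as_.
- by rewrite eqxx.
Qed.

End Diff.
End GramStructure.

(** * Signed graphs on ordinals *)

Section Interface.
Variable R : realType.

Lemma subE (V : zmodType) m n (A B : 'M[V]_(m, n)) i j : (A - B) i j = A i j - B i j.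
Proof. by rewrite !mxE. Qed.

Lemma quad_mx n (A : 'M[R]_n) (z : 'rV[R]_n) :
  (z *m A *m z^T) 0 0 = \sum_i \sum_j A i j * z 0 i * z 0 j.
Proof.
rewrite mxE exchange_big; apply: eq_bigr => j _ /=; rewrite !mxE mulr_suml.
by apply: eq_bigr => i _; ring.
Qed.

Lemma quad_id n (z : 'rV[R]_n) : (z *m z^T) 0 0 = \sum_i z 0 i ^+ 2.
Proof. by rewrite mxE; apply: eq_bigr => i _; rewrite mxE expr2. Qed.

Lemma quad_id_gt0 n (z : 'rV[R]_n) : z != 0 -> 0 < (z *m z^T) 0 0.
Proof.
move=> z0; rewrite lt_def quad_id sumr_ge0 ?andbT => [|i _]; last exact: sqr_ge0.
apply: contra z0; rewrite psumr_eq0 => [/allP h'|i _]; last exact: sqr_ge0.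
by apply/eqP/rowP => i; rewrite mxE; apply/eqP; rewrite -sqrf_eq0; apply: h'; exact: mem_index_enum.
Qed.

Definition int_adj n (G : signed_graph n) (u v : 'I_n) : int :=
  if pos_edge G u v then 1 else if neg_edge G u v then -1 else 0.

Lemma int_adj_signed n (G : signed_graph n) : signed_symmetric (int_adj G).
Proof.
split=> [u v|u|u v]; rewrite /int_adj.
- by rewrite pos_edge_sym neg_edge_sym.
- by rewrite pos_edge_irr neg_edge_irr.
by case: pos_edge => //; case: neg_edge.
Qed.

Lemma signed_adjE n (G : signed_graph n) i j : signed_adj R G i j = (int_adj G i j)%:~R.
Proof.
rewrite mxE /int_adj; case: pos_edge => //; case: neg_edge => //=; by rewrite rmorphN1.
Qed.

Lemma adj_form_mx n (G : signed_graph n) (z : 'rV[R]_n) :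
  (z *m signed_adj R G *m z^T) 0 0 = adj_form (int_adj G) (z 0) (z 0).
Proof.
rewrite quad_mx; apply: eq_bigr => i _; apply: eq_bigr => j _; by rewrite signed_adjE.
Qed.

Lemma largest_spec_le n (G : signed_graph n) (l : R) :
  spec_le (int_adj G) l [set: 'I_n] -> (0 < mult l G)%N -> is_largest_eigenvalue G l.
Proof.
move=> hsp; rewrite /mult lt0n mxrank_eq0 => h0; split=> // mu /eigenvalueP[z hz z0].
have := hsp (z 0); rewrite -adj_form_mx -quad_id hz -scalemxAl mxE => h.
have {}h : mu * (z *m z^T) 0 0 <= l * (z *m z^T) 0 0 by apply: h => u; rewrite inE.
by rewrite -(ler_pM2r (quad_id_gt0 z0)).
Qed.

Section GraphOf.
Variables (n : nat) (a : 'I_n -> 'I_n -> int).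
Hypothesis ha : signed_symmetric a.

Lemma value_symmetric (z : int) : symmetric (fun u v => a u v == z).
Proof. by case: ha => as_ _ _ u v; rewrite as_. Qed.

Lemma value_irreflexive (z : int) : z != 0 -> irreflexive (fun u v => a u v == z).
Proof. by case: ha => _ a0 _ z0 u; rewrite a0 eq_sym (negbTE z0). Qed.

Lemma value_exclusive u v : ~~ ((a u v == 1) && (a u v == -1)).
Proof. by case: eqP => // ->. Qed.

Definition graph_of : signed_graph n :=
  SignedGraph (value_symmetric 1) (value_symmetric (-1))
    (value_irreflexive (z := 1) isT) (value_irreflexive (z := -1) isT) value_exclusive.
End GraphOf.

Lemma graph_ofE n (a : 'I_n -> 'I_n -> int) (ha : signed_symmetric a) u v :
  int_adj (graph_of ha) u v = a u v.
Proof.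
have [_ _ /(_ u v)] := ha; rewrite /int_adj /=; case: eqP => [->//|h1].
by case: eqP => [->//|h2]; lia.
Qed.

Definition induced n (T : finType) (a : T -> T -> int) (f : 'I_n -> T) (u v : 'I_n) := a (f u) (f v).

Lemma induced_signed n (T : finType) (a : T -> T -> int) (f : 'I_n -> T) :
  signed_symmetric a -> signed_symmetric (induced a f).
Proof. by move=> [as_ a0 a1]; split=> *; rewrite /induced; [exact: as_|exact: a0|exact: a1]. Qed.

Section Enumerate.
Variables (T : finType) (W : {set T}) (a : T -> T -> int).
Hypothesis ha : signed_symmetric a.
Let f : 'I_#|W| -> T := fun i => enum_val i.
Let G := graph_of (induced_signed f ha).

Lemma extend_sum (F : T -> R) :
  (forall u, u \notin W -> F u = 0) -> \sum_u F u = \sum_i F (f i).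
Proof.
move=> h; transitivity (\sum_(u in W) F u); last by rewrite big_enum_val.
by rewrite [RHS]big_mkcond; apply: eq_bigr => u _; case: ifP => // /negbT /h.
Qed.

Lemma induced_spec_le (l : R) : spec_le a l W -> spec_le (int_adj G) l [set: 'I_#|W|].
Proof.
move=> hsp x _.
pose x' u : R := \sum_(i | f i == u) x i.
have fx i : x' (f i) = x i.
  by rewrite /x' (eq_bigl (pred1 i)) ?big_pred1_eq // => j; rewrite (inj_eq enum_val_inj).
have x0 u : u \notin W -> x' u = 0.
  move=> uW; rewrite /x' big1 // => i /eqP E; move: uW; rewrite -E; by rewrite enum_valP.
have := hsp x' x0.
rewrite (extend_sum) => [|u /x0 ->]; last by rewrite expr0n.
rewrite /adj_form (extend_sum) => [|u /x0 h]; last by rewrite big1 // => v _; rewrite h mulr0 mul0r.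
rewrite (eq_bigr (fun i => \sum_j (int_adj G i j)%:~R * x i * x j)).
  by rewrite [X in _ <= l * X -> _](eq_bigr (fun i => x i ^+ 2)) // => i _; rewrite fx.
move=> i _; rewrite (extend_sum) => [|u /x0 ->]; last by rewrite mulr0.
by apply: eq_bigr => j _; rewrite !fx graph_ofE.
Qed.
End Enumerate.

End Interface.

(** * The upper bound *)

Section Upper.
Variable R : realType.
Variables (alpha beta : R) (p : nat) (t : R).
Local Notation lam := ((1 - alpha) / (alpha - beta)).
Local Notation gam := (alpha / (alpha - beta)).
Hypotheses (halpha0 : 0 <= alpha) (halpha1 : alpha < 1) (hbeta0 : beta < 0).
Hypotheses (p0 : (0 < p)%N) (hp : 1 < p.+1%:R * (1 - gam)).
Hypotheses (t1 : 1 < t) (t6 : t ^+ 6 <= t ^+ 2 + 1) (lt : lam < t + t^-1).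

Lemma gap_gt0 : 0 < alpha - beta.
Proof. by rewrite subr_gt0 (lt_le_trans hbeta0). Qed.
Let gap_neq0 : alpha - beta != 0. Proof. by rewrite gt_eqF ?gap_gt0. Qed.
Lemma lam_gt0 : 0 < lam. Proof. by rewrite divr_gt0 ?gap_gt0 // subr_gt0. Qed.
Lemma gam_lt1 : gam < 1. Proof. by rewrite ltr_pdivrMr ?gap_gt0 // mul1r ltrDl oppr_gt0. Qed.

Section Code.
Variables (d N : nat) (v : 'I_N -> 'rV[R]_d).
Hypothesis hv : two_distance_code alpha beta v.

Definition beta_rel (i j : 'I_N) : bool := (i != j) && (dot (v i) (v j) == beta).

Lemma dotC (x y : 'rV[R]_d) : dot x y = dot y x.
Proof. by apply: eq_bigr => i _; rewrite mulrC. Qed.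

Lemma beta_rel_sym : symmetric beta_rel.
Proof. by move=> i j; rewrite /beta_rel eq_sym dotC. Qed.

Lemma beta_rel_irr : irreflexive beta_rel.
Proof. by move=> i; rewrite /beta_rel eqxx. Qed.

Lemma code_dot i j :
  dot (v i) (v j) = (alpha - beta) * (lam * (i == j)%:R - (beta_rel i j)%:R + gam).
Proof.
have [h1 h2] := hv; rewrite /beta_rel; have [->|ij] := eqVneq i j => /=.
  by rewrite h1; field.
have ab : alpha == beta = false by apply/negbTE; rewrite -subr_eq0.
by case: (h2 i j ij) => ->; rewrite ?eqxx ?ab /=; field.
Qed.

Lemma code_psd (x : 'I_N -> R) : 0 <= gram_form lam gam beta_rel x.
Proof.
rewrite -(pmulr_rge0 _ gap_gt0).
suff -> : (alpha - beta) * gram_form lam gam beta_rel x = \sum_k (\sum_i x i * v i 0 k) ^+ 2.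
  by apply: sumr_ge0 => k _; exact: sqr_ge0.
transitivity (\sum_i \sum_j x i * x j * dot (v i) (v j)); last first.
  under [RHS]eq_bigr => k _ do rewrite expr2 big_distrlr /=.
  rewrite [RHS]exchange_big; apply: eq_bigr => i _; rewrite [RHS]exchange_big; apply: eq_bigr => j _ /=.
  by rewrite mulr_sumr; apply: eq_bigr => k _; ring.
rewrite /gram_form /rel_form expr2 [X in gam * X]big_distrlr /= !mulr_sumr -sumrB -big_split mulr_sumr.
apply: eq_bigr => i _ /=; rewrite mulr_sumr.
have -> : lam * x i ^+ 2 = \sum_j lam * (i == j)%:R * (x i * x j).
  rewrite (bigD1 i) //= eqxx mulr1 expr2 big1 ?addr0 // => j ji.
  by rewrite eq_sym (negbTE ji) mulr0 mul0r.
rewrite -sumrB -big_split mulr_sumr; apply: eq_bigr => j _ /=.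
by rewrite code_dot; ring.
Qed.
End Code.

(** A vector orthogonal to the coordinates of the code and to the colour indicators is a
    [lam]-eigenvector of the signed graph; these are [d + p] linear conditions. The last clause is
    conditional since [lam] need not be an eigenvalue. *)
Theorem code_signed_graph : exists C : nat, forall d N (v : 'I_N -> 'rV[R]_d),
  two_distance_code alpha beta v -> exists n (G : signed_graph n),
  [/\ (N <= n + C)%N, colorable G p, (n <= mult lam G + (d + p))%N &
      (0 < mult lam G)%N -> is_largest_eigenvalue G lam].
Proof.
have [C1 [D hnear]] := near_multipartite lam_gt0 gam_lt1 p0 hp.
have [M hobs] := small_obstruction D t1 t6 lt.
exists (C1 + p * (M * (D + 1)))%N => d N v hv.
have bs := beta_rel_sym v; have bi := beta_rel_irr v; have psd := code_psd hv.
have [W [c [hW hdeg]]] := hnear _ _ bs bi psd.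
pose a := signed_diff (beta_rel v) c.
have ha : signed_symmetric a by exact: signed_diff_symmetric.
have hdeg' : deg_le a W D.
  move=> u uW; apply: leq_trans (hdeg u uW); apply: subset_leq_card; apply/subsetP => w.
  by rewrite !inE signed_diff_neq0.
have [|W' [W'W cW' hsp]] := remove_obstructions bs bi psd (M := M) hdeg'.
  move=> S SW nS; apply: hobs => // u uS.
  apply: leq_trans (hdeg' u (subsetP SW _ uS)); apply: subset_leq_card.
  by apply/subsetP => w; rewrite !inE => /andP[/(subsetP SW) -> ->].
pose f : 'I_#|W'| -> 'I_N := fun i => enum_val i.
pose G := graph_of (induced_signed f ha).
have GE i j : int_adj G i j = a (f i) (f j) by exact: graph_ofE.
exists #|W'|, G; split.
- have h1 := cardsC W; rewrite card_ord in h1.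
  have h2 := cardsID W' W; rewrite (setIidPr W'W) in h2.
  by move: hW cW'; rewrite -/(setD W W'); lia.
- apply/existsP; exists [ffun i => c (f i)]; apply/forallP => i; apply/forallP => j.
  rewrite !ffunE /= /induced /a /signed_diff.
  by case: (f i == f j) => //=; case: (beta_rel v (f i) (f j)); case: (c (f i) == c (f j)).
- pose V := \matrix_(i < #|W'|, k < d) v (f i) 0 k.
  pose Cl := \matrix_(i < #|W'|, k < p) (c (f i) == k)%:R : 'M[R]_(#|W'|, p).
  have hker : (kermx (row_mx V Cl) <= eigenspace (signed_adj R G) lam)%MS.
    apply/row_subP => i0; set z := row i0 _; apply/eigenspaceP.
    have : z *m row_mx V Cl = 0 by rewrite /z -row_mul mulmx_ker row0.
    rewrite mul_mx_row => /eqP; rewrite row_mx_eq0 => /andP[/eqP zV /eqP zC].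
    have zc k : \sum_j z 0 j * (c (f j) == k)%:R = 0.
      have := congr1 (fun y : 'rV_p => y 0 k) zC; rewrite !mxE => E; rewrite -[RHS]E.
      by apply: eq_bigr => j _; rewrite [Cl _ _]mxE.
    have zs : \sum_j z 0 j = 0.
      transitivity (\sum_k \sum_j z 0 j * (c (f j) == k)%:R); last by rewrite big1.
      rewrite exchange_big; apply: eq_bigr => j _ /=.
      rewrite (bigD1 (c (f j))) //= eqxx mulr1 big1 ?addr0 // => k.
      by rewrite eq_sym => /negbTE ->; rewrite mulr0.
    have zv l : \sum_j z 0 j * dot (v (f j)) (v (f l)) = 0.
      transitivity (\sum_k (z *m V) 0 k * v (f l) 0 k); last first.
        by rewrite zV big1 // => k _; rewrite mxE mul0r.
      under [RHS]eq_bigr => k _ do rewrite mxE mulr_suml.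
      rewrite [RHS]exchange_big; apply: eq_bigr => j _ /=.
      by rewrite mulr_sumr; apply: eq_bigr => k _; rewrite [V _ _]mxE mulrA.
    apply/rowP => l; rewrite [LHS]mxE [RHS]mxE.
    have := zv l => E.
    have {E} : \sum_j z 0 j * (lam * (f j == f l)%:R - (beta_rel v (f j) (f l))%:R + gam) = 0.
      apply: (mulfI gap_neq0); rewrite mulr0 -[RHS]E mulr_sumr; apply: eq_bigr => j _.
      by rewrite (code_dot hv) [LHS]mulrCA.
    have -> : \sum_j z 0 j * (lam * (f j == f l)%:R - (beta_rel v (f j) (f l))%:R + gam)
       = lam * z 0 l - \sum_j z 0 j * signed_adj R G j l - \sum_j z 0 j * (c (f j) != c (f l))%:R
           + gam * \sum_j z 0 j.
      have -> : lam * z 0 l = \sum_j z 0 j * (lam * (f j == f l)%:R).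
        rewrite (bigD1 l) //= eqxx mulr1 big1 ?addr0 => [|j jl]; first by rewrite mulrC.
        by rewrite (inj_eq enum_val_inj) (negbTE jl) !mulr0.
      rewrite mulr_sumr -!sumrB -big_split; apply: eq_bigr => j _ /=.
      rewrite signed_adjE GE /a /signed_diff; have [->|_] := eqVneq (f j) (f l).
        by rewrite bi eqxx /=; ring.
      rewrite rmorphB /=; case: (beta_rel _ _ _); case: (_ != _) => /=; ring.
    have -> : \sum_j z 0 j * (c (f j) != c (f l))%:R = 0.
      transitivity (\sum_j z 0 j - \sum_j z 0 j * (c (f j) == c (f l))%:R); last by rewrite zs zc subrr.
      rewrite -sumrB; apply: eq_bigr => j _; case: eqP => _ /=; ring.
    by rewrite zs mulr0 subr0 addr0 => /eqP; rewrite subr_eq0 => /eqP ->.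
  have := mxrankS hker; rewrite mxrank_ker -/(mult lam G).
  have := rank_leq_col (row_mx V Cl); lia.
- apply: largest_spec_le; exact: induced_spec_le.
Qed.
End Upper.

(** * Largest eigenvalues and positive semidefinite matrices *)

Section Factor.
Variable R : realType.

Definition psd n (X : 'M[R]_n) : Prop := forall z : 'rV[R]_n, 0 <= (z *m X *m z^T) 0 0.

Lemma delta_quad n (X : 'M[R]_n) i (z : 'rV[R]_n) (c : R) : X^T = X ->
  ((z - c *: delta_mx 0 i) *m X *m (z - c *: delta_mx 0 i)^T) 0 0
   = (z *m X *m z^T) 0 0 - 2 * c * (z *m X) 0 i + c ^+ 2 * X i i.
Proof.
move=> hX; set w := c *: _.
have e1 (y : 'rV[R]_n) : (y *m w^T) 0 0 = c * y 0 i.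
  by rewrite /w linearZ /= -scalemxAr trmx_delta -colE !mxE.
have e2 : (w *m X *m z^T) 0 0 = c * (z *m X) 0 i.
  rewrite -e1; have -> : z *m X *m w^T = (w *m X *m z^T)^T.
    by rewrite !trmx_mul trmxK hX mulmxA.
  by rewrite [in RHS]mxE.
have e3 : (w *m X) 0 i = c * X i i by rewrite /w -scalemxAl -rowE !mxE.
have -> : (z - w) *m X *m (z - w)^T
   = z *m X *m z^T - z *m X *m w^T - (w *m X *m z^T - w *m X *m w^T).
  by rewrite linearB /= !mulmxBl !mulmxBr.
rewrite !subE !e1 e2 e3; ring.
Qed.

Lemma delta_row n (X : 'M[R]_n) i j (c : R) : ((c *: delta_mx 0 i : 'rV_n) *m X) 0 j = c * X i j.
Proof. by rewrite -scalemxAl -rowE !mxE. Qed.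

Lemma delta_self n (X : 'M[R]_n) i (c : R) : X^T = X ->
  ((c *: delta_mx 0 i : 'rV_n) *m X *m (c *: delta_mx 0 i : 'rV_n)^T) 0 0 = c ^+ 2 * X i i.
Proof.
move=> hX; have := delta_quad i (c *: delta_mx 0 i) c hX.
by rewrite subrr !mul0mx mxE delta_row; lra.
Qed.

(** Cholesky elimination with pivoting: removing the rank one matrix of a positive diagonal entry
    preserves semidefiniteness and lowers the rank, so the number of columns needed is the rank. *)
Lemma psd_factor n k (X : 'M[R]_n) : X^T = X -> psd X -> (\rank X <= k)%N ->
  exists B : 'M[R]_(n, k), X = B *m B^T.
Proof.
elim: k X => [|k IH] X hX pX rX.
  exists 0; rewrite mul0mx; apply/eqP; by rewrite -mxrank_eq0 -leqn0.
have dg (i : 'I_n) (z : 'rV[R]_n) c := delta_quad i z c hX.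
have Xii i : 0 <= X i i.
  by have := pX (1 *: delta_mx 0 i); rewrite delta_self // expr1n mul1r.
have [X0|X0] := eqVneq X 0; first by exists 0; rewrite mul0mx X0.
(* A semidefinite matrix with zero diagonal is zero: a nonzero entry would give a negative value. *)
have [i hi] : exists i, X i i != 0.
  apply: contrapT => H; move/eqP: X0; apply.
  have d0 i : X i i = 0 by apply/eqP/negPn/negP => h; apply: H; exists i.
  apply/matrixP => i j; rewrite mxE.
  have := pX (X i j *: delta_mx 0 i - 1 *: delta_mx 0 j).
  rewrite dg delta_self // delta_row !d0 => h; apply/eqP.
  by rewrite -sqrf_eq0 eq_le sqr_ge0 andbT expr2; lra.
have Xi : 0 < X i i by rewrite lt_def hi Xii.
pose u : 'rV[R]_n := (Num.sqrt (X i i))^-1 *: row i X.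
have uu : u^T *m u = (X i i)^-1 *: ((row i X)^T *m row i X).
  have s2 : (Num.sqrt (X i i))^-1 * (Num.sqrt (X i i))^-1 = (X i i)^-1.
    by rewrite -invfM -expr2 sqr_sqrtr // ltW.
  by apply/matrixP => x y; rewrite /u !(mxE, big_ord1) -s2; ring.
pose X' := X - u^T *m u.
have zu (z : 'rV[R]_n) : (z *m (u^T *m u) *m z^T) 0 0 = (X i i)^-1 * ((z *m X) 0 i) ^+ 2.
  rewrite uu -scalemxAr -scalemxAl mxE; congr (_ * _).
  have -> : z *m ((row i X)^T *m row i X) *m z^T = (z *m (row i X)^T) *m (z *m (row i X)^T)^T.
    by rewrite trmx_mul trmxK !mulmxA.
  have e : (z *m (row i X)^T) 0 0 = (z *m X) 0 i.
    by rewrite !mxE; apply: eq_bigr => j _; rewrite !mxE -{1}hX mxE.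
  by rewrite mxE big_ord1 [_^T _ _]mxE e expr2.
have pX' : psd X'.
  move=> z; rewrite /X' mulmxBr mulmxBl.
  rewrite subE zu.
  have := pX (z - ((z *m X) 0 i / X i i) *: delta_mx 0 i); rewrite dg.
  set q := (z *m X) 0 i; move: (X i i) Xi hi => x x0 hx.
  suff -> : (z *m X *m z^T) 0 0 - 2 * (q / x) * q + (q / x) ^+ 2 * x = (z *m X *m z^T) 0 0 - x^-1 * q ^+ 2 by [].
  by field.
have hX' : X'^T = X' by rewrite /X' linearB /= hX trmx_mul trmxK.
have [|B hB] := IH X' hX' pX'.
  rewrite -ltnS; apply: leq_trans rX.
  (* The kernel of [X'] contains that of [X] and, in addition, the pivot vector. *)
  have k1 : (kermx X <= kermx X')%MS.
    apply/rV_subP => z /sub_kermxP zX; apply/sub_kermxP.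
    rewrite /X' mulmxBr zX sub0r uu -scalemxAr mulmxA.
    suff -> : z *m (row i X)^T = 0 by rewrite mul0mx scaler0 oppr0.
    by rewrite tr_row hX colE mulmxA zX mul0mx.
  have k2 : ~~ (kermx X' <= kermx X)%MS.
    apply/negP => h; have : (delta_mx 0 i : 'rV[R]_n) *m X' = 0.
      rewrite /X' mulmxBr -rowE uu -scalemxAr mulmxA -rowE.
      have -> : row i (row i X)^T = (X i i)%:M by apply/matrixP => x y; rewrite !mxE !ord1 eqxx.
      by rewrite mul_scalar_mx scalerA mulVf // scale1r subrr.
    move=> /sub_kermxP h'; have /sub_kermxP := submx_trans h' h; rewrite -rowE => E.
    by move/eqP: hi; apply; have := congr1 (fun y : 'rV_n => y 0 i) E; rewrite !mxE.
  have /rank_ltmx : (kermx X < kermx X')%MS by rewrite /ltmx k1 k2.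
  rewrite !mxrank_ker; have := rank_leq_row X; have := rank_leq_row X'; lia.
have E : X = row_mx u^T B *m (row_mx u^T B)^T.
  by rewrite tr_row_mx mul_row_col trmxK -hB /X' addrC subrK.
by exists (row_mx u^T B).
Qed.

Lemma signed_adj_sym n (G : signed_graph n) : (signed_adj R G)^T = signed_adj R G.
Proof. by apply/matrixP => i j; rewrite !mxE pos_edge_sym neg_edge_sym. Qed.

Lemma quad_spec n (G : signed_graph n) (l : R) (z : 'rV[R]_n) : (z *m (l%:M - signed_adj R G) *m z^T) 0 0
    = l * (\sum_i z 0 i ^+ 2) - adj_form (int_adj G) (z 0) (z 0).
Proof.
by rewrite mulmxBr mulmxBl subE adj_form_mx mul_mx_scalar -scalemxAl -quad_id mxE.
Qed.

Lemma psd_spec n (G : signed_graph n) (l : R) :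
  spec_le (int_adj G) l [set: 'I_n] <-> psd (l%:M - signed_adj R G).
Proof.
have e := quad_spec G l.
split=> [h z|h x _].
  by rewrite e subr_ge0; apply: h => u; rewrite inE.
have := h (\row_i x i); rewrite e subr_ge0 => h'.
have <- : adj_form (int_adj G) ((\row_i x i) 0) ((\row_i x i) 0) = adj_form (int_adj G) x x.
  by apply: eq_bigr => i _; apply: eq_bigr => j _; rewrite !mxE.
have <- : \sum_i (\row_i x i) 0 i ^+ 2 = \sum_i x i ^+ 2 by apply: eq_bigr => i _; rewrite mxE.
exact: h'.
Qed.

(* The infimum [m] of the upper bounds of the Rayleigh quotient is an
   eigenvalue: if [m I - A = B B^T] were invertible, it would dominate a
   positive multiple of the identity. *)
Lemma largest_eigenvalue_spec_le n (G : signed_graph n) (l : R) :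
  is_largest_eigenvalue G l -> spec_le (int_adj G) l [set: 'I_n].
Proof.
move=> [_ hl]; pose A := signed_adj R G.
pose E : classical_sets.set R := fun m => spec_le (int_adj G) m [set: 'I_n].
have [n0|n0] := posnP n.
  move=> x _; rewrite /adj_form !big1 ?mulr0 // => i; move: (ltn_ord i); by rewrite {2}n0.
have mono m m' : m <= m' -> E m -> E m'.
  move=> mm h x hx; apply: le_trans (h x hx) _; apply: ler_wpM2r => //.
  by apply: sumr_ge0 => i _; exact: sqr_ge0.
have E0 : E n%:R.
  move=> x _; have [_ _ a1] := int_adj_signed G.
  apply: (@le_trans _ _ (\sum_i \sum_j (x i ^+ 2 + x j ^+ 2) / 2)).
    apply: ler_sum => i _; apply: ler_sum => j _.
    have [->|[->|->]] : int_adj G i j = 0 \/ int_adj G i j = 1 \/ int_adj G i j = -1.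
        by have := a1 i j; lia.
      by rewrite !mul0r divr_ge0 // addr_ge0 // sqr_ge0.
      by rewrite mul1r; have := sqr_ge0 (x i - x j); lra.
    by rewrite rmorphN1; have := sqr_ge0 (x i + x j); lra.
  under eq_bigr => i _ do rewrite -mulr_suml big_split /= sumr_const card_ord.
  rewrite -mulr_suml big_split /= sumrMnl sumr_const card_ord mulr_natl; lra.
have Elb m : E m -> 0 <= m.
  move=> h; have := h (fun i => (i == Ordinal n0)%:R) ltac:(by move=> u; rewrite inE).
  have [_ a0 _] := int_adj_signed G.
  have -> : \sum_u ((u == Ordinal n0)%:R : R) ^+ 2 = 1.
    rewrite (bigD1 (Ordinal n0)) // eqxx expr1n big1 /= ?addr0 // => i /negbTE ->; by rewrite expr0n.
  have -> : adj_form (int_adj G) (fun i => (i == Ordinal n0)%:R) (fun i => (i == Ordinal n0)%:R) = 0 :> R.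
    rewrite /adj_form big1 // => i _; rewrite big1 // => j _.
    case: (eqVneq i (Ordinal n0)) => [->|_]; last by rewrite mulr0 mul0r.
    case: (eqVneq j (Ordinal n0)) => [->|_]; last by rewrite mulr0.
    by rewrite a0 !mul0r.
  by rewrite mulr1.
have hinf : classical_sets.has_inf E by split; [exists n%:R|exists 0 => m /Elb].
pose m := inf E.
have Em : E m.
  move=> x hx; set s := \sum_u _; set q := adj_form _ _ _.
  have s0 : 0 <= s by apply: sumr_ge0 => i _; exact: sqr_ge0.
  rewrite leNgt; apply/negP => hlt.
  have [s00|sp] := eqVneq s 0.
    by have := E0 x hx; rewrite -/s -/q s00 mulr0; move: hlt; rewrite s00 mulr0; lra.
  have {}sp : 0 < s by rewrite lt_def sp.
  have : m < q / s by rewrite ltr_pdivlMr.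
  move=> /(inf_lt hinf.1)[y Ey yq]; have := Ey x hx.
  rewrite -/s -/q; apply/negP; rewrite -ltNge; by rewrite -ltr_pdivlMr.
suff ml : m <= l by exact: mono Em.
apply: hl; have /psd_spec pX := Em.
have hX : (m%:M - A)^T = m%:M - A by rewrite linearB /= tr_scalar_mx signed_adj_sym.
have [B hB] := psd_factor hX pX (rank_leq_row _).
have [Bu|Bn] := boolP (B \in unitmx); last first.
  have : kermx B != 0 by rewrite kermx_eq0 row_free_unit.
  move=> /rowV0Pn[z /sub_kermxP zB z0]; apply/eigenvalueP; exists z => //.
  have : z *m (m%:M - A) = 0 by rewrite hB mulmxA zB mul0mx.
  by rewrite mulmxBr mul_mx_scalar => /eqP; rewrite subr_eq0 => /eqP.
exfalso; pose S := invmx B *m (invmx B)^T.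
pose K := 1 + \sum_i \sum_j `|S i j|.
have K0 : 0 < K by rewrite ltr_wpDr // sumr_ge0 // => i _; rewrite sumr_ge0.
have hK (z : 'rV[R]_n) : (z *m z^T) 0 0 <= K * (z *m (m%:M - A) *m z^T) 0 0.
  pose w := z *m B.
  have -> : z *m (m%:M - A) *m z^T = w *m w^T by rewrite hB /w trmx_mul !mulmxA.
  have -> : z *m z^T = w *m S *m w^T.
    have gen (y : 'rV[R]_n) : y *m S *m y^T = (y *m invmx B) *m (y *m invmx B)^T.
      by rewrite /S trmx_mul !mulmxA.
    by rewrite gen /w mulmxK.
  have w0 i : w 0 i ^+ 2 <= (w *m w^T) 0 0.
    by rewrite quad_id (bigD1 i) //= lerDl sumr_ge0 // => j _; exact: sqr_ge0.
  have ww : 0 <= (w *m w^T) 0 0 by rewrite quad_id sumr_ge0 // => j _; exact: sqr_ge0.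
  rewrite quad_mx /K mulrDl mul1r -[leLHS]add0r lerD // mulr_suml; apply: ler_sum => i _.
  rewrite mulr_suml; apply: ler_sum => j _; apply: le_trans (ler_norm _) _.
  rewrite -mulrA normrM; apply: ler_wpM2l => //; have := w0 i; have := w0 j.
  by rewrite ler_norml; have := sqr_ge0 (w 0 i - w 0 j); have := sqr_ge0 (w 0 i + w 0 j); move=> *; apply/andP; split; lra.
have : E (m - K^-1).
  apply/psd_spec => z; have := hK z; rewrite -ler_pdivrMl // => h.
  have -> : (m - K^-1)%:M - signed_adj R G = (m%:M - A) - (K^-1)%:M.
    by rewrite raddfB /= addrAC.
  by rewrite mulmxBr mulmxBl subE mul_mx_scalar -scalemxAl [X in _ - X]mxE subr_ge0.
move=> /(ge_inf hinf.2); rewrite -/m; have : 0 < K^-1 by rewrite invr_gt0.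
lra.
Qed.
End Factor.

(** * The lower bound *)

Section Lower.
Variable R : realType.
Variables (alpha beta : R).

Lemma code_of_family d (T K : finType) (F : T -> K -> R) :
  (forall u, \sum_k F u k ^+ 2 = 1) ->
  (forall u w, u != w -> \sum_k F u k * F w k = alpha \/ \sum_k F u k * F w k = beta) ->
  (#|K| <= d)%N -> exists v : 'I_#|T| -> 'rV[R]_d, two_distance_code alpha beta v.
Proof.
move=> h1 h2 Kd.
pose v (i : 'I_#|T|) : 'rV[R]_d := \row_j (if insub (j : nat) is Some k then F (enum_val i) (enum_val (k : 'I_#|K|)) else 0).
have hdot i j : dot (v i) (v j) = \sum_k F (enum_val i) k * F (enum_val j) k.
  rewrite (reindex (@enum_val K K)) /=; last by apply: onW_bij; exact: enum_val_bij.
  rewrite /dot (bigID (fun k : 'I_d => (k < #|K|)%N)) /= [X in _ + X]big1 ?addr0; last first.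
    by move=> k hk; rewrite !mxE insubN // mul0r.
  rewrite (big_ord_narrow Kd); apply: eq_bigr => k _; rewrite !mxE /=.
  by rewrite (valK k).
exists v; split=> [i|i j ij]; rewrite hdot.
  by rewrite -[RHS](h1 (enum_val i)); apply: eq_bigr => k _; rewrite expr2.
by apply: h2; rewrite (inj_eq enum_val_inj).
Qed.

Hypotheses (halpha0 : 0 <= alpha) (halpha1 : alpha < 1) (hbeta0 : beta < 0).
Local Notation lam := ((1 - alpha) / (alpha - beta)).
Local Notation gam := (alpha / (alpha - beta)).

Lemma sq_sum_le n (s : 'I_n -> R) : (\sum_i s i) ^+ 2 <= n%:R * \sum_i s i ^+ 2.
Proof.
rewrite expr2 big_distrlr /=.
apply: (@le_trans _ _ (\sum_i \sum_j (s i ^+ 2 + s j ^+ 2) / 2)).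
  by apply: ler_sum => i _; apply: ler_sum => j _; have := sqr_ge0 (s i - s j); lra.
have E i : \sum_j (s i ^+ 2 + s j ^+ 2) / 2 = (s i ^+ 2 *+ n + \sum_j s j ^+ 2) / 2.
  by rewrite -mulr_suml big_split /= sumr_const card_ord.
rewrite (eq_bigr _ (fun i _ => E i)) -mulr_suml big_split /= sumrMnl sumr_const card_ord mulr_natl; lra.
Qed.

(** Cauchy-Schwarz makes [I - (1 - gam) J] semidefinite; this is the constraint on [p] in the lower
    bound. *)
Lemma colour_factor p : p%:R * (1 - gam) <= 1 ->
  exists C : 'M[R]_(p, p), 1%:M - const_mx (1 - gam) = C *m C^T.
Proof.
move=> hp; apply: psd_factor.
- by apply/matrixP => i j; rewrite !mxE eq_sym.
- move=> z; rewrite quad_mx.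
  have -> : \sum_i \sum_j (1%:M - const_mx (1 - gam) : 'M[R]_p) i j * z 0 i * z 0 j
     = \sum_i z 0 i ^+ 2 - (1 - gam) * (\sum_i z 0 i) ^+ 2.
    rewrite expr2 big_distrlr /= mulr_sumr -sumrB; apply: eq_bigr => i _.
    have -> : z 0 i ^+ 2 = \sum_j (i == j)%:R * (z 0 i * z 0 j).
      rewrite (bigD1 i) //= eqxx mul1r expr2 big1 ?addr0 // => j; rewrite eq_sym => /negbTE ->.
      by rewrite mul0r.
    by rewrite mulr_sumr -sumrB; apply: eq_bigr => j _; rewrite !mxE; ring.
  rewrite subr_ge0; have g0 : 0 <= 1 - gam by rewrite subr_ge0 ltW // gam_lt1.
  apply: le_trans (ler_wpM2l g0 (sq_sum_le _)) _; rewrite mulrA mulrC mulrC -[leRHS]mul1r.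
  by apply: ler_wpM2r; [apply: sumr_ge0 => i _; exact: sqr_ge0|rewrite mulrC].
exact: rank_leq_row.
Qed.

(** Up to the factor [alpha - beta] the Gram matrix has [l] diagonal blocks [lam I - A], to which
    [gam] is added for equal colours and [gam - 1] for distinct ones. Without an edge this gives
    [alpha] or [beta] by colour; a positive edge turns [alpha] into [beta] and a negative one [beta]
    into [alpha]. The blocks need [l] times the rank of [lam I - A] dimensions, the colours [p]
    more. *)
Theorem code_of_graph p n (G : signed_graph n) l d : p%:R * (1 - gam) <= 1 ->
  colorable G p -> is_largest_eigenvalue G lam ->
  (l * (n - mult lam G) + p <= d)%N ->
  exists v : 'I_(l * n) -> 'rV[R]_d, two_distance_code alpha beta v.
Proof.
move=> hp /existsP[c hc] hG hd.
have [C hC] := colour_factor hp.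
have gap : 0 < alpha - beta by exact: gap_gt0.
have gap0 : alpha - beta != 0 by rewrite gt_eqF.
pose X := lam%:M - signed_adj R G.
have hX : X^T = X by rewrite linearB /= tr_scalar_mx signed_adj_sym.
have pX : psd X by apply/psd_spec; exact: largest_eigenvalue_spec_le.
have rX : (\rank X <= n - mult lam G)%N.
  have : (\rank (eigenspace (signed_adj R G) lam) = n - \rank (signed_adj R G - lam%:M)%R)%N.
    exact: mxrank_ker.
  rewrite -/(mult lam G) => ->; have := rank_leq_row (signed_adj R G - lam%:M).
  have -> : X = - (signed_adj R G - lam%:M) by rewrite opprB.
  by rewrite mxrank_opp; lia.
move: (n - mult lam G)%N rX hd => r rX hd.
have [B hB] := psd_factor hX pX rX.
pose s := Num.sqrt (alpha - beta).
have s2 : s * s = alpha - beta by rewrite -expr2 sqr_sqrtr // ltW.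
pose F (u : 'I_l * 'I_n) (k : 'I_l * 'I_r + 'I_p) : R :=
  match k with inl qk => (qk.1 == u.1)%:R * B u.2 qk.2 * s | inr k => C (c u.2) k * s end.
have hF u w : \sum_k F u k * F w k = (alpha - beta) *
    ((u.1 == w.1)%:R * X u.2 w.2 + ((c u.2 == c w.2)%:R - (1 - gam))).
  rewrite big_sumType /= mulrDr; congr (_ + _).
    rewrite -s2 -(pair_bigA _ (fun q k => (q == u.1)%:R * B u.2 k * s * ((q == w.1)%:R * B w.2 k * s))) /=.
    rewrite (bigD1 u.1) //= [X in _ + X]big1 ?addr0; last first.
      by move=> q /negbTE ->; rewrite big1 // => k _; rewrite !mul0r.
    have := congr1 (fun M : 'M_n => M u.2 w.2) hB; rewrite [RHS]mxE => ->.
    rewrite mulr_sumr mulr_sumr; apply: eq_bigr => k _; rewrite eqxx [_^T _ _]mxE mul1r; ring.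
  have := congr1 (fun M : 'M_p => M (c u.2) (c w.2)) hC.
  rewrite [RHS]mxE subE [1%:M _ _]mxE [const_mx _ _ _]mxE => ->.
  rewrite -s2 mulr_sumr; apply: eq_bigr => k _; rewrite [_^T _ _]mxE; ring.
have XE i j : X i j = lam * (i == j)%:R - signed_adj R G i j.
  by rewrite /X subE [_%:M _ _]mxE mulr_natr.
have := @code_of_family d [the finType of ('I_l * 'I_n)%type] [the finType of ('I_l * 'I_r + 'I_p)%type] F.
rewrite card_prod !card_ord card_sum card_prod !card_ord; apply => //.
- move=> u; transitivity (\sum_k F u k * F u k); first by apply: eq_bigr => k _; rewrite expr2.
  rewrite hF !eqxx XE eqxx signed_adjE; have [_ -> _] := int_adj_signed G.
  by rewrite /=; field.
- move=> [q i] [q' j] /=; rewrite xpair_eqE => ne; rewrite !hF /=.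
  have := forallP (forallP hc i) j; move: ne; rewrite XE mxE.
  case: (eqVneq q q') => [_|_] /=; last first.
    by move=> _ _; rewrite mul0r; case: (c i == c j); [left|right]; rewrite /=; field.
  move=> ij; rewrite (negbTE ij) /= mulr0 sub0r mul1r.
  have := edge_one_sign G i j.
  case: (pos_edge G i j); case: (neg_edge G i j) => //= _; case: (c i == c j) => //= _;
    try by [right; field|left; field].
Qed.

(** The Gram matrix [(1 - alpha) I + alpha J] is semidefinite. This code serves when [d < p] and
    when no admissible graph exists. *)
Lemma simplex_code d : exists v : 'I_d -> 'rV[R]_d, two_distance_code alpha beta v.
Proof.
pose X : 'M[R]_d := (1 - alpha)%:M + const_mx alpha.
have hX : X^T = X by apply/matrixP => i j; rewrite !mxE eq_sym.
have pX : psd X.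
  move=> z; rewrite quad_mx.
  have -> : \sum_i \sum_j X i j * z 0 i * z 0 j
     = (1 - alpha) * (\sum_i z 0 i ^+ 2) + alpha * (\sum_i z 0 i) ^+ 2.
    rewrite expr2 big_distrlr /= !mulr_sumr -big_split; apply: eq_bigr => i _ /=.
    have -> : z 0 i ^+ 2 = \sum_j (i == j)%:R * (z 0 i * z 0 j).
      rewrite (bigD1 i) //= eqxx mul1r expr2 big1 ?addr0 // => j; rewrite eq_sym => /negbTE ->.
      by rewrite mul0r.
    by rewrite !mulr_sumr -big_split; apply: eq_bigr => j _; rewrite !mxE /= -mulr_natr; ring.
  rewrite addr_ge0 // mulr_ge0 ?sqr_ge0 //; first by rewrite subr_ge0 ltW.
  by apply: sumr_ge0 => i _; exact: sqr_ge0.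
have [B hB] := psd_factor hX pX (rank_leq_row X).
exists (fun i => row i B).
have hdot i j : dot (row i B) (row j B) = X i j.
  by rewrite hB mxE; apply: eq_bigr => k _; rewrite !mxE.
split=> [i|i j ij]; rewrite hdot !mxE.
  by rewrite eqxx mulr1n subrK.
by left; rewrite (negbTE ij) mulr0n add0r.
Qed.
End Lower.

(** * Counting roots with bounded chromatic number *)

Lemma int_abs1 (z : int) : `|z| = 1 -> z = 1 \/ z = -1.
Proof. lia. Qed.

Section RootCount.
Variables (R : realFieldType) (T : finType) (a : T -> T -> int) (p : nat) (c : T -> 'I_p) (r : root_data T).
Hypotheses (ha : signed_symmetric a) (hr : represents a r [set: T])
  (hneg : forall u v, a u v = -1 -> c u != c v) (hpos : forall u v, a u v = 1 -> c u = c v).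
Hypothesis p3 : (3 <= p)%N.
Local Notation e1 := (end1 r).
Local Notation e2 := (end2 r).
Implicit Types (u v w : T) (x y : nat).

Let inc x u := (e1 u == x) || (e2 u == x).
(** Meaningful only when [x] is an end of [u]. *)
Let oth x u := if e1 u == x then e2 u else e1 u.
Let par u w := [&& w != u, inc (e1 u) w & inc (e2 u) w].

Lemma ends u : [/\ (e1 u < dim r)%N, (e2 u < dim r)%N, e1 u != e2 u, `|sgn1 r u| = 1 & `|sgn2 r u| = 1].
Proof. by have [_ h _ _] := hr; apply: h; rewrite inE. Qed.

Lemma coord_abs x u : inc x u -> `|coord r u x| = 1.
Proof.
have [_ _ h3 h4 h5] := ends u; rewrite /inc /coord (eq_sym x) (eq_sym x).
case: (eqVneq (e1 u) x) => [E _|_ /= /eqP E].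
  by rewrite -E eq_sym (negbTE h3); lia.
by rewrite E eqxx; lia.
Qed.

Lemma ipE u w : u != w -> root_ip r (coord r u) w = - a u w.
Proof.
by move=> uw; have [_ _ h _] := hr; rewrite h ?inE // (negbTE uw) mulr0 sub0r.
Qed.

Lemma ip_oth x u w : inc x w ->
  root_ip r (coord r u) w = coord r u x * coord r w x + coord r u (oth x w) * coord r w (oth x w).
Proof.
have [_ _ h3 _ _] := ends w.
have c1 : coord r w (e1 w) = sgn1 r w by rewrite /coord eqxx (negbTE h3) mulr1 mulr0 addr0.
have c2 : coord r w (e2 w) = sgn2 r w by rewrite /coord eqxx eq_sym (negbTE h3) mulr1 mulr0 add0r.
rewrite /inc /oth /root_ip; case: (eqVneq (e1 w) x) => [<- _|ne /= /eqP <-]; rewrite c1 c2; ring.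
Qed.

Lemma inc_oth x u : inc x u -> inc (oth x u) u /\ oth x u != x.
Proof.
have [_ _ h3 _ _] := ends u; rewrite /inc /oth.
case: (eqVneq (e1 u) x) => [<- _|ne /= h]; first by rewrite eqxx orbT eq_sym.
by rewrite eqxx.
Qed.

Lemma coord_out x u : ~~ inc x u -> coord r u x = 0.
Proof.
rewrite /inc negb_or (eq_sym _ x) (eq_sym _ x) /coord => /andP[/negbTE -> /negbTE ->].
by rewrite !mulr0 addr0.
Qed.

Lemma inc_cases x y u : inc x u -> inc y u -> y != x -> y = oth x u.
Proof.
rewrite /inc /oth; case: (eqVneq (e1 u) x) => [->|ne /= /eqP ->] /=.
  by move=> _ /orP[/eqP ->|/eqP -> //]; rewrite eqxx.
by move=> /orP[/eqP -> //|/eqP ->]; rewrite eqxx.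
Qed.

Lemma abs_ip u w : u != w -> `|root_ip r (coord r u) w| <= 1.
Proof. by move=> uw; have [_ _ h] := ha; rewrite ipE // normrN. Qed.

(** Roots meeting in one coordinate have inner product 1 or -1 according to their signs there. This
    determines the sign of the edge, and the colouring then tells whether the colours agree. *)
Lemma meet_colour x u w : u != w -> inc x u -> inc x w -> oth x u != oth x w ->
  (c u == c w) = (coord r u x != coord r w x).
Proof.
move=> uw xu xw ne; have := ipE uw; rewrite (ip_oth u xw).
have [ow owx] := inc_oth xw.
have -> : coord r u (oth x w) = 0.
  by apply: coord_out; apply: contra ne => h; rewrite (inc_cases xu h owx).
have := coord_abs xu; have := coord_abs xw; rewrite mul0r addr0.
have [->|ncw] := eqVneq (coord r u x) (coord r w x) => h1 h2 E /=.
  have {}E : a u w = -1 by lia.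
  by apply/negbTE; exact: hneg.
have {}E : a u w = 1 by lia.
by apply/eqP; exact: hpos.
Qed.

(* Parallel roots are orthogonal: they agree at exactly one end. *)
Lemma parallel_agree x u w : u != w -> inc x u -> inc x w -> oth x u = oth x w ->
  (coord r u x == coord r w x) = (coord r u (oth x u) != coord r w (oth x u)).
Proof.
move=> uw xu xw E; have := abs_ip uw; rewrite (ip_oth u xw) -E.
have [ou _] := inc_oth xu; have [ow _] := inc_oth xw; rewrite -E in ow.
have := coord_abs xu; have := coord_abs xw; have := coord_abs ou; have := coord_abs ow.
move: (coord r u x) (coord r w x) (coord r u _) (coord r w _) => i j k l.
have cs := int_abs1.
by move=> /cs[] -> /cs[] -> /cs[] -> /cs[] ->.
Qed.

Lemma parP x u w : inc x u -> par u w = [&& w != u, inc x w & oth x w == oth x u].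
Proof.
move=> xu; rewrite /par; case: (eqVneq w u) => //= wu.
have [_ _ h3 _ _] := ends u; have [_ _ h3' _ _] := ends w.
have [ou oux] := inc_oth xu; have ends_u : (e1 u, e2 u) = (x, oth x u) \/ (e1 u, e2 u) = (oth x u, x).
  by move: xu; rewrite /inc /oth; case: (eqVneq (e1 u) x) => [->|_ /= /eqP ->]; [left|right].
have key : inc x w && inc (oth x u) w = inc x w && (oth x w == oth x u).
  case: (boolP (inc x w)) => //= xw; apply/idP/eqP => [h|<-]; last by have [] := inc_oth xw.
  by rewrite (inc_cases xw h oux).
by case: ends_u => -[-> ->]; rewrite ?[inc (oth x u) w && _]andbC key.
Qed.

(** Three parallel roots would be pairwise orthogonal in a plane. *)
Lemma par_unique u w v : par u w -> par u v -> w = v.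
Proof.
have [_ _ h3 _ _] := ends u; have iu : inc (e1 u) u by rewrite /inc eqxx.
rewrite !(parP _ iu) => /and3P[wu xw /eqP ow] /and3P[vu xv /eqP ov].
apply/eqP/negPn/negP => wv.
have := parallel_agree wu xw iu ow; have := parallel_agree vu xv iu ov.
have := parallel_agree wv xw xv (etrans ow (esym ov)).
have [o1 _] := inc_oth xw; have [o2 _] := inc_oth xv; have [o3 _] := inc_oth iu.
rewrite ow in o1 *; rewrite ov in o2 *.
have := coord_abs xw; have := coord_abs xv; have := coord_abs iu.
have := coord_abs o1; have := coord_abs o2; have := coord_abs o3.
move: (coord r u _) (coord r u _) (coord r w _) (coord r w _) (coord r v _) (coord r v _).
have cs := int_abs1.
by move=> ? ? ? ? ? ? /cs[] -> /cs[] -> /cs[] -> /cs[] -> /cs[] -> /cs[] ->.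
Qed.

Lemma par_sym u w : par u w -> par w u.
Proof.
have iu : inc (e1 u) u by rewrite /inc eqxx.
rewrite (parP _ iu) => /and3P[wu xw /eqP ow].
by rewrite (parP _ xw) eq_sym wu iu ow eqxx.
Qed.

Lemma same_colour_par x u w : u != w -> inc x u -> inc x w -> c u = c w ->
  coord r u x = coord r w x -> par u w.
Proof.
move=> uw xu xw cuw suw; rewrite (parP _ xu) eq_sym uw xw /= eq_sym.
by apply: contraT => /(meet_colour uw xu xw); rewrite cuw suw !eqxx.
Qed.

(** Chosen so that [p (1/2 + d) = p / 2 + 1/4]. *)
Let d : R := (4 * p%:R)^-1.

Let d_bounds : [/\ 0 < d, d <= 1/12 & p%:R * d = 1/4].
Proof.
have p0 : (3 : R) <= p%:R by rewrite ler_nat.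
have q0 : (0 : R) < 4 * p%:R by rewrite mulr_gt0 //; lra.
split; rewrite /d ?invr_gt0 //.
  by rewrite -[1/12]invrK lef_pV2 ?posrE // ?invr_gt0; lra.
by field; rewrite gt_eqF //; lra.
Qed.

(* Each root distributes a total weight 1 over its two ends, so as to favour
   the coordinates at which few roots can meet. *)
Definition end_weight u x : R :=
  if [pick w | par u w] is Some w then
    if coord r u x == coord r w x then (if c u == c w then 1/4 else 1/2 + d)
    else (if c u == c w then 3/4 else 1/2 - d)
  else 1/2.

Lemma weight_par u w x : par u w -> end_weight u x =
  if coord r u x == coord r w x then (if c u == c w then 1/4 else 1/2 + d)
    else (if c u == c w then 3/4 else 1/2 - d).
Proof.
by move=> h; rewrite /end_weight; case: pickP => [v /(par_unique h) <- //|/(_ w)]; rewrite h.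
Qed.

Lemma weight_sum u : end_weight u (e1 u) + end_weight u (e2 u) = 1.
Proof.
rewrite /end_weight; case: pickP => [w h|_]; last by lra.
have iu : inc (e1 u) u by rewrite /inc eqxx.
have := h; rewrite (parP _ iu) => /and3P[wu xw /eqP ow]; rewrite eq_sym in wu.
have := parallel_agree wu iu xw (esym ow).
have -> : oth (e1 u) u = e2 u by rewrite /oth eqxx.
by move=> ->; case: eqP => _ /=; case: (c u == c w); lra.
Qed.

(** With equal signs at [x], roots of one colour are parallel. So a colour contributes either a pair
    of weights 1/4 or a single root of weight at most [1/2 + d]. *)
Lemma weight_unmixed x :
  (forall u w, inc x u -> inc x w -> coord r u x = coord r w x) ->
  \sum_(u | inc x u) end_weight u x <= p%:R / 2 + 1/4.
Proof.
move=> hx; have [d0 d12 pd] := d_bounds.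
suff hk k : \sum_(u | inc x u && (c u == k)) end_weight u x <= 1/2 + d.
  rewrite (partition_big c xpredT) //=.
  apply: (@le_trans _ _ (\sum_(k < p) (1/2 + d))); first by apply: ler_sum => k _; exact: hk.
  by rewrite sumr_const card_ord -[_ *+ p]mulr_natl mulrDr pd; lra.
case: (pickP (fun u => inc x u && (c u == k))) => [u /andP[xu /eqP cu]|h0]; last first.
  by rewrite big_pred0 //; lra.
rewrite (bigD1 u) /= ?xu ?cu ?eqxx //.
case: (pickP (fun w => (inc x w && (c w == k)) && (w != u))) => [w /andP[/andP[xw /eqP cw] wu]|h1].
  have uw' : u != w by rewrite eq_sym.
  have uw : par u w by apply: (same_colour_par uw' xu xw _ (hx _ _ xu xw)); rewrite cu cw.
  rewrite (bigD1 w) /= ?xw ?cw ?eqxx // big1 ?addr0; last first.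
    move=> v /andP[/andP[/andP[xv /eqP cv] vu] vw]; exfalso; move/eqP: vw; apply.
    have uv' : u != v by rewrite eq_sym.
    have uv : par u v by apply: (same_colour_par uv' xu xv _ (hx _ _ xu xv)); rewrite cu cv.
    by rewrite (par_unique uw uv).
  rewrite (weight_par _ uw) (weight_par _ (par_sym uw)) cu cw !eqxx (hx _ _ xu xw) eqxx; lra.
rewrite big_pred0 // addr0 /end_weight; case: pickP => [w uw|_]; last by lra.
have := uw; rewrite (parP _ xu) => /and3P[_ xw _].
by rewrite (hx _ _ xu xw) eqxx; case: (c u == c w); lra.
Qed.

(** A block is at most one parallel pair. The worst one has a single colour and opposite signs at
    [x], with weight 3/4 twice. *)
Lemma weight_block x y : \sum_(u | inc x u && (oth x u == y)) end_weight u x <= 3/2.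
Proof.
have [d0 d12 _] := d_bounds.
case: (pickP (fun u => inc x u && (oth x u == y))) => [u /andP[xu /eqP ou]|h0]; last first.
  by rewrite big_pred0 //; lra.
rewrite (bigD1 u) /= ?xu ?ou ?eqxx //.
case: (pickP (fun w => (inc x w && (oth x w == y)) && (w != u))) => [w /andP[/andP[xw /eqP ow] wu]|h1].
  have uw : par u w by rewrite (parP _ xu) wu xw ow ou eqxx.
  rewrite (bigD1 w) /= ?xw ?ow ?eqxx // big1 ?addr0; last first.
    move=> v /andP[/andP[/andP[xv /eqP ov] vu] vw]; exfalso; move/eqP: vw; apply.
    have uv : par u v by rewrite (parP _ xu) vu xv ov ou eqxx.
    by rewrite (par_unique uw uv).
  rewrite (weight_par _ uw) (weight_par _ (par_sym uw)) (eq_sym (c w)) (eq_sym (coord r w x)).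
  by case: eqP => _; case: eqP => _; lra.
rewrite big_pred0 // addr0 /end_weight; case: pickP => [w uw|_]; last by lra.
by case: eqP => _; case: eqP => _; lra.
Qed.

Section Mixed.
Variables (x : nat) (um up : T).
Hypotheses (xm : inc x um) (xp : inc x up) (smp : coord r um x != coord r up x).

Lemma opposite u : inc x u -> exists2 v, inc x v & coord r v x != coord r u x.
Proof.
move=> xu; have [E|ne] := eqVneq (coord r um x) (coord r u x); last by exists um.
by exists up; rewrite // -E eq_sym.
Qed.

Lemma colourP u w : inc x u -> inc x w -> oth x u != oth x w ->
  (c u == c w) = (coord r u x != coord r w x).
Proof.
by move=> xu xw ne; apply: meet_colour => //; apply: contraNneq ne => ->.
Qed.

(** For distinct other ends, colours agree exactly when signs differ. So three such roots have equal
    signs and distinct colours, whereas a root of the opposite sign would share its colour with two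
    of them. *)
Lemma two_other_ends u1 u2 u3 : inc x u1 -> inc x u2 -> inc x u3 ->
  oth x u1 != oth x u2 -> oth x u1 != oth x u3 -> oth x u2 != oth x u3 -> False.
Proof.
move=> x1 x2 x3 o12 o13 o23.
have c12 := colourP x1 x2 o12; have c13 := colourP x1 x3 o13; have c23 := colourP x2 x3 o23.
have a1 := coord_abs x1; have a2 := coord_abs x2; have a3 := coord_abs x3.
have [v xv sv] := opposite x1; have av := coord_abs xv.
have cs := int_abs1.
have h12 : coord r u1 x = coord r u2 x.
  apply/eqP/negPn/negP => s12; move: c12; rewrite s12 => /eqP E; move: c13 c23; rewrite E => ->.
  by move: s12; case: (cs _ a1) => ->; case: (cs _ a2) => ->; case: (cs _ a3) => ->.
have h13 : coord r u1 x = coord r u3 x.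
  apply/eqP/negPn/negP => s13; move: c13; rewrite s13 => /eqP E; move: c12; rewrite E eq_sym c23.
  by rewrite -h12 s13 eqxx.
move: c12 c13 c23; rewrite -h12 -h13 eqxx /= => /negbT c12 /negbT c13 /negbT c23.
have hv u : inc x u -> oth x v != oth x u -> coord r u x = coord r u1 x -> c v = c u.
  by move=> xu o s; apply/eqP; rewrite (colourP xv xu o) s.
have [E|n1] := eqVneq (oth x v) (oth x u1).
  by case/eqP: c23; rewrite -(hv u2) ?E // -(hv u3) ?E.
have [E|n2] := eqVneq (oth x v) (oth x u2).
  by case/eqP: c13; rewrite -(hv u1) // -(hv u3) ?E.
by case/eqP: c12; rewrite -(hv u1) // -(hv u2).
Qed.

(** In a parallel pair, equal signs with distinct colours are refuted by a root of the opposite sign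
    outside the pair, and opposite signs with equal colours by [z]. What remains weighs [1/2] or
    [1 - 2 d]. *)
Lemma weight_block_two y z : inc x z -> oth x z != y ->
  \sum_(u | inc x u && (oth x u == y)) end_weight u x <= 1 - 2 * d.
Proof.
move=> xz oz; have [d0 d12 _] := d_bounds.
case: (pickP (fun u => inc x u && (oth x u == y))) => [u /andP[xu /eqP ou]|h0]; last first.
  by rewrite big_pred0 //; lra.
rewrite (bigD1 u) /= ?xu ?ou ?eqxx //.
case: (pickP (fun w => (inc x w && (oth x w == y)) && (w != u))) => [w /andP[/andP[xw /eqP ow] wu]|h1].
  have uw : par u w by rewrite (parP _ xu) wu xw ow ou eqxx.
  have only v : inc x v -> oth x v = y -> v != u -> v = w.
    move=> xv ov vu; have uv : par u v by rewrite (parP _ xu) vu xv ov ou eqxx.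
    by rewrite (par_unique uw uv).
  rewrite (bigD1 w) /= ?xw ?ow ?eqxx // big1 ?addr0; last first.
    by move=> v /andP[/andP[/andP[xv /eqP ov] vu] /eqP vw]; case: vw; exact: only.
  rewrite (weight_par _ uw) (weight_par _ (par_sym uw)) (eq_sym (c w)) (eq_sym (coord r w x)).
  have cz v : inc x v -> oth x v = y -> (c z == c v) = (coord r z x != coord r v x).
    by move=> xv ov; apply: colourP; rewrite ?ov.
  have cs := int_abs1.
  have [sE|sE] := eqVneq (coord r u x) (coord r w x); have [cE|cE] := eqVneq (c u) (c w); try lra.
    exfalso; have [v xv sv] := opposite xu.
    have ov : oth x v != y.
      apply/negP => /eqP ov; have vu : v != u by apply: contraNneq sv => ->.
      by move: sv; rewrite (only v) // sE eqxx.
    move/eqP: cE; apply; have h1 : c v == c u by rewrite colourP // ou.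
    have h2 : c v == c w by rewrite colourP ?ow // -sE.
    by rewrite -(eqP h1) (eqP h2).
  have E1 := cz u xu ou; have E2 := cz w xw ow; rewrite cE E2 in E1.
  exfalso; move: E1 sE (coord_abs xz) (coord_abs xu) (coord_abs xw).
  move: (coord r z x) (coord r u x) (coord r w x) => i j k E1 sE /cs hi /cs hj /cs hk.
  by case: hi hj hk E1 sE => -> [] -> [] ->.
rewrite big_pred0 // addr0 /end_weight; case: pickP => [w uw|_]; last by lra.
have := uw; rewrite (parP _ xu) => /and3P[wu xw /eqP ow].
by have := h1 w; rewrite xw ow ou eqxx wu.
Qed.

(** There is either one block, of weight at most 3/2, or two of weight at most [1 - 2 d] each. It is
    [3 <= p] that makes both fit. *)
Lemma weight_mixed : \sum_(u | inc x u) end_weight u x <= p%:R / 2 + 1/4.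
Proof.
have [d0 d12 _] := d_bounds; have p0 : (3 : R) <= p%:R by rewrite ler_nat.
rewrite (bigID (fun u => oth x u == oth x um)) /=.
have h1 := weight_block x (oth x um).
case: (pickP (fun u => inc x u && (oth x u != oth x um))) => [z /andP[xz oz]|h0]; last first.
  by rewrite [X in _ + X]big_pred0 // addr0; lra.
have h2 := weight_block_two xz oz.
have h3 := @weight_block_two (oth x z) um xm ltac:(by rewrite eq_sym).
have -> : \sum_(u | inc x u && (oth x u != oth x um)) end_weight u x
   = \sum_(u | inc x u && (oth x u == oth x z)) end_weight u x.
  apply: eq_bigl => u; case: (boolP (inc x u)) => //= xu.
  apply/idP/eqP => [ou|->//]; apply/eqP/negPn/negP => ouz.
  by apply: (two_other_ends xm xu xz) => //; rewrite eq_sym.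
have h4 : 0 <= p%:R / 2 + 4 * d - 7/4.
  have pp : (0 : R) < p%:R by lra.
  rewrite -(pmulr_rge0 _ pp); have [_ _ pd] := d_bounds.
  have -> : p%:R * (p%:R / 2 + 4 * d - 7/4) = p%:R * p%:R / 2 + 4 * (p%:R * d) - p%:R * (7/4) by ring.
  by rewrite pd; nra.
lra.
Qed.
End Mixed.

Theorem root_count : #|T|%:R <= (p%:R / 2 + 1/4) * (dim r)%:R :> R.
Proof.
have hx x : \sum_(u | inc x u) end_weight u x <= p%:R / 2 + 1/4.
  case: (boolP [exists u, exists w, [&& inc x u, inc x w & coord r u x != coord r w x]]).
    by case/existsP => u /existsP[w /and3P[xu xw suw]]; exact: (weight_mixed xu xw suw).
  move/existsPn => h; apply: weight_unmixed => u w xu xw.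
  by have /existsPn/(_ w) := h u; rewrite xu xw /= negbK => /eqP.
have -> : #|T|%:R = \sum_(x < dim r) \sum_(u | inc x u) end_weight u x :> R.
  rewrite -sum1_card natr_sum (exchange_big_dep xpredT) //=; apply: eq_bigr => u _.
  have [h1 h2 h3 _ _] := ends u; rewrite -(weight_sum u).
  rewrite (bigD1 (Ordinal h1)) /= ?/inc ?eqxx // (bigD1 (Ordinal h2)) /=; last first.
    by rewrite eqxx orbT -val_eqE /= eq_sym.
  rewrite big1 ?addr0 // => i /andP[/andP[/orP[]/eqP E]]; rewrite -!val_eqE /= -E eqxx //.
by rewrite mulr_natr -[X in _ *+ X]card_ord -sumr_const; apply: ler_sum => x _; exact: hx.
Qed.
End RootCount.

(** * The infimum [k_p] is attained *)

Lemma colored_signs n (G : signed_graph n) p : colorable G p -> exists c : 'I_n -> 'I_p,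
  (forall u v, int_adj G u v = -1 -> c u != c v) /\ (forall u v, int_adj G u v = 1 -> c u = c v).
Proof.
move=> /existsP[c hc]; exists c; split=> u v; have := forallP (forallP hc u) v; rewrite /int_adj.
  by case: (pos_edge G u v) => //; case: (neg_edge G u v) => // /andP[].
case: (pos_edge G u v) => //; last by case: (neg_edge G u v).
by move=> /andP[_ /= /eqP].
Qed.

Section Admissible.
Variable R : realType.
Variables (p : nat) (lam : R).

Definition admissible n (G : signed_graph n) : Prop :=
  [/\ (0 < n)%N, colorable G p & is_largest_eigenvalue G lam].

Lemma mult_gt0 n (G : signed_graph n) : is_largest_eigenvalue G lam -> (0 < mult lam G)%N.
Proof. by move=> [h _]; rewrite /mult lt0n mxrank_eq0. Qed.

Lemma admissible_of_spec n (G : signed_graph n) : colorable G p ->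
  spec_le (int_adj G) lam [set: 'I_n] -> (0 < mult lam G)%N -> admissible G.
Proof.
move=> hc hs hm; split=> //; last exact: largest_spec_le.
by apply: leq_trans hm (rank_leq_col _).
Qed.

Section Restrict.
Variables (T : finType) (X : {set T}) (a : T -> T -> int).
Hypothesis ha : signed_symmetric a.
Let f : 'I_#|X| -> T := fun i => enum_val i.

Definition restrict := graph_of (induced_signed f ha).

Lemma restrictE i j : int_adj restrict i j = a (f i) (f j).
Proof. exact: graph_ofE. Qed.

Lemma restrict_colorable (c : T -> 'I_p) :
  (forall u v, a u v = -1 -> c u != c v) -> (forall u v, a u v = 1 -> c u = c v) ->
  colorable restrict p.
Proof.
move=> hn hp; apply/existsP; exists [ffun i => c (f i)].
apply/forallP => i; apply/forallP => j; rewrite !ffunE /=.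
by apply/andP; split; apply/implyP => /eqP h; [exact: hn|apply/eqP; exact: hp].
Qed.
End Restrict.

(** An eigenvector restricted to a union of components remains one or vanishes, and it is determined
    by its two restrictions. *)
Lemma mult_split n (G : signed_graph n) (X : {set 'I_n}) :
  (forall u v, u \in X -> v \notin X -> int_adj G u v = 0) ->
  (mult lam G <= mult lam (restrict X (int_adj_signed G))
     + mult lam (restrict (~: X) (int_adj_signed G)))%N.
Proof.
move=> h0; have [as_ _ _] := int_adj_signed G.
pose P (Y : {set 'I_n}) : 'M[R]_(n, #|Y|) := \matrix_(i, j) (i == enum_val j)%:R.
have zP (Y : {set 'I_n}) (z : 'rV[R]_n) j : (z *m P Y) 0 j = z 0 (enum_val j).
  rewrite mxE (bigD1 (enum_val j)) //= mxE eqxx mulr1 big1 ?addr0 // => i /negbTE ij.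
  by rewrite mxE ij mulr0.
pose E := eigenspace (signed_adj R G) lam.
have sub (Y : {set 'I_n}) : (forall u v, u \in Y -> v \notin Y -> int_adj G u v = 0) ->
    (E *m P Y <= eigenspace (signed_adj R (restrict Y (int_adj_signed G))) lam)%MS.
  move=> hY; apply/row_subP => i; rewrite row_mul; set z := row i E.
  have /eigenspaceP hz : (z <= eigenspace (signed_adj R G) lam)%MS by exact: row_sub.
  apply/eigenspaceP/rowP => j; rewrite [RHS]mxE zP.
  have := congr1 (fun y : 'rV_n => y 0 (enum_val j)) hz; rewrite [RHS]mxE => <-.
  rewrite [LHS]mxE [RHS]mxE (bigID (fun u => u \in Y)) /= [X in _ + X]big1 ?addr0; last first.
    by move=> u uY; rewrite signed_adjE as_ hY ?enum_valP // mulr0.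
  rewrite [RHS]big_enum_val; apply: eq_bigr => u _.
  by rewrite zP !signed_adjE restrictE.
have hX := sub X h0.
have hC : (E *m P (~: X) <= eigenspace (signed_adj R (restrict (~: X) (int_adj_signed G))) lam)%MS.
  by apply: sub => u v; rewrite !inE negbK => uX vX; rewrite as_ h0.
have hE : (\rank E <= \rank (E *m row_mx (P X) (P (~: X))))%N.
  rewrite -[X in (X <= _)%N](mxrank_mul_ker E (row_mx (P X) (P (~: X)))).
  rewrite -[X in (_ <= X)%N]addn0 leq_add2l leqn0 mxrank_eq0; apply/eqP/row_matrixP => i.
  rewrite row0; set z := row i _.
  have : (z <= kermx (row_mx (P X) (P (~: X))))%MS by apply: submx_trans (row_sub _ _) (capmxSr _ _).
  move=> /sub_kermxP; rewrite mul_mx_row => /eqP; rewrite row_mx_eq0 => /andP[/eqP z1 /eqP z2].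
  apply/rowP => u; rewrite [RHS]mxE; case: (boolP (u \in X)) => uX.
    have := zP X z (enum_rank_in uX u); rewrite z1 mxE enum_rankK_in // => <- //.
  have uC : u \in ~: X by rewrite inE.
  by have := zP (~: X) z (enum_rank_in uC u); rewrite z2 mxE enum_rankK_in // => <-.
apply: leq_trans hE _; rewrite mul_mx_row -mxrank_tr tr_row_mx.
apply: (@leq_trans (\rank (E *m P X)^T + \rank (E *m P (~: X))^T)).
  by rewrite -addsmxE; exact: (mxrank_adds_leqif _ _).1.
by rewrite !mxrank_tr; apply: leq_add; apply: mxrankS.
Qed.

(* The mediant inequality: one of the two parts has a ratio at most that of the whole. *)
Lemma connected_admissible n (G : signed_graph n) : admissible G ->
  exists n' (G' : signed_graph n'), [/\ admissible G', connected_on (int_adj G') [set: 'I_n'] &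
     (n' * mult lam G <= n * mult lam G')%N].
Proof.
elim/ltn_ind: n G => n IH G hG.
have [hcon|hn] := EM (connected_on (int_adj G) [set: 'I_n]); first by exists n, G.
move/existsNP: hn => [X]; move=> /not_implyP[XT /not_implyP[X0 /not_implyP[XnT hX]]].
have [as_ _ _] := int_adj_signed G.
have h0 u v : u \in X -> v \notin X -> int_adj G u v = 0.
  move=> uX vX; apply/eqP/negPn/negP => h; apply: hX.
  by exists u, v; split=> //; rewrite ?inE ?vX // as_.
have [n0 /colored_signs[c [cn cp]] hl] := hG.
have hs := largest_eigenvalue_spec_le hl.
have sp (Y : {set 'I_n}) : spec_le (int_adj (restrict Y (int_adj_signed G))) lam [set: 'I_#|Y|].
  by apply: induced_spec_le; apply: spec_le_sub hs; exact: subsetT.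
have adm (Y : {set 'I_n}) : (0 < mult lam (restrict Y (int_adj_signed G)))%N ->
    admissible (restrict Y (int_adj_signed G)).
  by move=> hm; apply: admissible_of_spec => //; exact: restrict_colorable cn cp.
have cX : (#|X| < n)%N by rewrite -[X in (_ < X)%N]card_ord -cardsT proper_card // properEneq XnT.
have cC : (#|~: X| < n)%N.
  rewrite -[X in (_ < X)%N]card_ord -cardsT proper_card // properEneq subsetT andbT.
  by apply: contraNneq X0 => E; rewrite -(setCK X) E setCT.
have sC := cardsC X; rewrite card_ord in sC.
have := mult_split h0; set m1 := mult lam (restrict X _); set m2 := mult lam (restrict (~: X) _) => hm.
have mG := mult_gt0 hl.
have tr (Y : {set 'I_n}) : (#|Y| < n)%N -> (0 < mult lam (restrict Y (int_adj_signed G)))%N ->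
    (#|Y| * mult lam G <= n * mult lam (restrict Y (int_adj_signed G)))%N ->
    exists n' (G' : signed_graph n'), [/\ admissible G', connected_on (int_adj G') [set: 'I_n'] &
     (n' * mult lam G <= n * mult lam G')%N].
  move=> cY mY rY; have [n' [G' [h1 h2 h3]]] := IH _ cY _ (adm Y mY).
  exists n', G'; split=> //.
  have Y0 : (0 < #|Y|)%N by have [] := adm Y mY.
  rewrite -(leq_pmul2l Y0); move: h3 rY; set my := mult lam (restrict _ _); set m' := mult lam G'.
  set m := mult lam G => h3 rY.
  have : (n' * (#|Y| * m) <= n' * (n * my))%N by rewrite leq_mul2l rY orbT.
  have : (n * (n' * my) <= n * (#|Y| * m'))%N by rewrite leq_mul2l h3 orbT.
  nia.
have [r1|r1] := leqP (#|X| * mult lam G) (n * m1).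
  have [m10|m10] := posnP m1; last exact: tr cX m10 r1.
  have x0 : (0 < #|X|)%N by rewrite card_gt0.
  by move: r1; rewrite m10; nia.
have [r2|r2] := leqP (#|~: X| * mult lam G) (n * m2); last by nia.
have [m20|m20] := posnP m2; last exact: tr cC m20 r2.
by move: r2 r1; rewrite m20; nia.
Qed.

(** The neighbours of [u] in one colour class are joined to [u] with a common sign and to each other
    only positively. A star with weight [lam] at its centre, up to that sign, shows that there are
    at most [lam ^+ 2] of them. *)
Lemma colored_degree n (G : signed_graph n) : 0 < lam -> admissible G ->
  deg_le (int_adj G) [set: 'I_n] (p * Num.bound (lam ^+ 2)).
Proof.
move=> lam0 [n0 /colored_signs[c [cn cp]] hl] u _; have hs := largest_eigenvalue_spec_le hl.
have [as_ a0 a1] := int_adj_signed G.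
pose N k := [set v | (int_adj G u v != 0) && (c v == k)].
suff hk k : (#|N k| <= Num.bound (lam ^+ 2))%N.
  have sub : [set v in [set: 'I_n] | int_adj G u v != 0] \subset \bigcup_(k in [set: 'I_p]) N k.
    by apply/subsetP => v; rewrite !inE /= => h; apply/bigcupP; exists (c v); rewrite ?inE ?h /=.
  apply: leq_trans (subset_leq_card sub) _; apply: leq_trans (leq_card_bigcup _ _) _.
  by rewrite -[X in (_ <= X * _)%N]card_ord -cardsT -sum_nat_const; apply: leq_sum => k _; exact: hk.
pose tau : int := if c u == k then 1 else -1.
have uN : u \notin N k by rewrite inE a0 eqxx.
have hN v : v \in N k -> int_adj G u v = tau.
  rewrite inE => /andP[h0 /eqP cv]; have := a1 u v; rewrite /tau -cv.
  case: eqP => [E|E] h.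
    have [//|E'] : int_adj G u v = 1 \/ int_adj G u v = -1 by lia.
    by have := cn _ _ E'; rewrite E eqxx.
  have [E'|//] : int_adj G u v = 1 \/ int_adj G u v = -1 by lia.
  by case: E; exact: cp.
have tau2 : tau%:~R * tau%:~R = 1 :> R by rewrite /tau; case: eqP => _; rewrite ?mulr1 ?rmorphN1 ?mulrNN ?mulr1.
pose x v : R := (v == u)%:R * (tau%:~R * lam) + (v \in N k)%:R.
have m_ : \sum_v ((v \in N k)%:R : R) = #|N k|%:R.
  by have := @sum_ind R _ (N k) 1; rewrite mulr1 => <-; apply: eq_bigr => v _; rewrite mulr1.
have sx : \sum_v x v ^+ 2 = lam ^+ 2 + #|N k|%:R.
  rewrite -m_ (bigD1 u) //= [in RHS](bigD1 u) //= /x eqxx (negbTE uN) addr0 mul1r add0r.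
  rewrite exprMn expr2 tau2 mul1r; congr (_ + _); apply: eq_bigr => v /negbTE ->.
  by rewrite mul0r add0r; case: (_ \in _); rewrite ?expr1n ?expr0n.
have ax : 2 * lam * #|N k|%:R <= adj_form (int_adj G) x x.
  have e : adj_form (int_adj G) x x = 2 * lam * #|N k|%:R
     + \sum_v \sum_w (int_adj G v w)%:~R * (v \in N k)%:R * (w \in N k)%:R.
    pose g v w := (int_adj G v w)%:~R * (v \in N k)%:R * (w \in N k)%:R : R.
    transitivity (\sum_v ((v == u)%:R * (lam * #|N k|%:R) + ((v \in N k)%:R * lam + \sum_w g v w))).
      apply: eq_bigr => v _; rewrite (bigD1 u) //= [X in _ = _ + (_ + X)](bigD1 u) //=.
      rewrite {2}/x eqxx (negbTE uN) addr0 mul1r [g v u]/g (negbTE uN) mulr0 add0r.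
      have [->|vu] := eqVneq v u.
        rewrite a0 mul0r mul0r add0r (negbTE uN) mul0r add0r mul1r.
        rewrite [X in _ = _ + X]big1 ?addr0; last by move=> w _; rewrite /g (negbTE uN) mulr0 mul0r.
        rewrite -m_ [in RHS](bigD1 u) //= (negbTE uN) add0r mulr_sumr; apply: eq_bigr => w wu.
        rewrite /x eqxx (negbTE uN) addr0 mul1r (negbTE wu) mul0r add0r.
        case: (boolP (w \in N k)) => wN; last by rewrite !mulr0.
        by rewrite (hN w wN) mulrA tau2 mul1r.
      rewrite mul0r add0r /x (negbTE vu) mul0r add0r; congr (_ + _).
        case: (boolP (v \in N k)) => vN; last by rewrite mulr0 !mul0r.
        by rewrite as_ (hN v vN) mulr1 mulrA tau2.
      by apply: eq_bigr => w /negbTE wu; rewrite wu mul0r add0r.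
    rewrite big_split big_split /= -!mulr_suml m_ (bigD1 u) //= eqxx big1 ?addr0; last by move=> v /negbTE ->.
    by rewrite mul1r addrA; congr (_ + _); ring.
  rewrite e lerDl sumr_ge0 // => v _; rewrite sumr_ge0 // => w _.
  case: (boolP (v \in N k)) => vN; last by rewrite mulr0 mul0r.
  case: (boolP (w \in N k)) => wN; last by rewrite mulr0.
  rewrite !mulr1 ler0z; move: vN wN; rewrite !inE => /andP[_ /eqP cv] /andP[_ /eqP cw].
  have := cn v w; rewrite cv cw eqxx; have := a1 v w; case: (int_adj G v w) => // i.
  by case: i => [|i] h1 h2; [have := h2 erefl|move: h1].
have := hs x ltac:(by move=> v; rewrite inE); rewrite sx => h.
have h2 : #|N k|%:R <= lam ^+ 2 by rewrite -(ler_pM2l lam0); lra.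
by rewrite -(ler_nat R); apply: le_trans h2 (ltW (archi_boundP _)); exact: sqr_ge0.
Qed.

End Admissible.

Section Attained.
Variable R : realType.

Lemma psd_kernel n (X : 'M[R]_n) (z : 'rV[R]_n) : X^T = X -> psd X ->
  (z *m X *m z^T) 0 0 = 0 -> z *m X = 0.
Proof.
move=> hX pX; have [B ->] := psd_factor hX pX (rank_leq_row _).
have -> : z *m (B *m B^T) *m z^T = (z *m B) *m (z *m B)^T by rewrite trmx_mul !mulmxA.
move=> h; suff : z *m B = 0 by rewrite mulmxA => ->; rewrite mul0mx.
by apply/eqP; apply: contraT => /quad_id_gt0; rewrite h ltxx.
Qed.

(* After switching the second colour class all edges are positive, so this is
   the simplicity of the Perron eigenvalue. *)
Lemma mult_two_colors n (G : signed_graph n) p (l : R) : (p <= 2)%N -> colorable G p ->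
  is_largest_eigenvalue G l -> connected_on (int_adj G) [set: 'I_n] -> (mult l G <= 1)%N.
Proof.
move=> p2 /colored_signs[c [cn cp]] hl hcon.
have hs := largest_eigenvalue_spec_le hl; have [as_ a0 a1] := int_adj_signed G.
pose s u : R := if val (c u) == 0%N then 1 else -1.
have ss u : s u * s u = 1 by rewrite /s; case: ifP; rewrite ?mulr1 ?mulrNN ?mulr1.
have sa u v : (int_adj G u v)%:~R * s u * s v = `|(int_adj G u v)%:~R| :> R.
  have [->|[E|E]] : int_adj G u v = 0 \/ int_adj G u v = 1 \/ int_adj G u v = -1.
      by have := a1 u v; lia.
    by rewrite !mul0r normr0.
    by rewrite E mul1r {1}/s (cp _ _ E) -/(s v) ss normr1.
  rewrite E rmorphN1 normrN1 /s; have := cn _ _ E; rewrite -val_eqE /=.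
  have := ltn_ord (c u); have := ltn_ord (c v).
  move: (val (c u)) (val (c v)) => x y hx hy xy; do 2 case: eqP => ?; rewrite ?mulr1 ?mulrN1 ?mulrNN ?mulr1 ?opprK //; lia.
have nz (z : 'rV[R]_n) u : (z <= eigenspace (signed_adj R G) l)%MS -> z 0 u = 0 -> z = 0.
  move=> /eigenspaceP hz zu.
  pose w : 'rV[R]_n := \row_i (s i * `|z 0 i|).
  have zz : adj_form (int_adj G) (z 0) (z 0) = l * \sum_i z 0 i ^+ 2.
    by rewrite -adj_form_mx hz -scalemxAl mxE quad_id.
  have ww : \sum_i w 0 i ^+ 2 = \sum_i z 0 i ^+ 2.
    by apply: eq_bigr => i _; rewrite mxE exprMn expr2 ss mul1r real_normK // num_real.
  have aw : adj_form (int_adj G) (z 0) (z 0) <= adj_form (int_adj G) (w 0) (w 0).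
    apply: ler_sum => i _; apply: ler_sum => j _; rewrite !mxE.
    have -> : (int_adj G i j)%:~R * (s i * `|z 0 i|) * (s j * `|z 0 j|)
      = ((int_adj G i j)%:~R * s i * s j) * `|z 0 i| * `|z 0 j| by ring.
    by rewrite sa -!normrM ler_norm.
  have pX := (psd_spec G l).1 hs.
  have hX : (l%:M - signed_adj R G)^T = l%:M - signed_adj R G.
    by rewrite linearB /= tr_scalar_mx signed_adj_sym.
  have /(psd_kernel hX pX) : (w *m (l%:M - signed_adj R G) *m w^T) 0 0 = 0.
    apply/eqP; rewrite eq_le pX andbT quad_spec ww -zz subr_le0 //.
  rewrite mulmxBr => wX.
  have hw j : \sum_i w 0 i * (int_adj G i j)%:~R = l * w 0 j.
    have := congr1 (fun y : 'rV_n => y 0 j) wX; rewrite [RHS]mxE subE mul_mx_scalar mxE => /eqP.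
    rewrite subr_eq0 => /eqP ->; rewrite mxE; apply: eq_bigr => i _; by rewrite signed_adjE.
  pose X := [set i | z 0 i == 0].
  have [XT|XT] := eqVneq X [set: 'I_n].
    by apply/rowP => i; rewrite mxE; apply/eqP; have := in_setT i; rewrite -XT inE.
  have X0 : X != set0 by apply/set0Pn; exists u; rewrite inE zu.
  have [i [j [iX jX aji]]] := hcon X (subsetT _) X0 XT; exfalso.
  have zi : z 0 i = 0 by move: iX; rewrite inE => /eqP.
  have zj : z 0 j != 0 by move: jX; rewrite !inE andbT.
  have : \sum_k `|(int_adj G k i)%:~R| * `|z 0 k| = 0 :> R.
    transitivity (s i * \sum_k w 0 k * (int_adj G k i)%:~R); last first.
      by rewrite hw mxE zi normr0 !mulr0.
    by rewrite mulr_sumr; apply: eq_bigr => k _; rewrite -sa mxE; ring.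
  move/eqP; rewrite psumr_eq0 => [/allP/(_ j (mem_index_enum _))|k _]; last by rewrite mulr_ge0.
  by rewrite mulf_eq0 !normr_eq0 (negbTE zj) orbF intr_eq0 (negbTE aji).
have [n0|n0] := posnP n; first by apply: leq_trans (rank_leq_col _) _; rewrite n0.
pose u0 := Ordinal n0; rewrite /mult; set E := eigenspace _ _.
rewrite -(mxrank_mul_ker E (delta_mx u0 0 : 'M_(n, 1))).
suff -> : (E :&: kermx (delta_mx u0 0 : 'M_(n, 1)))%MS = 0.
  by rewrite mxrank0 addn0; exact: rank_leq_col.
apply/row_matrixP => i; rewrite row0; apply: (nz _ u0).
  by apply: submx_trans (row_sub _ _) (capmxSl _ _).
set z := row i _; have : (z <= kermx (delta_mx u0 0 : 'M_(n, 1)))%MS.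
  by apply: submx_trans (row_sub _ _) (capmxSr _ _).
by move=> /sub_kermxP; rewrite -colE => h; have := congr1 (fun y : 'M_1 => y 0 0) h; rewrite !mxE.
Qed.

(** Rank and nullity: the common kernel of the [k] conditions lies in the eigenspace. *)
Lemma mult_ge (T : finType) (a : T -> T -> int) (ha : signed_symmetric a) (l : R) k
    (b : T -> 'I_k -> R) :
  (forall x : T -> R, (forall j, \sum_u x u * b u j = 0) ->
     forall v, \sum_u x u * (a u v)%:~R = l * x v) ->
  (#|T| <= mult l (restrict [set: T] ha) + k)%N.
Proof.
move=> hb; pose f (i : 'I_#|[set: T]|) := enum_val i.
pose B : 'M[R]_(#|[set: T]|, k) := \matrix_(i, j) b (f i) j.
have sub : (kermx B <= eigenspace (signed_adj R (restrict [set: T] ha)) l)%MS.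
  apply/row_subP => r; set z := row r _.
  have zB : z *m B = 0 by apply/sub_kermxP; exact: row_sub.
  pose x u := z 0 (enum_rank_in (in_setT u) u).
  have xf i : x (f i) = z 0 i by rewrite /x enum_valK_in.
  have sm (F : T -> R) : \sum_u F u = \sum_i F (f i).
    by rewrite (@extend_sum R _ [set: T]) // => u; rewrite inE.
  apply/eigenspaceP/rowP => j; rewrite [RHS]mxE -xf -hb => [|j'].
    by rewrite sm mxE; apply: eq_bigr => i _; rewrite signed_adjE restrictE xf.
  transitivity ((z *m B) 0 j'); last by rewrite zB mxE.
  by rewrite sm [RHS]mxE; apply: eq_bigr => i _; rewrite xf [B _ _]mxE.
have := mxrankS sub; rewrite mxrank_ker -/(mult _ _) => h.
by have := rank_leq_col B; have := cardsT T; lia.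
Qed.

Lemma sum_indM (T : finType) (x : T -> R) v : \sum_u x u * (u == v)%:R = x v.
Proof.
rewrite (bigD1 v) //= eqxx mulr1 big1 ?addr0 // => u /negbTE ->; by rewrite mulr0.
Qed.

(** * The rook graph and the triangle, extremal for eigenvalue 2 *)

Section Rook.
Variable p : nat.
Local Notation T := ('I_p.+1 * 'I_p.+1)%type.

(** Distinct cells of a common line get [-1], all other pairs 0. The order is [p.+1] so that
    ordinals form a group, whose addition table is the Latin square used as colouring. *)
Definition rook (u v : T) : int := 2 * (u == v)%:R - (u.1 == v.1)%:R - (u.2 == v.2)%:R.

Lemma rook_signed : signed_symmetric rook.
Proof.
split=> [u v|u|u v]; rewrite /rook.
- by rewrite (eq_sym u) (eq_sym u.1) (eq_sym u.2).
- by rewrite !eqxx.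
- by rewrite -pair_eqE /=; do 2 case: eqP.
Qed.

Lemma rook_colorable : colorable (restrict [set: T] rook_signed) p.+1.
Proof.
apply: (@restrict_colorable _ _ _ _ _ (fun u : T => u.1 + u.2)) => u v; rewrite /rook -pair_eqE /=.
  case: eqP => [->|h1]; case: eqP => [->|h2] //=; rewrite ?subr0 //.
    by move=> _; apply/negP => /eqP /addrI.
  by move=> _; apply/negP => /eqP /addIr.
by case: eqP => h1; case: eqP => h2.
Qed.

Lemma rook_sum (x : T -> R) v : \sum_u x u * (rook u v)%:~R
  = 2 * x v - \sum_u x u * (u.1 == v.1)%:R - \sum_u x u * (u.2 == v.2)%:R.
Proof.
rewrite -(sum_indM x v) mulr_sumr -!sumrB; apply: eq_bigr => u _.
by rewrite /rook !rmorphB rmorphM !rmorph_nat /=; ring.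
Qed.

(** The form of [2 I - A] is the sum of the squares of the row sums and of the column sums. *)
Lemma rook_spec : spec_le rook (2 : R) [set: T].
Proof.
move=> x _.
have -> : adj_form rook x x = 2 * \sum_u x u ^+ 2 - \sum_i (\sum_u x u * (u.1 == i)%:R) ^+ 2
    - \sum_i (\sum_u x u * (u.2 == i)%:R) ^+ 2.
  have sq (g : T -> 'I_p.+1) : \sum_i (\sum_u x u * (g u == i)%:R) ^+ 2
      = \sum_v x v * \sum_u x u * (g u == g v)%:R.
    under eq_bigr => i _ do rewrite expr2 mulr_sumr.
    rewrite exchange_big; apply: eq_bigr => v _ /=.
    rewrite (bigD1 (g v)) //= eqxx mulr1 [X in _ + X]big1 ?addr0 1?mulrC // => i.
    by rewrite eq_sym => /negbTE ->; rewrite !mulr0.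
  rewrite !sq mulr_sumr -!sumrB /adj_form exchange_big; apply: eq_bigr => v _ /=.
  transitivity (x v * \sum_u x u * (rook u v)%:~R); last by rewrite rook_sum; ring.
  by rewrite mulr_sumr; apply: eq_bigr => u _; ring.
have h (F : 'I_p.+1 -> R) : 0 <= \sum_i F i ^+ 2 by apply: sumr_ge0 => i _; exact: sqr_ge0.
by have := h (fun i => \sum_u x u * (u.1 == i)%:R); have := h (fun i => \sum_u x u * (u.2 == i)%:R); lra.
Qed.

Lemma rook_mult : (p ^ 2 <= mult (2 : R) (restrict [set: T] rook_signed))%N.
Proof.
(* One column is omitted since row and column sums have the same total; [2 p + 1] conditions
   remain. *)
pose b (u : T) (j : 'I_(p.+1 + p)) : R :=
  match split j with inl i => (u.1 == i)%:R | inr i => (u.2 == lift ord0 i)%:R end.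
suff : (#|{: T}| <= mult (2 : R) (restrict [set: T] rook_signed) + (p.+1 + p))%N.
  rewrite card_prod card_ord; nia.
apply: (@mult_ge _ _ rook_signed 2 _ b) => x hx v.
have h1 i : \sum_u x u * (u.1 == i)%:R = 0.
  rewrite -[RHS](hx (lshift p i)); apply: eq_bigr => u _; rewrite /b.
  by rewrite (unsplitK (inl i) : split (lshift p i) = inl i).
have h2 i : \sum_u x u * (u.2 == lift ord0 i)%:R = 0.
  rewrite -[RHS](hx (rshift p.+1 i)); apply: eq_bigr => u _; rewrite /b.
  by rewrite (unsplitK (inr i) : split (rshift p.+1 i) = inr i).
have tot (g : T -> 'I_p.+1) : \sum_i \sum_u x u * (g u == i)%:R = \sum_u x u.
  rewrite exchange_big; apply: eq_bigr => u _ /=.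
  rewrite (bigD1 (g u)) //= eqxx mulr1 big1 ?addr0 // => i; rewrite eq_sym => /negbTE ->; exact: mulr0.
have h3 i : \sum_u x u * (u.2 == i)%:R = 0.
  case: (unliftP ord0 i) => [j ->|->]; first exact: h2.
  have := tot snd; rewrite big_ord_recl [X in _ + X]big1 => [|j _]; last exact: h2.
  by rewrite addr0 => ->; rewrite -(tot fst) big1.
by rewrite rook_sum h1 h3 !subr0.
Qed.
End Rook.

Definition triangle (u v : 'I_3) : int := (u != v)%:R.

Lemma triangle_signed : signed_symmetric triangle.
Proof. by split=> [u v|u|u v]; rewrite /triangle ?eqxx // ?(eq_sym u) //; case: eqP. Qed.

Lemma triangle_sum (x : 'I_3 -> R) v : \sum_u x u * (triangle u v)%:~R = \sum_u x u - x v.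
Proof.
rewrite -(sum_indM x v) -sumrB; apply: eq_bigr => u _.
by rewrite /triangle; case: eqP => _; rewrite ?mulr1 ?mulr0 ?subrr ?subr0.
Qed.

Lemma triangle_admissible p : (0 < p)%N ->
  admissible p (2 : R) (restrict [set: 'I_3] triangle_signed).
Proof.
move=> p0; apply: admissible_of_spec.
- apply: (@restrict_colorable _ _ _ _ _ (fun _ => Ordinal p0)) => // u v.
  by rewrite /triangle; case: eqP.
- apply: induced_spec_le => x _.
  have -> : adj_form triangle x x = (\sum_u x u) ^+ 2 - \sum_u x u ^+ 2.
    rewrite expr2 mulr_suml -sumrB /adj_form exchange_big; apply: eq_bigr => v _ /=.
    transitivity (x v * \sum_u x u * (triangle u v)%:~R); last by rewrite triangle_sum; ring.
    by rewrite mulr_sumr; apply: eq_bigr => u _; ring.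
  by have := sq_sum_le x; lra.
pose b (u : 'I_3) (j : 'I_2) : R := (u == ord0)%:R - (u == lift ord0 j)%:R.
have : (#|'I_3| <= mult (2 : R) (restrict [set: 'I_3] triangle_signed) + 2)%N.
  apply: (@mult_ge _ _ triangle_signed 2 _ b) => x hx v.
  have h j : x ord0 = x (lift ord0 j).
    have := hx j; under eq_bigr => u _ do rewrite /b mulrBr.
    by rewrite sumrB !sum_indM => /eqP; rewrite subr_eq0 => /eqP.
  have xc u : x u = x ord0 by case: (unliftP ord0 u) => [j ->|->].
  rewrite triangle_sum; under eq_bigr => u _ do rewrite xc.
  by rewrite sumr_const card_ord (xc v) -mulr_natl; lra.
by rewrite card_ord; lia.
Qed.
End Attained.

(** With [p = q.+1], the product [(2 p - 1) (2 p + 1) = 4 p ^ 2 - 1] leaves [D / 4] to absorb the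
    [p ^ 2] caused by the [+1] of the rank bound; hence the condition [4 p ^ 2 <= D]. *)
Lemma root_arith n m D q : (4 * n <= (2 * q.+1 + 1) * D)%N -> (m + D <= n.+1)%N ->
  (4 * q.+1 ^ 2 <= D)%N -> (q.+1 ^ 2 * m <= n * q ^ 2)%N.
Proof.
move=> h1 h2 h3; rewrite -(leq_pmul2l (isT : (0 < 4)%N)).
have h4 : (q.+1 ^ 2 * (m + D) <= q.+1 ^ 2 * n.+1)%N by rewrite leq_mul2l h2 orbT.
have h5 : ((2 * q + 1) * (4 * n) <= (2 * q + 1) * ((2 * q.+1 + 1) * D))%N.
  by rewrite leq_mul2l h1 orbT.
move: h3 h4 h5; rewrite -!mulnn; lia.
Qed.

Lemma ratio_trans a b c d e f : (0 < d)%N ->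
  (a * d <= c * b)%N -> (c * f <= e * d)%N -> (a * f <= e * b)%N.
Proof.
move=> d0 h1 h2; rewrite -(leq_pmul2l d0).
have -> : (d * (a * f) = a * d * f)%N by lia.
apply: (@leq_trans (c * b * f)); first by rewrite leq_mul2r h1 orbT.
have -> : (c * b * f = b * (c * f))%N by lia.
have -> : (d * (e * b) = b * (e * d))%N by lia.
by rewrite leq_mul2l h2 orbT.
Qed.

(** * Minimising the ratio of order to multiplicity *)

Section Minimum.
Variable R : realType.

(* Vectors orthogonal to every root are constant on the spanning tree, so the
   roots have rank at least [dim r - 1]. *)
Lemma mult_root n (G : signed_graph n) r : represents (int_adj G) r [set: 'I_n] ->
  (mult (2 : R) G + dim r <= n.+1)%N.
Proof.
move=> hr; have [d0 hP _ ht] := hr.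
pose C : 'M[R]_(n, dim r) := \matrix_(u, j) (coord r u j)%:~R.
have sub : (eigenspace (signed_adj R G) 2 <= kermx C)%MS.
  apply/row_subP => i; set z := row i _.
  have /eigenspaceP hz : (z <= eigenspace (signed_adj R G) 2)%MS by exact: row_sub.
  have := rep_form (x := z 0) hr; rewrite -adj_form_mx hz -scalemxAl mxE quad_id subrr.
  move=> /(_ (fun u h => ltac:(by rewrite inE in h)))/eqP.
  rewrite psumr_eq0 => [/allP h|j _]; last exact: sqr_ge0.
  apply/sub_kermxP/rowP => j; rewrite [RHS]mxE; apply/eqP; rewrite -sqrf_eq0.
  have := h j (mem_index_enum _); rewrite mxE.
  by congr (_ ^+ 2 == _); apply: eq_bigr => u _; rewrite [C _ _]mxE.
have k1 : (\rank (kermx C^T) <= 1)%N.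
  apply: leq_trans (rank_leq_row (const_mx 1 : 'rV[R]_(dim r))); apply: mxrankS.
  apply/row_subP => i; set y := row i _.
  have yC : y *m C^T = 0 by apply/sub_kermxP; exact: row_sub.
  pose f j := if insub j is Some o then y 0 o else 0 : R.
  have fE (j : 'I_(dim r)) : f j = y 0 j by rewrite /f valK.
  have hu u : (sgn1 r u)%:~R * f (end1 r u) + (sgn2 r u)%:~R * f (end2 r u) = 0 :> R.
    have [h1 h2 _ _ _] := hP u (in_setT u); rewrite -(coord_sum f h1 h2).
    transitivity ((y *m C^T) 0 u); last by rewrite yC mxE.
    by rewrite [RHS]mxE; apply: eq_bigr => j _; rewrite fE [C^T _ _]mxE [C _ _]mxE mulrC.
  have fc j : (j < dim r)%N -> f j = f 0%N.
    elim/ltn_ind: j => j IH jd; have [->//|j0] := posnP j.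
    have [_ e2 e1 es] := ht j ltac:(by rewrite j0).
    rewrite -(IH _ e1 (ltn_trans e1 jd)).
    have := hu (tree r j); rewrite e2 es rmorphN mulNr => /eqP; rewrite subr_eq0 => /eqP.
    have [_ _ _ s1 _] := hP (tree r j) (in_setT _).
    by move/mulfI => -> //; rewrite intr_eq0 -normr_eq0 s1.
  suff -> : y = f 0%N *: const_mx 1 by exact: scalemx_sub.
  by apply/rowP => j; rewrite [RHS]mxE [X in _ * X]mxE mulr1 -(fc j) // fE.
have hm : (mult (2 : R) G <= \rank (kermx C))%N by exact: mxrankS sub.
move: k1 hm; rewrite !mxrank_ker mxrank_tr; set m := mult _ _.
have := rank_leq_row C; have := rank_leq_col C; lia.
Qed.

Lemma mult_root_colored n (G : signed_graph n) r p : (3 <= p)%N -> colorable G p ->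
  represents (int_adj G) r [set: 'I_n] -> (4 * p ^ 2 <= dim r)%N ->
  (p ^ 2 * mult (2 : R) G <= n * (p.-1) ^ 2)%N.
Proof.
move=> p3 /colored_signs[c [cn cp]] hr hd.
have := root_count R (int_adj_signed G) hr cn cp p3; rewrite card_ord => h1.
have := mult_root hr; set m := mult _ _ => h2.
have {}h1 : (4 * n <= (2 * p + 1) * dim r)%N.
  rewrite -(ler_nat R) !natrM natrD natrM; lra.
move: h1 h2 hd p3; case: p c cn cp => [//|q] c _ _ h1 h2 hd p3 /=.
exact: root_arith h1 h2 hd.
Qed.

Section Bounded.
Variables (p : nat) (t lam : R).
Hypotheses (p0 : (0 < p)%N) (lam0 : 0 < lam) (t1 : 1 < t) (t6 : t ^+ 6 <= t ^+ 2 + 1)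
  (lt : lam < t + t^-1).

Lemma bounded_admissible : exists M, forall n (G : signed_graph n), admissible p lam G ->
  exists n' (G' : signed_graph n'), [/\ admissible p lam G', (n' <= M)%N &
     (n' * mult lam G <= n * mult lam G')%N].
Proof.
have [M0 hM] := large_connected (p * Num.bound (lam ^+ 2)) (4 * p ^ 2) t1 t6 lt.
(* 3 and [p ^ 2] are the orders of the triangle and of the rook graph. *)
exists (maxn M0 (maxn 3 (p ^ 2))) => n G /connected_admissible[n' [G' [hG' hcon hle]]].
have [nM|nM] := leqP n' (maxn M0 (maxn 3 (p ^ 2))); first by exists n', G'.
have [n0 hc hl] := hG'.
have hs := largest_eigenvalue_spec_le hl.
have [|l2 [r hr hd]] := hM _ _ _ (int_adj_signed G') (colored_degree lam0 hG') hcon hs.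
  by rewrite cardsT card_ord; lia.
have lam2 : lam = 2.
  apply/eqP; rewrite eq_le l2 andbT.
  have [/eigenvalueP[z hz z0] _] := hl.
  have s2 : spec_le (int_adj G') (2 : R) [set: 'I_n'] by exact: rep_spec_le2 hr.
  have := s2 (z 0); rewrite -adj_form_mx -quad_id hz -scalemxAl mxE.
  move=> /(_ (fun u h => ltac:(by rewrite inE in h))).
  by rewrite ler_pM2r // quad_id_gt0.
move: hle hG' hl; rewrite lam2 => hle hG' hl.
have m'0 := mult_gt0 hl.
have tr n1 (G1 : signed_graph n1) : (n1 * mult (2 : R) G' <= n' * mult (2 : R) G1)%N ->
    (n1 * mult (2 : R) G <= n * mult (2 : R) G1)%N.
  by move=> h; apply: ratio_trans m'0 h hle.
have [p2|p2] := leqP p 2.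
  exists #|[set: 'I_3]|, (restrict [set: 'I_3] triangle_signed); split.
  - exact: triangle_admissible.
  - by rewrite cardsT card_ord; lia.
  apply: tr; have := mult_two_colors p2 hc hl hcon.
  have := mult_gt0 (let: And3 _ _ h := triangle_admissible R p0 in h).
  move: (mult _ (restrict _ triangle_signed)) => m1 m10 m'1; rewrite cardsT card_ord.
  by apply: (@leq_trans (n' * 1)%N); [lia|rewrite leq_mul2l m10 orbT].
have [q hq] : exists q, p = q.+1 by case: (p) p0 => // q; exists q.
have hm := mult_root_colored p2 hc hr hd.
have hk := rook_mult R q.
exists #|[set: 'I_q.+1 * 'I_q.+1]|, (restrict [set: 'I_q.+1 * 'I_q.+1] (rook_signed q)); split.
- apply: admissible_of_spec.
  + by rewrite hq; exact: rook_colorable.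
  + by apply: induced_spec_le; exact: rook_spec.
  + by apply: leq_trans hk; rewrite expn_gt0; lia.
- by rewrite cardsT card_prod card_ord hq -mulnn; lia.
apply: tr; move: (mult _ (restrict _ (rook_signed q))) hk => m1 hk.
rewrite cardsT card_prod card_ord mulnn -hq; apply: leq_trans hm _.
by rewrite hq leq_mul2l hk orbT.
Qed.

(** For orders up to [M] every multiplicity divides [M!], so the ratios scaled by [M!] are natural
    numbers and have a least element. *)
Lemma minimal_admissible : (exists n (G : signed_graph n), admissible p lam G) ->
  exists n0 (G0 : signed_graph n0), admissible p lam G0 /\
    forall n (G : signed_graph n), admissible p lam G ->
      (n0 * mult lam G <= n * mult lam G0)%N.
Proof.
move=> [n1 [G1 hG1]]; have [M hM] := bounded_admissible.
pose P k := exists n (G : signed_graph n), [/\ admissible p lam G, (n <= M)%N &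
  k = (n * (M`! %/ mult lam G))%N].
have exP : exists k, `[< P k >].
  have [n' [G' [h1 h2 _]]] := hM _ _ hG1.
  by exists (n' * (M`! %/ mult lam G'))%N; apply/asboolP; exists n', G'.
have [k /asboolP[n0 [G0 [h0 n0M ek]]] hk] := ex_minnP exP.
exists n0, G0; split=> // n G /hM[n' [G' [h' n'M hle]]].
have dv m (H : signed_graph m) : admissible p lam H -> (m <= M)%N ->
    (0 < mult lam H)%N /\ (M`! %/ mult lam H * mult lam H = M`!)%N.
  move=> [_ _ /mult_gt0 hm] mM; split=> //; apply: divnK; apply: dvdn_fact.
  by rewrite hm (leq_trans _ mM) // rank_leq_col.
have [m0 e0] := dv _ _ h0 n0M; have [m' e'] := dv _ _ h' n'M.
have : `[< P (n' * (M`! %/ mult lam G'))%N >] by apply/asboolP; exists n', G'.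
move=> /hk; rewrite ek => hmin.
have f0 := fact_gt0 M.
have h1 : (n0 * mult lam G' <= n' * mult lam G0)%N.
  rewrite -(leq_pmul2r f0); move: hmin e0 e'; move: (_ %/ _)%N (_ %/ _)%N => q' q0 hmin e0 e'.
  have -> : (n0 * mult lam G' * M`! = n0 * q0 * (mult lam G0 * mult lam G'))%N by rewrite -e0; lia.
  have -> : (n' * mult lam G0 * M`! = n' * q' * (mult lam G0 * mult lam G'))%N by rewrite -e'; lia.
  exact: leq_mul.
exact: ratio_trans m' h1 hle.
Qed.
End Bounded.

(** The diagonal of [A] is zero, so [A] is not [l I]. This keeps [n - mult l G], the denominator of
    the slope, positive. *)
Lemma mult_lt n (G : signed_graph n) (l : R) : 0 < l -> (0 < n)%N -> (mult l G < n)%N.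
Proof.
move=> l0 n0; rewrite ltn_neqAle rank_leq_col andbT; apply/negP => h.
have full : row_full (eigenspace (signed_adj R G) l) by [].
pose z : 'rV[R]_n := delta_mx 0 (Ordinal n0).
have /eigenspaceP hz : (z <= eigenspace (signed_adj R G) l)%MS by exact: submx_full.
have := congr1 (fun y : 'rV_n => y 0 (Ordinal n0)) hz.
rewrite /z -rowE mxE signed_adjE; have [_ -> _] := int_adj_signed G.
by rewrite !mxE !eqxx mulr1 => /esym /eqP; rewrite gt_eqF.
Qed.
End Minimum.

(** * Growth of the code size *)

Lemma upper_arith n0 m0 e n m N C d' : n0 = (e + m0)%N -> (N <= n + C)%N -> (n <= m + d')%N ->
  (n0 * m <= n * m0)%N -> (N * e <= n0 * d' + C * e)%N.
Proof.
move=> E h1 h2 h3; have := leq_mul h1 (leqnn e); have := leq_mul h2 (leqnn n0).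
rewrite mulnDl !mulnDl [(n * n0)%N]mulnC {1}E; lia.
Qed.

Lemma lower_arith n0 p d e q r : (p <= d)%N -> (d - p)%N = (q * e + r)%N -> (r < e)%N ->
  (n0 * d <= q * n0 * e + n0 * (p + e))%N.
Proof.
move=> h1 h2 h3; rewrite -(subnK h1) h2 [(q * n0)%N]mulnC -mulnA -mulnDr leq_mul2l.
by rewrite -addnA leq_add2l addnC leq_add2l (ltnW h3) orbT.
Qed.

Section Asymptotics.
Variables (R : realType) (alpha beta t : R) (p : nat).
Local Notation lam := ((1 - alpha) / (alpha - beta)).
Local Notation gam := (alpha / (alpha - beta)).

(** The growth [a * d / e + O(1)] with its denominator cleared, so that the counting stays in
    natural numbers. *)
Definition linear_code_growth (a e : nat) := exists K : nat, forall d : nat,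
  (forall N (v : 'I_N -> 'rV[R]_d), two_distance_code alpha beta v -> N * e <= a * d + K)%N /\
  exists N (v : 'I_N -> 'rV[R]_d), two_distance_code alpha beta v /\ (a * d <= N * e + K)%N.

Lemma max_code_growth a e : (0 < e)%N -> linear_code_growth a e ->
  exists N : nat -> nat, (forall d, is_max_code_size alpha beta d (N d)) /\
    exists C : R, forall d, `|(N d)%:R - a%:R * d%:R / e%:R| <= C.
Proof.
move=> e0 [K hK].
pose P d N := `[< exists v : 'I_N -> 'rV[R]_d, two_distance_code alpha beta v >].
have exP d : exists N, P d N.
  by have [_ [N [v [hv _]]]] := hK d; exists N; apply/asboolP; exists v.
have bP d N : P d N -> (N <= a * d + K)%N.
  by move=> /asboolP[v hv]; have := (hK d).1 N v hv; nia.
pose F d := ex_maxn (exP d) (bP d).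
have hF d : is_max_code_size alpha beta d (F d).
  rewrite /F; case: ex_maxnP => N /asboolP h hmax; split=> // n v hv.
  by apply: hmax; apply/asboolP; exists v.
exists F; split=> //; exists K%:R => d.
have [[v hv] hmax] := hF d; have [h1 [N [w [hw h2]]]] := hK d.
have {}h1 := h1 _ _ hv; have {}h2 := leq_trans h2 (leq_add (leq_mul (hmax _ _ hw) (leqnn e)) (leqnn K)).
have er : 0 < e%:R :> R by rewrite ltr0n.
have e1 : 1 <= e%:R :> R by rewrite ler1n.
rewrite -(ler_pM2r er) -[X in _ * X <= _](gtr0_norm er) -normrM mulrBl divfK ?gt_eqF //.
apply: (@le_trans _ _ K%:R); last by rewrite ler_peMr.
move: h1 h2; rewrite -(ler_nat R) -(ler_nat R (a * d)) !natrD !natrM ler_norml => h1 h2.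
by apply/andP; split; lra.
Qed.

Hypotheses (halpha0 : 0 <= alpha) (halpha1 : alpha < 1) (hbeta : beta < 0) (p0 : (0 < p)%N)
  (hp : p%:R * (1 - gam) <= 1) (hp1 : 1 < p.+1%:R * (1 - gam))
  (t1 : 1 < t) (t6 : t ^+ 6 <= t ^+ 2 + 1) (hlam : lam < t + t^-1).

(** For [k = n0 / m0] the slope [k / (k - 1)] is [n0 / (n0 - m0)]. Minimality of [G0] bounds the
    multiplicity in the graph of any code; conversely each copy of [G0] uses [n0 - m0] dimensions
    for [n0] vectors. *)
Lemma growth_admissible n0 (G0 : signed_graph n0) : admissible p lam G0 ->
  (forall n (G : signed_graph n), admissible p lam G -> (n0 * mult lam G <= n * mult lam G0)%N) ->
  linear_code_growth n0 (n0 - mult lam G0).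
Proof.
move=> [n00 c0 l0] hmin.
have lam0 : 0 < lam by exact: lam_gt0.
have := mult_lt G0 lam0 n00; have := mult_gt0 l0; set m0 := mult lam G0 => m00 m0n.
have [C hC] := code_signed_graph halpha0 halpha1 hbeta p0 hp1 t1 t6 hlam.
pose e := (n0 - m0)%N; have e0 : (0 < e)%N by rewrite subn_gt0.
exists (n0 * p + (C * e + n0 * (p + e)))%N => d; split.
  move=> N v /hC[n [G [NC hc hm hl]]]; apply: (@leq_trans (n0 * (d + p) + C * e)%N); last first.
    by rewrite mulnDr -!addnA !leq_add2l leq_addr.
  apply: upper_arith (esym (subnK (ltnW m0n))) NC hm _.
  have [m_0|m_0] := posnP (mult lam G); first by rewrite m_0 muln0.
  apply: hmin; split=> //; [by apply: leq_trans m_0 (rank_leq_col _)|exact: hl].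
(* For [d < p] the constant absorbs everything and any code will do. *)
have [pd|pd] := leqP p d; last first.
  have [v hv] := simplex_code beta halpha0 halpha1 d; exists d, v; split=> //.
  have : (n0 * d <= n0 * p)%N by rewrite leq_mul2l ltnW // orbT.
  by move/leq_trans; apply; exact: leq_trans (leq_addr _ _) (leq_addl _ _).
have [|v hv] := @code_of_graph R alpha beta halpha0 halpha1 hbeta p n0 G0 ((d - p) %/ e) d hp c0 l0.
  by rewrite -/m0 -/e addnC -leq_subRL // leq_trunc_div.
exists ((d - p) %/ e * n0)%N, v; split=> //; rewrite -/e.
have := lower_arith n0 pd (divn_eq (d - p) e) (ltn_pmod (d - p) e0).
by move/leq_trans; apply; rewrite leq_add2l; apply: leq_trans (leq_addl _ _) (leq_addl _ _).
Qed.

(** Then [lam] is not an eigenvalue of the graph of a code, and the rank bound alone gives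
    [N <= d + p + C]. *)
Lemma growth_no_admissible : ~ (exists n (G : signed_graph n), admissible p lam G) ->
  linear_code_growth 1 1.
Proof.
move=> hno; have [C hC] := code_signed_graph halpha0 halpha1 hbeta p0 hp1 t1 t6 hlam.
exists (p + C)%N => d; split; last first.
  have [v hv] := simplex_code beta halpha0 halpha1 d; exists d, v; split=> //; lia.
move=> N v /hC[n [G [NC hc hm hl]]].
have [m_0|m_0] := posnP (mult lam G); first by lia.
case: hno; exists n, G; split=> //; [by apply: leq_trans m_0 (rank_leq_col _)|exact: hl].
Qed.

Lemma colorable_widen n (G : signed_graph n) q q' : (q <= q')%N -> colorable G q -> colorable G q'.
Proof.
move=> hq /existsP[c hc]; apply/existsP; exists [ffun i => widen_ord hq (c i)].
apply/forallP => i; apply/forallP => j; rewrite !ffunE; exact: (forallP (forallP hc i) j).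
Qed.
End Asymptotics.

(* The invariant [k_] and the asymptotic formula *)
From mathcomp Require Import all_classical all_reals all_analysis.
Section Invariant.
Variables (R : realType) (p : nat) (lambda : R).

Lemma chromatic_number_le n (G : signed_graph n) :
  (chromatic_number R G <= p%:R%:E)%E = colorable G p.
Proof.
rewrite /chromatic_number; case: pselect => [ex|nex]; last first.
  by rewrite leye_eq; apply/esym/negbTE/negP => h; apply: nex; exists p.
rewrite lee_fin ler_nat; case: ex_minnP => m hm hmin; apply/idP/idP => h.
  exact: colorable_widen hm.
exact: hmin.
Qed.

Lemma k_no_admissible : ~ (exists n (G : signed_graph n), admissible p lambda G) ->
  k_ p lambda = +oo%E.
Proof.
move=> h; rewrite /k_ -[RHS](ereal_inf0 R); congr ereal_inf.
apply/seteqP; split=> // x [n [G [n0 hc hl _]]]; exfalso; apply: h.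
by exists n, G; split=> //; rewrite -chromatic_number_le.
Qed.

Lemma k_minimal n0 (G0 : signed_graph n0) : admissible p lambda G0 ->
  (forall n (G : signed_graph n), admissible p lambda G ->
     (n0 * mult lambda G <= n * mult lambda G0)%N) ->
  k_ p lambda = (n0%:R / (mult lambda G0)%:R)%:E.
Proof.
move=> [n00 hc0 hl0] hmin; apply/eqP; rewrite eq_le; apply/andP; split.
  by apply: ereal_inf_lbound; exists n0, G0; rewrite chromatic_number_le.
apply: le_ereal_inf_tmp => x [n [G [n1 hc hl ->]]].
rewrite chromatic_number_le in hc; rewrite lee_fin.
have m0 := mult_gt0 hl0; have m1 := mult_gt0 hl.
rewrite ler_pdivrMr ?ltr0n // mulrAC ler_pdivlMr ?ltr0n // -!natrM ler_nat.
by apply: hmin.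
Qed.
End Invariant.

(** Between 0 and 1 one has [rho ^+ 3 <= rho], against the equation. For negative [rho] the
    nonnegative product [(rho + 1) ^+ 2 * (1 - rho)] reduces to [- rho ^+ 2]. *)
Lemma cubic_root_gt1 (R : realType) (rho : R) : rho ^+ 3 = rho + 1 -> 1 < rho.
Proof.
move=> h; rewrite ltNge; apply/negP => h1.
have [h0|h0] := leP 0 rho.
  have : rho * (1 - rho) * (1 + rho) >= 0 by rewrite !mulr_ge0 //; lra.
  rewrite (_ : rho * (1 - rho) * (1 + rho) = rho - rho ^+ 3); last by ring.
  rewrite h; lra.
have : 0 <= (rho + 1) ^+ 2 * (1 - rho) by rewrite mulr_ge0 ?sqr_ge0 //; lra.
nra.
Qed.

Theorem corollary4p6 (R : realType) (rho lambda_star alpha beta lambda : R) (p : nat)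
  (hrho : rho ^+ 3 = rho + 1)
  (hlambda_star : lambda_star = rho `^ (1 / 2) + rho `^ (- (1 / 2)))
  (hbeta1 : -1 <= beta) (hbeta0 : beta < 0)
  (halpha0 : 0 <= alpha) (halpha1 : alpha < 1)
  (hlambda : lambda = (1 - alpha) / (alpha - beta))
  (hp : p%:Z = Num.floor (- alpha / beta) + 1)
  (hlt : lambda < lambda_star) :
  exists N : nat -> nat,
    (forall d : nat, (0 < d)%N -> is_max_code_size alpha beta d (N d)) /\
    exists C : R, forall d : nat, (0 < d)%N ->
      `| (N d)%:R - (if (k_ p lambda < +oo)%E
                     then fine (k_ p lambda) * d%:R / (fine (k_ p lambda) - 1)
                     else d%:R) | <= C.
Proof.
have rho1 := cubic_root_gt1 hrho; have rho0 : 0 < rho by lra.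
(* Here [t ^+ 6 = rho ^+ 3 = rho + 1 = t ^+ 2 + 1], and [lambda_star] is [t + t^-1]. *)
pose t := rho `^ (1 / 2).
have t2 : t ^+ 2 = rho.
  by rewrite -powR_mulrn ?powR_ge0 // /t -powRrM mul1r mulVf ?pnatr_eq0 // powRr1 // ltW.
have t0 : 0 < t by exact: powR_gt0.
have t1 : 1 < t.
  by rewrite -(ltr_pXn2r (n := 2)) ?nnegrE ?ltW ?ltr01 // t2 expr1n.
have t6 : t ^+ 6 <= t ^+ 2 + 1 by rewrite (exprM t 2 3) t2 hrho.
have lt : (1 - alpha) / (alpha - beta) < t + t^-1.
  by rewrite -hlambda; move: hlt; rewrite hlambda_star powRN.
have ab : 0 < alpha - beta by lra.
have /andP[f1 f2] := floor_itv (- alpha / beta).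
have pE : (p%:R : R) = (Num.floor (- alpha / beta))%:~R + 1 by rewrite -[LHS]/((p%:Z)%:~R) hp intrD.
have q0 : 0 <= - alpha / beta by rewrite mulNr -mulrN -invrN divr_ge0 // oppr_ge0 ltW.
have p0 : (0 < p)%N by rewrite -(ltr_nat R); move: f2; rewrite intrD -pE /=; lra.
have gE : 1 - alpha / (alpha - beta) = - beta / (alpha - beta) by field; rewrite gt_eqF.
have qE : (- alpha / beta) * - beta = alpha by field; rewrite lt_eqF.
(* With [gam = alpha / (alpha - beta)], the inverse of [1 - gam] is [1 - alpha / beta], so [p] is
   the largest integer with [p (1 - gam) <= 1]. *)
have hp0 : p%:R * (1 - alpha / (alpha - beta)) <= 1.
  rewrite gE mulrA ler_pdivrMr // mul1r.
  have : (p%:R - 1 - - alpha / beta) * - beta <= 0 by rewrite mulr_le0_ge0 //; lra.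
  by rewrite mulrBl qE; lra.
have hp1 : 1 < p.+1%:R * (1 - alpha / (alpha - beta)).
  rewrite gE mulrA ltr_pdivlMr // mul1r -natr1.
  have : 0 < (p%:R - - alpha / beta) * - beta.
    by rewrite mulr_gt0 //; move: f2; rewrite ?intrD -?pE /=; lra.
  by rewrite mulrBl qE; lra.
have [hex|hno] := EM (exists n (G : signed_graph n), admissible p lambda G); last first.
  have hno' := hno; rewrite hlambda in hno'.
  have [N [hN [C hC]]] := max_code_growth (ltnSn 0)
    (growth_no_admissible halpha0 halpha1 hbeta0 p0 hp0 hp1 t1 t6 lt hno').
  exists N; split=> [d _|]; first exact: hN.
  exists C => d _; rewrite k_no_admissible // ltxx.
  by have := hC d; rewrite mul1r divr1.
have lam0 : 0 < lambda by rewrite hlambda divr_gt0 // subr_gt0.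
have lt' : lambda < t + t^-1 by rewrite hlambda.
have [n0 [G0 [hG0 hmin]]] := minimal_admissible p0 lam0 t1 t6 lt' hex.
have kE := k_minimal hG0 hmin.
have [n00 _ hl0] := hG0.
have mn := mult_lt G0 lam0 n00; have m0 := mult_gt0 hl0.
have e0 : (0 < n0 - mult lambda G0)%N by rewrite subn_gt0.
have grow : linear_code_growth alpha beta n0 (n0 - mult lambda G0).
  move: hG0 hmin; rewrite hlambda => hG0 hmin.
  exact: (growth_admissible halpha0 halpha1 hbeta0 p0 hp0 hp1 t1 t6 lt).
have [N [hN [C hC]]] := max_code_growth e0 grow.
exists N; split=> [d _|]; first exact: hN.
exists C => d _; rewrite kE ltry /=.
have mR : (mult lambda G0)%:R != 0 :> R by rewrite pnatr_eq0 -lt0n.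
have eR : n0%:R - (mult lambda G0)%:R != 0 :> R by rewrite gt_eqF // subr_gt0 ltr_nat.
suff -> : n0%:R / (mult lambda G0)%:R * d%:R / (n0%:R / (mult lambda G0)%:R - 1)
    = n0%:R * d%:R / (n0 - mult lambda G0)%:R :> R by exact: hC.
by rewrite natrB ?(ltnW mn) //; field; rewrite mR eR.
Qed.
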